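(* Let $L$ be an algebraic, possibly infinite, extension of $\mathbb{Q}$, let $Z\subseteq L$ be a number field such that $L$ is normal over $Z$, let $q>2$ be a rational prime, and let $\mathfrak p_Z$ be a prime of $Z$ not lying above $q$. Assume: (i) there is a non-negative integer $m_f$ such that every prime lying above $\mathfrak p_Z$ in any number field contained in $L$ has relative degree $f$ over $\mathfrak p_Z$ with $\mathrm{ord}_q f\le m_f$; (ii) there is a non-negative integer $m_e$ such that every prime lying above $\mathfrak p_Z$ in any number field contained in $L$ has ramification index $e$ over $\mathfrak p_Z$ with $e\le m_e$. Then there exists a subset $\mathcal{X}\subseteq L$ such that: (a) if $x\in\mathcal{X}$ then $x$ is integral at $\mathfrak p_Z$; (b) if $x\in Z$ and $x$ is integral at $\mathfrak p_Z$, then $x\in\mathcal{X}$; (c) $\mathcal{X}$ is Diophantine over $L$.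
   Context: An element $y$ of $L$ is ''integral at $\mathfrak p_Z$'' if for some (equivalently every) number field $M$ with $Z(y)\subseteq M\subseteq L$, $\mathrm{ord}_{\mathfrak p_M}y\ge 0$ for every prime $\mathfrak p_M$ of $M$ lying above $\mathfrak p_Z$. A subset $A$ of a field $R$ is Diophantine over $R$ if there is a polynomial $f(t,x_1,\dots,x_n)$ with coefficients in $R$ such that for all $t\in R$: $t\in A$ iff $\exists x_1,\dots,x_n\in R$ with $f(t,x_1,\dots,x_n)=0$. *)

(* Defs.v *)
From HB Require Import structures.
From mathcomp Require Import all_boot all_order all_algebra all_field.
From mathcomp Require Import mpoly.
Set Implicit Arguments. Unset Strict Implicit. Unset Printing Implicit Defensive.
Import Order.TTheory GRing.Theory Num.Theory.
Local Open Scope ring_scope.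

(* All algebraic extensions of Q are realised inside algC, the algebraic
   closure of Q.  Subsets of algC are Prop-valued predicates. *)
Definition cset := algC -> Prop.

Definition csubset (A B : cset) : Prop := forall x, A x -> B x.

Definition is_subfield (K : cset) : Prop :=
  K 0 /\ K 1 /\ (forall x y, K x -> K y -> K (x - y)) /\
  (forall x y, K x -> K y -> K (x * y)) /\ (forall x, K x -> K x^-1).

Definition is_number_field (K : cset) : Prop :=
  is_subfield K /\
  exists s : seq algC, (forall b, b \in s -> K b) /\
    forall x, K x -> exists r : seq algC,
      size r = size s /\ (forall c, c \in r -> c \in Crat) /\
      x = \sum_(i < size s) r`_i * s`_i.

Definition ring_of_integers (K : cset) : cset := fun x => K x /\ x \in Aint.

Definition is_prime_of (K : cset) (P : cset) : Prop :=
  let O := ring_of_integers K in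
  csubset P O /\ P 0 /\ (forall x y, P x -> P y -> P (x + y)) /\
  (forall a x, O a -> P x -> P (a * x)) /\ ~ P 1 /\
  (forall a b, O a -> O b -> P (a * b) -> P a \/ P b) /\
  (exists x, P x /\ x <> 0).

Definition lies_above (Z : cset) (P pZ : cset) : Prop :=
  forall x, ring_of_integers Z x -> (P x <-> pZ x).

Fixpoint idpow (O P : cset) (k : nat) : cset :=
  match k with
  | 0 => O
  | k'.+1 => fun x => exists s : seq (algC * algC),
      (forall ab, ab \in s -> P ab.1 /\ idpow O P k' ab.2) /\
      x = \sum_(ab <- s) ab.1 * ab.2
  end.

Definition ram_index (M : cset) (P pZ : cset) (e : nat) : Prop :=
  csubset pZ (idpow (ring_of_integers M) P e) /\
  ~ csubset pZ (idpow (ring_of_integers M) P e.+1).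

Definition residue_card (K : cset) (P : cset) (n : nat) : Prop :=
  exists s : seq algC, size s = n /\
    (forall x, x \in s -> ring_of_integers K x) /\
    (forall i j, (i < n)%N -> (j < n)%N -> i <> j -> ~ P (s`_i - s`_j)) /\
    (forall x, ring_of_integers K x -> exists2 y, y \in s & P (x - y)).

Definition rel_degree (M Z : cset) (P pZ : cset) (f : nat) : Prop :=
  exists n N, residue_card M P n /\ residue_card Z pZ N /\ n = (N ^ f)%N.

(* ord_P y >= 0 for y in M, P a prime of M: y = a/b with a, b in O_M,
   b <> 0 and ord_P a >= ord_P b *)
Definition ord_ge0 (M : cset) (P : cset) (y : algC) : Prop :=
  let O := ring_of_integers M in
  exists a b, O a /\ O b /\ b <> 0 /\ y = a / b /\
    forall k, idpow O P k b -> idpow O P k a.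

Definition integral_at (L Z pZ : cset) (y : algC) : Prop :=
  exists M, is_number_field M /\ csubset Z M /\ csubset M L /\ M y /\
    forall P, is_prime_of M P -> lies_above Z P pZ -> ord_ge0 M P y.

Definition normal_over (L Z : cset) : Prop :=
  forall sigma : {rmorphism algC -> algC},
    (forall z, Z z -> sigma z = z) -> forall x, L x -> L (sigma x).

Definition diophantine_over (L : cset) (A : cset) : Prop :=
  exists (n : nat) (p : {mpoly algC[n.+1]}),
    (forall m, L (mpoly.mcoeff m p)) /\
    forall t, L t ->
      (A t <-> exists v : 'I_n.+1 -> algC,
                 v ord0 = t /\ (forall i, L (v i)) /\ p.@[v] = 0).

(* Main.v *)
(* Let l be the prime below pZ.  Choose primes r such that e = q^k divides r - 1 and the order of
   l modulo r is divisible by the power of q in r - 1 up to a bounded factor, and let U be the set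
   of v such that kappa * v^f is a norm from the r-th cyclotomic extension for one of these r, a
   divisor f of (r - 1) / e and a kappa from a finite list.  Norms from this extension have,
   at a prime P with residue degree f_P over l, an order N such that the order of l modulo r
   divides f_P * N up to multiples of r - 1 (stable subspaces under a free action of Z/r have
   cardinality 1 modulo r).  As the q-part of f_P is bounded, the order of v at P is divisible by
   D = q^B, with B as large as wanted: it is taken such that lam, a multiple of l, has order less
   than D / 2.  Let X0 be the set of t such that (1 + lam t^D) b = 1 + lam^2 x has a solution with b
   and x products of 735 elements of U.  Comparing orders modulo D excludes ord t < 0.

   Every natural number t is in X0: a sieve in the progression of the solutions (b, x) of the
   linear equation produces b and x with few prime factors, all of them p such that
   p^((r - 1) / e) = 1 modulo one of the r, and by the pigeonhole principle such a p is in U.  Finally,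
   an element of Z integral at pZ is a quotient of an element of O_Z by an element of 1 + pZ, and both
   have integer coordinates on finitely many generators.  Finite conjunctions are Diophantine because
   a^D = lam b^D has only the trivial solution in L, again by comparing orders. *)
Require Import Defs.
From HB Require Import structures.
From mathcomp Require Import all_boot all_order all_algebra all_fingroup all_solvable all_field.
From mathcomp Require Import mxrepresentation mxabelem.
From mathcomp Require Import zify ring lra.
From Stdlib Require Import Classical ClassicalEpsilon.
Set Implicit Arguments. Unset Strict Implicit. Unset Printing Implicit Defensive.
Import Order.TTheory GRing.Theory Num.Theory.
Local Open Scope ring_scope.

(** * A combinatorial sieve *)

(** For a single r only one unit class in e consists of e-th powers, so most primes cannot be used.
    With R primes r the proportion of classes that are bad for all of them is (1 - 1/e)^R, as small
    as the sieve requires; this is why a list of r is needed. A sieve bounds the number of prime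
    factors of b and x but does not control their classes. The remedy is a symmetry: b and x are 1
    modulo each r, so a bad prime factor v has a cofactor in the inverse class, which is bad too.
    One of the two is at most the square root, and the pairs with such a small bad divisor are
    counted by sieving again. The coefficient lam^2 keeps three terms apart. If ord t < 0, the
    orders of (1 + lam t^D) b, 1 and lam^2 x are congruent to ord lam, 0 and 2 ord lam modulo D. As
    0 < 2 ord lam < D, these classes are distinct and the equation cannot balance. Norms are handled
    as determinants of matrices commuting with a companion matrix, so the factorization of the
    cyclotomic polynomial over a number field never enters. *)

Fixpoint esymf (j : nat) (a : seq rat) : rat :=
  if a is x :: s then esymf j s + x * (if j is j'.+1 then esymf j' s else 0)
  else (j == 0)%:R.

(** With [esymf j] the elementary symmetric function of degree j, [altsym m] is the alternating sum
    and [cumsym m] the plain sum of those of degree at most m; [altsym] truncates the expansion of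
    the product of the 1 - x. *)
Fixpoint altsym (m : nat) (a : seq rat) : rat :=
  if a is x :: s then altsym m s - x * (if m is m'.+1 then altsym m' s else 0)
  else 1.

Fixpoint cumsym (m : nat) (a : seq rat) : rat :=
  if a is x :: s then cumsym m s + x * (if m is m'.+1 then cumsym m' s else 0)
  else 1.

(** Each product of j entries at distinct places occurs j! times in the expanded power. The
    induction keeps only two terms of the binomial expansion of (x + S)^(j+1). *)
Lemma esym_bound j a : (forall x, x \in a -> 0 <= x) ->
  esymf j a * j`!%:R <= (\sum_(x <- a) x) ^+ j.
Proof.
elim: a j => [|x s IH] j h /=.
  by rewrite big_nil expr0n; case: j => [|j] /=; rewrite ?mul1r ?mul0r.
have hs y : y \in s -> 0 <= y by move=> ys; apply: h; rewrite inE ys orbT.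
have hx : 0 <= x by apply: h; rewrite inE eqxx.
have hS : 0 <= \sum_(y <- s) y by rewrite big_seq sumr_ge0.
rewrite big_cons; case: j => [|j].
  by rewrite mulr0 addr0 expr0; have := IH 0 hs; rewrite expr0.
rewrite mulrDl.
apply: le_trans (_ : (\sum_(y <- s) y) ^+ j.+1 + x * (j.+1%:R * (\sum_(y <- s) y) ^+ j) <= _).
  apply: lerD; first exact: IH.
  rewrite factS natrM -mulrA ler_wpM2l // mulrCA ler_wpM2l ?ler0n //.
  exact: IH.
set S := \sum_(y <- s) y in hS *.
elim: j {IH} => [|j IHj]; first by rewrite !expr1 expr0 !mulr1; lra.
rewrite [leRHS]exprS.
apply: le_trans (ler_wpM2l (addr_ge0 hx hS) IHj).
have h1 : 0 <= S ^+ j by rewrite exprn_ge0.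
have h2 : 0 <= j.+1%:R :> rat by rewrite ler0n.
rewrite !exprS -[j.+2%:R]natr1.
have : 0 <= x * x * j.+1%:R * S ^+ j by rewrite !mulr_ge0.
lra.
Qed.

Lemma cumsym_ge1 m a : (forall x, x \in a -> 0 <= x) -> 1 <= cumsym m a.
Proof.
elim: a m => [|x s IH] m h //=.
have hs y : y \in s -> 0 <= y by move=> ys; apply: h; rewrite inE ys orbT.
have hx : 0 <= x by apply: h; rewrite inE eqxx.
case: m => [|m]; first by rewrite mulr0 addr0; exact: IH.
have := IH m.+1 hs; have := IH m hs => h1 h2.
have : 0 <= x * cumsym m s by rewrite mulr_ge0 //; lra.
lra.
Qed.

Lemma cumsym_bound m a : (forall x, x \in a -> 0 <= x) ->
  cumsym m a <= (1 + \sum_(x <- a) x) ^+ m.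
Proof.
elim: a m => [|x s IH] m h /=; first by rewrite big_nil addr0 expr1n.
have hs y : y \in s -> 0 <= y by move=> ys; apply: h; rewrite inE ys orbT.
have hx : 0 <= x by apply: h; rewrite inE eqxx.
have hS : 0 <= \sum_(y <- s) y by rewrite big_seq sumr_ge0.
rewrite big_cons; case: m => [|m].
  by rewrite mulr0 addr0 expr0; have := IH 0 hs; rewrite expr0.
have h1 := IH m.+1 hs; have h2 := IH m hs.
set S := \sum_(y <- s) y in hS h1 h2 *.
apply: le_trans (_ : (1 + S) ^+ m.+1 + x * (1 + S) ^+ m <= _).
  by apply: lerD => //; apply: ler_wpM2l.
have -> : (1 + S) ^+ m.+1 + x * (1 + S) ^+ m = (1 + (x + S)) * (1 + S) ^+ m.
  by rewrite exprS; ring.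
rewrite exprS; apply: ler_wpM2l; first lra.
by apply: lerXn2r; rewrite ?nnegrE; lra.
Qed.

Lemma esym_le_cumsym m a : (forall x, x \in a -> 0 <= x) ->
  esymf m a <= cumsym m a.
Proof.
elim: a m => [|x s IH] m h /=; first by rewrite lern1; case: (m).
have hs y : y \in s -> 0 <= y by move=> ys; apply: h; rewrite inE ys orbT.
have hx : 0 <= x by apply: h; rewrite inE eqxx.
apply: lerD; first exact: IH.
by case: m => [|m] //; apply: ler_wpM2l => //; apply: IH.
Qed.

Lemma cumsymS m a : (forall x, x \in a -> 0 <= x) ->
  cumsym m a <= cumsym m.+1 a.
Proof.
elim: a m => [|x s IH] m h //=.
have hs y : y \in s -> 0 <= y by move=> ys; apply: h; rewrite inE ys orbT.
have hx : 0 <= x by apply: h; rewrite inE eqxx.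
apply: lerD; first exact: IH.
case: m => [|m]; last by apply: ler_wpM2l => //; apply: IH.
by rewrite mulr0 mulr_ge0 //; have := cumsym_ge1 0 hs; lra.
Qed.

Lemma prod_1sub_itv (a : seq rat) : (forall x, x \in a -> 0 <= x <= 1) ->
  0 <= \prod_(x <- a) (1 - x) <= 1.
Proof.
move=> h; elim: a h => [|x s IH] h; first by rewrite big_nil ler01 lexx.
have hs y : y \in s -> 0 <= y <= 1 by move=> ys; apply: h; rewrite inE ys orbT.
have /andP[hx0 hx1] : 0 <= x <= 1 by apply: h; rewrite inE eqxx.
have /andP[h0 h1] := IH hs.
rewrite big_cons mulr_ge0 ?subr_ge0 //=.
by apply: mulr_ile1 => //; lra.
Qed.

(* Bonferroni's inequalities, in weighted form: they are applied both to the
   indicators of the sifting conditions and to their densities. *)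
Lemma bonferroni m a : (forall x, x \in a -> 0 <= x <= 1) ->
  0 <= (-1) ^+ m * (altsym m a - \prod_(x <- a) (1 - x)) <= esymf m.+1 a.
Proof.
elim: a m => [|x s IH] m h; first by rewrite big_nil /= subrr mulr0 lexx.
have hs y : y \in s -> 0 <= y <= 1 by move=> ys; apply: h; rewrite inE ys orbT.
have /andP[hx0 hx1] : 0 <= x <= 1 by apply: h; rewrite inE eqxx.
have /andP[hV0 hV1] := prod_1sub_itv hs.
rewrite big_cons; have /andP[h1 h2] := IH m hs.
case: m h1 h2 => [|m] h1 h2.
  rewrite expr0 mul1r /= mulr0 subr0 in h1 h2 *.
  have he : esymf 0 s = 1.
    by elim: (s) => [|y t IHt] //=; rewrite mulr0 addr0.
  rewrite he; set V := \prod_(y <- s) _ in hV0 hV1 h1 h2 *.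
  have : 0 <= x * V by rewrite mulr_ge0.
  have : x * V <= x * 1 by rewrite ler_wpM2l.
  by move=> *; apply/andP; split; lra.
have /andP[h3 h4] := IH m hs.
rewrite [esymf _ _]/= [altsym _ _]/=.
set V := \prod_(y <- s) _ in hV0 hV1 h1 h2 h3 h4 *.
have -> : (-1) ^+ m.+1 * (altsym m.+1 s - x * altsym m s - (1 - x) * V) =
  (-1) ^+ m.+1 * (altsym m.+1 s - V) + x * ((-1) ^+ m * (altsym m s - V)).
  by rewrite exprS; ring.
apply/andP; split; first by apply: addr_ge0 => //; apply: mulr_ge0.
by apply: lerD => //; apply: ler_wpM2l.
Qed.

(* A block [(m, P)] sifts by the primes of [P], truncating Bonferroni's
   inequality at level [2 m]. *)
Notation block := (nat * seq nat)%type.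

(** * Upper and lower sieve weights by blocks *)

Section Sift.
Variables (I : nat) (bad : nat -> pred nat) (k : nat -> nat) (ok : pred nat).

Let g p : rat := (k p)%:R / p%:R.
Let ind p i : rat := (bad p i)%:R.

Hypothesis level : forall D, uniq D -> all ok D ->
  `| \sum_(0 <= i < I) \prod_(p <- D) ind p i - I%:R * \prod_(p <- D) g p |
    <= \prod_(p <- D) (k p)%:R.

Hypothesis g01 : forall p, ok p -> 0 <= g p <= 1.

(** Approximate independence: [f] has mean [mu] and is uncorrelated with the conditions at primes
    outside [S], with error factor [nu]. Quantifying over all [D] is what allows a condition to be
    moved into the weight. *)
Definition regular (S : seq nat) (f : nat -> rat) (mu nu : rat) :=
  forall D, uniq D -> all ok D -> ~~ has (mem S) D ->
  `| \sum_(0 <= i < I) (\prod_(p <- D) ind p i) * f i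
     - I%:R * (\prod_(p <- D) g p) * mu | <= (\prod_(p <- D) (k p)%:R) * nu.

Lemma regular1 : regular [::] (fun=> 1) 1 1.
Proof.
move=> D uD oD _; rewrite !mulr1 (eq_bigr (fun i => \prod_(p <- D) ind p i)) ?level // => i _.
by rewrite mulr1.
Qed.

Lemma regular_sub S S' f mu nu : {subset S <= S'} ->
  regular S f mu nu -> regular S' f mu nu.
Proof.
move=> sub h D uD oD hD; apply: h => //.
by apply: contra hD => /hasP[x xD xS]; apply/hasP; exists x => //; apply: sub.
Qed.

(** A set [D] for the new weight is the set [p :: D] for the old one. *)
Lemma regular_mul S f mu nu p : ok p -> p \notin S ->
  regular S f mu nu ->
  regular (p :: S) (fun i => ind p i * f i) (g p * mu) ((k p)%:R * nu).
Proof.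
move=> okp pS h D uD oD hD.
move: hD; rewrite has_sym /= negb_or => /andP[pD hD].
have := h (p :: D); rewrite /= pD uD okp oD /= negb_or => /(_ isT isT).
rewrite has_sym hD (negbTE pS).
move=> /(_ isT); rewrite !big_cons.
set A := \sum_(_ <= _ < _) _; set B := \sum_(_ <= _ < _) _.
have -> : A = B by apply: eq_bigr => i _; rewrite big_cons; ring.
set G := \prod_(j <- D) g j; set K := \prod_(j <- D) (k j)%:R.
have -> : I%:R * G * (g p * mu) = I%:R * (g p * G) * mu by ring.
by have -> : K * ((k p)%:R * nu) = (k p)%:R * K * nu by ring.
Qed.

Lemma regularD S f1 mu1 nu1 f2 mu2 nu2 c : 
  regular S f1 mu1 nu1 -> regular S f2 mu2 nu2 -> `|c| = 1 ->
  regular S (fun i => f1 i + c * f2 i) (mu1 + c * mu2) (nu1 + nu2).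
Proof.
move=> h1 h2 c1 D uD oD hD.
have e1 := h1 D uD oD hD; have e2 := h2 D uD oD hD.
set Pi := \prod_(p <- D) (k p)%:R in e1 e2 *.
set G := \prod_(p <- D) g p in e1 e2 *.
have -> : \sum_(0 <= i < I) \prod_(p <- D) ind p i * (f1 i + c * f2 i) =
  \sum_(0 <= i < I) \prod_(p <- D) ind p i * f1 i +
   c * \sum_(0 <= i < I) \prod_(p <- D) ind p i * f2 i.
  by rewrite mulr_sumr -big_split; apply: eq_bigr => i _ /=; ring.
set A := \sum_(_ <= _ < _) _ in e1 *; set B := \sum_(_ <= _ < _) _ in e2 *.
have -> : A + c * B - I%:R * G * (mu1 + c * mu2) =
  (A - I%:R * G * mu1) + c * (B - I%:R * G * mu2) by ring.
by rewrite [leRHS]mulrDr (le_trans (ler_normD _ _)) // lerD // normrM c1 mul1r.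
Qed.

Lemma regular_ext S f f' mu mu' nu nu' : f =1 f' -> mu = mu' -> nu = nu' ->
  regular S f mu nu -> regular S f' mu' nu'.
Proof.
move=> e <- <- h D uD oD hD.
rewrite (eq_bigr (fun i => \prod_(p <- D) ind p i * f i)) ?h // => i _.
by rewrite e.
Qed.

Lemma regular_le S f mu nu nu' : nu <= nu' ->
  regular S f mu nu -> regular S f mu nu'.
Proof.
move=> le h D uD oD hD; apply: le_trans (h D uD oD hD) _.
by apply: ler_wpM2l => //; rewrite prodr_ge0.
Qed.

Lemma regular_altsym P m S f mu nu : uniq P -> all ok P -> ~~ has (mem S) P ->
  regular S f mu nu ->
  regular (P ++ S) (fun i => altsym m [seq ind p i | p <- P] * f i)
    (altsym m [seq g p | p <- P] * mu)
    (cumsym m [seq (k p)%:R | p <- P] * nu).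
Proof.
move=> uP oP hP h; elim: P m uP oP hP => [|p P IH] m /=.
  by move=> _ _ _; rewrite !mul1r; apply: regular_ext h => // i; rewrite mul1r.
move=> /andP[pP uP] /andP[op oP]; rewrite negb_or => /andP[pS hP].
have h1 : regular (p :: P ++ S)
    (fun i => altsym m [seq ind p i | p <- P] * f i)
    (altsym m [seq g p | p <- P] * mu) (cumsym m [seq (k p)%:R | p <- P] * nu).
  by apply: regular_sub (IH m uP oP hP) => x xP; rewrite inE xP orbT.
case: m h1 => [|m] h1.
  rewrite !mulr0 subr0 addr0; apply: regular_ext h1 => // i.
  by rewrite mulr0 subr0.
have pPS : p \notin P ++ S by rewrite mem_cat negb_or pP.
have h2 := regular_mul op pPS (IH m uP oP hP).
have c1 : `|- 1 : rat| = 1 by rewrite normrN normr1.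
have := regularD h1 h2 c1; apply: regular_ext => [i||] /=; ring.
Qed.

Lemma regular_esym P m S f mu nu : uniq P -> all ok P -> ~~ has (mem S) P ->
  regular S f mu nu -> 0 <= nu ->
  regular (P ++ S) (fun i => esymf m [seq ind p i | p <- P] * f i)
    (esymf m [seq g p | p <- P] * mu)
    (esymf m [seq (k p)%:R | p <- P] * nu).
Proof.
move=> uP oP hP h nu0; elim: P m uP oP hP => [|p P IH] m /=.
  move=> _ _ _; case: m => [|m]; first by rewrite !mul1r; apply: regular_ext h => // i; rewrite mul1r.
  move=> D _ _ _; rewrite !mul0r !mulr0 subr0 big1 ?normr0 // => i _.
  by rewrite mul0r mulr0.
move=> /andP[pP uP] /andP[op oP]; rewrite negb_or => /andP[pS hP].
have h1 : regular (p :: P ++ S)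
    (fun i => esymf m [seq ind p i | p <- P] * f i)
    (esymf m [seq g p | p <- P] * mu) (esymf m [seq (k p)%:R | p <- P] * nu).
  by apply: regular_sub (IH m uP oP hP) => x xP; rewrite inE xP orbT.
case: m h1 => [|m] h1.
  rewrite !mulr0 !addr0; apply: regular_ext h1 => // i.
  by rewrite mulr0 addr0.
have pPS : p \notin P ++ S by rewrite mem_cat negb_or pP.
have h2 := regular_mul op pPS (IH m uP oP hP).
have := regularD h1 h2 (normr1 _); apply: regular_ext => [i||] /=; ring.
Qed.

Definition upf (Bs : seq block) i : rat :=
  \prod_(B <- Bs) altsym B.1.*2 [seq ind p i | p <- B.2].
Definition upmu (Bs : seq block) : rat :=
  \prod_(B <- Bs) altsym B.1.*2 [seq g p | p <- B.2].
(** One degree more than in [upf], so as to bound also the error of the first omitted term that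
    occurs in [lowf]. *)
Definition bnorm (B : block) : rat := cumsym B.1.*2.+1 [seq (k p)%:R | p <- B.2].

(** The lower weight of the Brun-Hooley sieve. With y the truncated sum of the block, V its
    indicator and e the first omitted term, V >= y - e. After multiplication by the indicator of the
    other blocks, y is paired with their lower weight and e with their upper one. *)
Fixpoint lowf (Bs : seq block) i : rat :=
  if Bs is B :: Bs' then altsym B.1.*2 [seq ind p i | p <- B.2] * lowf Bs' i
     - esymf B.1.*2.+1 [seq ind p i | p <- B.2] * upf Bs' i else 1.
Fixpoint lowmu (Bs : seq block) : rat :=
  if Bs is B :: Bs' then altsym B.1.*2 [seq g p | p <- B.2] * lowmu Bs'
     - esymf B.1.*2.+1 [seq g p | p <- B.2] * upmu Bs' else 1.

Definition sifted (Bs : seq block) i := all (fun B : block => ~~ has (bad^~ i) B.2) Bs.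
Definition dens (Bs : seq block) : rat := \prod_(B <- Bs) \prod_(p <- B.2) (1 - g p).
Definition rem (Bs : seq block) : rat := \prod_(B <- Bs) bnorm B.
Definition support (Bs : seq block) := flatten [seq B.2 | B <- Bs].

Lemma k_ge0 P x : x \in [seq (k p)%:R : rat | p <- P] -> 0 <= x.
Proof. by move=> /mapP[p _ ->]. Qed.

Lemma bnorm_ge1 B : 1 <= bnorm B. Proof. exact: cumsym_ge1 (@k_ge0 _). Qed.

Lemma rem_ge1 Bs : 1 <= rem Bs.
Proof.
rewrite /rem; elim: Bs => [|B Bs IH]; rewrite ?big_nil // big_cons.
have h := bnorm_ge1 B; apply: le_trans (h) _; rewrite ler_peMr //.
exact: le_trans ler01 h.
Qed.

Lemma regular_up Bs : uniq (support Bs) -> all ok (support Bs) ->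
  regular (support Bs) (upf Bs) (upmu Bs) (rem Bs).
Proof.
rewrite /upf /upmu /rem; elim: Bs => [|B Bs IH].
  by move=> _ _; rewrite !big_nil; apply: regular_ext regular1 => // i; rewrite big_nil.
rewrite /support /= cat_uniq all_cat => /and3P[uB hB uBs] /andP[oB oBs].
have hB' : ~~ has (mem (support Bs)) B.2.
  by apply: contra hB => /hasP[x x1 x2]; apply/hasP; exists x.
have := regular_altsym (B.1.*2) uB oB hB' (IH uBs oBs).
rewrite !big_cons => h; apply: regular_le (_ : _ <= _) _; last first.
  by apply: regular_ext h => // i; rewrite big_cons.
apply: ler_wpM2r; first by have := rem_ge1 Bs; rewrite /rem; lra.
exact: cumsymS (@k_ge0 _).
Qed.

(** Each block adds one upper weight to the recursion, hence the factor [(size Bs).+1]. *)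
Lemma regular_low Bs : uniq (support Bs) -> all ok (support Bs) ->
  regular (support Bs) (lowf Bs) (lowmu Bs) ((size Bs).+1%:R * rem Bs).
Proof.
elim: Bs => [|B Bs IH] us os.
  rewrite /rem big_nil mulr1 /=; apply: regular_ext regular1 => //.
move: (us) (os); rewrite /support /= cat_uniq all_cat => /and3P[uB hB uBs] /andP[oB oBs].
have hB' : ~~ has (mem (support Bs)) B.2.
  by apply: contra hB => /hasP[x x1 x2]; apply/hasP; exists x.
have r0 : 0 <= rem Bs by have := rem_ge1 Bs; lra.
have h1 := regular_altsym (B.1.*2) uB oB hB' (IH uBs oBs).
have h2 := regular_esym (B.1.*2.+1) uB oB hB' (regular_up uBs oBs) r0.
have c1 : `|- 1 : rat| = 1 by rewrite normrN normr1.
have h := regularD h1 h2 c1.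
apply: regular_le (_ : _ <= _) _; last by apply: regular_ext h => // [i|]; rewrite mulN1r.
rewrite /rem big_cons -/(rem Bs) /bnorm.
have e1 := cumsymS (B.1.*2) (@k_ge0 B.2).
have e2 := esym_le_cumsym (B.1.*2.+1) (@k_ge0 B.2).
set c := cumsym _.+1 _ in e1 e2 *.
have -> : (size Bs).+2%:R = (size Bs).+1%:R + 1 :> rat by rewrite natr1.
set n := (size Bs).+1%:R : rat; have n0 : 0 <= n by rewrite ler0n.
apply: le_trans (lerD (ler_wpM2r (mulr_ge0 n0 r0) e1) (ler_wpM2r r0 e2)) _.
by rewrite le_eqVlt; apply/orP; left; apply/eqP; rewrite /= /n; ring.
Qed.

Lemma sifted_ind P i :
  \prod_(x <- [seq ind p i | p <- P]) (1 - x) = (~~ has (bad^~ i) P)%:R :> rat.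
Proof.
elim: P => [|p P IH]; first by rewrite big_nil.
rewrite /= big_cons IH /ind; case: (bad p i) => /=; first by rewrite subrr mul0r.
by rewrite subr0 mul1r.
Qed.

Lemma ind01 P i x : x \in [seq ind p i | p <- P] -> 0 <= x <= 1.
Proof. by move=> /mapP[p _ ->]; rewrite /ind; case: (bad p i). Qed.

Lemma even_bonferroni m (a : seq rat) : (forall x, x \in a -> 0 <= x <= 1) ->
  \prod_(x <- a) (1 - x) <= altsym m.*2 a <= \prod_(x <- a) (1 - x) + esymf m.*2.+1 a.
Proof.
move=> h; have := bonferroni m.*2 h.
by rewrite -signr_odd odd_double expr0 mul1r subr_ge0 lerBlDl.
Qed.

Lemma up_ge_sifted Bs i : (sifted Bs i)%:R <= upf Bs i.
Proof.
rewrite /upf; elim: Bs => [|B Bs IH]; first by rewrite big_nil.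
rewrite big_cons /= -mulnb natrM; apply: ler_pM => //.
by have /andP[h _] := even_bonferroni B.1 (@ind01 B.2 i); rewrite -sifted_ind.
Qed.

Lemma low_le_sifted Bs i : lowf Bs i <= (sifted Bs i)%:R.
Proof.
elim: Bs => [|B Bs IH] //=.
rewrite -mulnb natrM -sifted_ind.
have /andP[h1 h2] := even_bonferroni B.1 (@ind01 B.2 i).
have h3 := up_ge_sifted Bs i.
have : 0 <= \prod_(x <- [seq ind p i | p <- B.2]) (1 - x).
  by have /andP[] := prod_1sub_itv (@ind01 B.2 i).
set V := \prod_(_ <- _) _ in h1 h2 *; move=> V0.
set y := altsym _ _ in h1 h2 *; set e := esymf _ _ in h2 *.
have s0 : 0 <= (sifted Bs i)%:R :> rat by [].
have y0 : 0 <= y by lra.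
have := ler_wpM2l y0 IH.
have ve : y - V <= e by lra.
have := ler_wpM2r s0 ve.
have e0 : 0 <= e by lra.
have := ler_wpM2l e0 h3.
lra.
Qed.

Section Main.
Variables (Bs : seq block) (delta : block -> rat).
Hypothesis uBs : uniq (support Bs).
Hypothesis oBs : all ok (support Bs).
Hypothesis dB : forall B, B \in Bs -> 0 <= delta B /\
  esymf B.1.*2.+1 [seq g p | p <- B.2] <= delta B * \prod_(p <- B.2) (1 - g p).
Hypothesis sumd : \sum_(B <- Bs) delta B <= 2^-1.

Lemma g01P B : B \in Bs -> forall x, x \in [seq g p | p <- B.2] -> 0 <= x <= 1.
Proof.
move=> BB x /mapP[p pB ->]; apply: g01; apply: (allP oBs).
by apply/flattenP; exists B.2 => //; apply: map_f.
Qed.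

Lemma block_mu B : B \in Bs ->
  [/\ 0 <= \prod_(p <- B.2) (1 - g p),
      \prod_(p <- B.2) (1 - g p) <= altsym B.1.*2 [seq g p | p <- B.2] &
      altsym B.1.*2 [seq g p | p <- B.2] <= (1 + delta B) * \prod_(p <- B.2) (1 - g p)].
Proof.
move=> BB; have h := g01P BB.
have /andP[h1 h2] := even_bonferroni B.1 h.
have /andP[h3 _] := prod_1sub_itv h.
rewrite !big_map in h1 h2 h3; have [_ h4] := dB BB; split=> //.
by rewrite mulrDl mul1r; apply: le_trans h2 _; rewrite lerD2l.
Qed.

Lemma prod_1add (a : seq block) : (forall B, B \in a -> 0 <= delta B) ->
  0 <= \prod_(B <- a) (1 + delta B) /\
  \prod_(B <- a) (1 + delta B) * (1 - \sum_(B <- a) delta B) <= 1.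
Proof.
elim: a => [|B a IH] h; first by rewrite !big_nil subr0 mulr1.
have [h1 h2] := IH (fun x xa => h x (mem_behead (s := B :: a) xa)).
have d0 : 0 <= delta B by apply: h; rewrite inE eqxx.
have s0 : 0 <= \sum_(B <- a) delta B.
  by rewrite big_seq sumr_ge0 // => x xa; apply: h; rewrite inE xa orbT.
rewrite !big_cons; set P := \prod_(_ <- _) _ in h1 h2 *.
set S := \sum_(_ <- _) _ in s0 h2 *; split; first by apply: mulr_ge0 => //; lra.
have : 0 <= P * (delta B * (delta B + S)) by rewrite !mulr_ge0 ?addr_ge0.
have -> : (1 + delta B) * P * (1 - (delta B + S)) =
   P * (1 - S) - P * (delta B * (delta B + S)) by ring.
lra.
Qed.

(** Truncation multiplies the density of a block by at most 1 + delta, and the product of these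
    factors is at most 1 / (1 - sum of the delta), so at most 2. *)
Lemma up_mu : 0 <= dens Bs <= upmu Bs /\ upmu Bs <= 2 * dens Bs.
Proof.
have h : forall a : seq block, {subset a <= Bs} ->
    0 <= dens a <= upmu a /\ upmu a <= \prod_(B <- a) (1 + delta B) * dens a.
  rewrite /dens /upmu; elim=> [|B a IH] sub; first by rewrite !big_nil mulr1; split.
  have [/andP[h1 h2] h3] := IH (fun x xa => sub x (mem_behead (s := B :: a) xa)).
  have [h4 h5 h6] := block_mu (sub B (mem_head _ _)).
  rewrite !big_cons; split.
    by rewrite mulr_ge0 //=; apply: ler_pM.
  rewrite mulrACA; apply: ler_pM => //; first exact: le_trans h5.
  exact: le_trans h2.
have [/andP[h1 h2] h3] := h Bs (fun x => id).
have [p0 p1] := prod_1add (fun B BB => (dB BB).1).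
split; first by rewrite h1.
apply: le_trans h3 _; apply: ler_wpM2r => //.
set P := \prod_(_ <- _) _ in p0 p1 *.
have : P * 2^-1 <= P * (1 - \sum_(B <- Bs) delta B).
  by apply: ler_wpM2l => //; have := sumd; lra.
lra.
Qed.

(** By induction [lowmu] is at least (1 - sum of the delta) times [upmu]: the loss in a block is e
    <= delta V <= delta y times the upper mean of the others. *)
Lemma low_mu : dens Bs / 2 <= lowmu Bs.
Proof.
have h : forall a : seq block, {subset a <= Bs} ->
    0 <= upmu a /\ upmu a * (1 - \sum_(B <- a) delta B) <= lowmu a.
  rewrite /upmu; elim=> [|B a IH] sub; first by rewrite !big_nil subr0 mulr1; split.
  have [h1 h3] := IH (fun x xa => sub x (mem_behead (s := B :: a) xa)).
  have [h4 h5 h6] := block_mu (sub B (mem_head _ _)).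
  have [d0 d1] := dB (sub B (mem_head _ _)).
  have y0 := le_trans h4 h5.
  rewrite !big_cons /= -/(upmu a); split; first by rewrite mulr_ge0.
  rewrite -/(upmu a) in h1 h3; set y := altsym _ _ in h5 h6 y0 *.
  set e := esymf _ _ in d1 *; set V := \prod_(_ <- _) _ in h4 h5 h6 d1.
  have := ler_wpM2l y0 h3.
  have e1 : e <= delta B * y by apply: le_trans d1 _; apply: ler_wpM2l.
  have := ler_wpM2r h1 e1.
  lra.
have [h1 h2] := h Bs (fun x => id).
have [/andP[h3 h4] _] := up_mu.
have : upmu Bs * 2^-1 <= upmu Bs * (1 - \sum_(B <- Bs) delta B).
  by apply: ler_wpM2l => //; have := sumd; lra.
lra.
Qed.

Lemma sieve_bounds :
  \sum_(0 <= i < I) (sifted Bs i)%:R <= 2 * I%:R * dens Bs + rem Bs /\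
  I%:R * dens Bs / 2 - (size Bs).+1%:R * rem Bs <= \sum_(0 <= i < I) (sifted Bs i)%:R.
Proof.
have [/andP[h3 h4] h5] := up_mu; have h6 := low_mu.
have I0 : 0 <= I%:R :> rat by rewrite ler0n.
split.
  have := regular_up uBs oBs isT isT (D := [::]); move=> /(_ isT).
  rewrite !big_nil mulr1 mul1r; under eq_bigr do rewrite big_nil mul1r.
  rewrite ler_norml => /andP[_]; rewrite lerBlDl => h.
  apply: le_trans (_ : \sum_(0 <= i < I) upf Bs i <= _).
    by apply: ler_sum => i _; apply: up_ge_sifted.
  apply: le_trans h _; rewrite lerD2r; have := ler_wpM2l I0 h5; lra.
have := regular_low uBs oBs isT isT (D := [::]); move=> /(_ isT).
rewrite !big_nil mulr1 mul1r; under eq_bigr do rewrite big_nil mul1r.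
rewrite ler_norml => /andP[+ _]; rewrite lerBrDl => h.
apply: le_trans (_ : \sum_(0 <= i < I) lowf Bs i <= _); last first.
  by apply: ler_sum => i _; apply: low_le_sifted.
apply: le_trans _ h; have := ler_wpM2l I0 h6; lra.
Qed.
End Main.
End Sift.

(** * Counting in residue classes *)

Lemma sum_residue_full (q M a : nat) : (a < M)%N ->
  (\sum_(0 <= i < q * M) (i %% M == a) = q)%N.
Proof.
move=> aM; elim: q => [|q IH]; first by rewrite mul0n big_nil.
rewrite (@big_cat_nat _ _ _ (q * M)) //=; last by rewrite leq_mul2r leqnSn orbT.
rewrite IH mulSn addnC -{1}[(q * M)%N]add0n addnC big_addn addnK.
rewrite (eq_big_nat _ _ (F2 := fun i => (i == a : nat))); last first.
  by move=> i /andP[_ iM]; rewrite addnC modnMDl modn_small.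
rewrite (bigD1_seq a) /= ?mem_index_iota ?iota_uniq //.
by rewrite eqxx big1 ?addn0 ?addn1 // => i /negbTE ->.
Qed.

Lemma sum_residue_bound (I M a : nat) : (a < M)%N ->
  `| \sum_(0 <= i < I) (i %% M == a)%N%:R - I%:R / M%:R | <= 1 :> rat.
Proof.
move=> aM; have M0 : (0 < M)%N by apply: leq_ltn_trans aM.
have Mr : 0 < M%:R :> rat by rewrite ltr0n.
set S := \sum_(_ <= _ < _) _.
have -> : S = (\sum_(0 <= i < I) (i %% M == a))%N%:R by rewrite natr_sum.
have mono m n : (m <= n)%N ->
    (\sum_(0 <= i < m) (i %% M == a) <= \sum_(0 <= i < n) (i %% M == a))%N.
  by move=> mn; rewrite [leqRHS](@big_cat_nat _ _ _ m) //= leq_addr.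
have h1 : (I %/ M <= \sum_(0 <= i < I) (i %% M == a))%N.
  by rewrite -{1}(sum_residue_full (I %/ M) aM) mono // leq_trunc_div.
have h2 : (\sum_(0 <= i < I) (i %% M == a) <= (I %/ M).+1)%N.
  by rewrite -(sum_residue_full (I %/ M).+1 aM) mono // ltnW // ltn_ceil.
rewrite ler_norml; apply/andP; split.
  rewrite lerBrDl lerBlDr ler_pdivrMr // mulrDl mul1r.
  have : (I <= I %/ M * M + M)%N by rewrite addnC -mulSn ltnW // ltn_ceil.
  rewrite -(ler_nat rat) natrD natrM => h; apply: le_trans h _.
  by rewrite lerD2r ler_wpM2r ?ler0n // ler_nat.
rewrite lerBlDr addrC -lerBlDr; apply: le_trans (_ : (I %/ M)%:R <= _).
  by rewrite lerBlDr natr1 ler_nat.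
by rewrite ler_pdivlMr // -natrM ler_nat leq_trunc_div.
Qed.

Section Crt.
Variables (bad : nat -> pred nat) (k : nat -> nat) (ok : pred nat).
Hypothesis okp : forall p, ok p -> prime p /\
  exists W : seq nat, [/\ uniq W, size W = k p, all (fun a => a < p)%N W &
    forall i, bad p i = (i %% p \in W)%N].

Lemma crt_residues D : uniq D -> all ok D ->
  exists W : seq nat, [/\ uniq W, size W = (\prod_(p <- D) k p)%N,
    all (fun a => a < \prod_(p <- D) p)%N W &
    forall i, all (bad^~ i) D = (i %% (\prod_(p <- D) p) \in W)%N].
Proof.
elim: D => [|p D IH] /=.
  move=> _ _; exists [:: 0%N]; split; rewrite ?big_nil //= => i.
  by rewrite modn1.
move=> /andP[pD uD] /andP[okpp oD]; have [W [uW sW aW bW]] := IH uD oD.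
have [pp [V [uV sV aV bV]]] := okp okpp.
set M := (\prod_(q <- D) q)%N in aW bW.
have co : coprime p M.
  rewrite /M; elim: (D) pD oD => [|q E IHE]; first by rewrite big_nil coprimen1.
  rewrite inE negb_or => /andP[pq pE] /= /andP[oq oE].
  rewrite big_cons coprimeMr IHE // andbT prime_coprime // dvdn_prime2 //.
  by have [] := okp oq.
have M0 : (0 < M)%N.
  rewrite /M big_seq_cond prodn_cond_gt0 // => q; rewrite andbT => qD.
  by have [/prime_gt0] := okp (allP oD _ qD).
have p0 := prime_gt0 pp.
rewrite !big_cons -/M.
exists [seq (chinese p M a b %% (p * M))%N | a <- V, b <- W]; split.
- apply: allpairs_uniq => // -[a b] [a' b'] /allpairsP[[a1 b1] /= [h1 h2 [-> ->]]].
  move=> /allpairsP[[a2 b2] /= [h3 h4 [-> ->]]] /= e.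
  have ea : (a1 %% p = a2 %% p)%N.
    rewrite -(chinese_modl co a1 b1) -(chinese_modl co a2 b2).
    by rewrite -(modn_dvdm _ (dvdn_mulr M (dvdnn p))) e modn_dvdm // dvdn_mulr.
  have eb : (b1 %% M = b2 %% M)%N.
    rewrite -(chinese_modr co a1 b1) -(chinese_modr co a2 b2).
    by rewrite -(modn_dvdm _ (dvdn_mull p (dvdnn M))) e modn_dvdm // dvdn_mull.
  by move: ea eb; rewrite !modn_small ?(allP aV) ?(allP aW) // => -> ->.
- by rewrite size_allpairs sV sW.
- by apply/allP => x /allpairsP[[a b] /= [_ _ ->]]; rewrite ltn_mod muln_gt0 p0 M0.
move=> i; rewrite bV bW; apply/andP/allpairsP => [[h1 h2]|[[a b] /= [h1 h2 e]]].
  by exists (i %% p, i %% M)%N; split => //=; rewrite -chinese_mod.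
have -> : (i %% p = a)%N.
  rewrite -(modn_dvdm _ (dvdn_mulr M (dvdnn p))) e modn_dvdm ?dvdn_mulr //.
  by rewrite chinese_modl // modn_small // (allP aV).
have -> // : (i %% M = b)%N.
  rewrite -(modn_dvdm _ (dvdn_mull p (dvdnn M))) e modn_dvdm ?dvdn_mull //.
  by rewrite chinese_modr // modn_small // (allP aW).
Qed.

(** Each of the classes modulo the product of [D] contributes its share of the I indices up to an
    error of at most 1, and there are as many classes as the product of the [k p]. *)
Lemma crt_level I D : uniq D -> all ok D ->
  `| \sum_(0 <= i < I) \prod_(p <- D) (bad p i)%:R
      - I%:R * \prod_(p <- D) ((k p)%:R / p%:R) |
    <= \prod_(p <- D) (k p)%:R :> rat.
Proof.
move=> uD oD; have [W [uW sW aW bW]] := crt_residues uD oD.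
set M := (\prod_(q <- D) q)%N in aW bW.
have e i : \prod_(p <- D) (bad p i)%:R = \sum_(a <- W) (i %% M == a)%N%:R :> rat.
  transitivity ((all (bad^~ i) D)%:R : rat).
    elim: (D) => [|p E IH]; first by rewrite big_nil.
    by rewrite big_cons IH /= -natrM mulnb.
  rewrite bW; elim: (W) uW => [|a V IH]; first by rewrite big_nil.
  rewrite big_cons inE /= => /andP[aV uV]; rewrite -IH //.
  by case: eqP => [->|] /=; rewrite ?add0r // (negbTE aV) addr0.
rewrite (eq_bigr (fun i => \sum_(a <- W) (i %% M == a)%N%:R)); last by move=> i _; exact: e.
rewrite exchange_big /=.
have M0 : (0 < M)%N.
  rewrite /M big_seq_cond prodn_cond_gt0 // => q; rewrite andbT => qD.
  by have [/prime_gt0] := okp (allP oD _ qD).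
have -> : \prod_(p <- D) ((k p)%:R / p%:R) = \sum_(a <- W) (M%:R)^-1 :> rat.
  by rewrite big_const_seq count_predT iter_addr_0 sW prodf_div -[RHS]mulr_natl !natr_prod.
rewrite -natr_prod -sW mulr_sumr -sumrB.
apply: le_trans (ler_norm_sum _ _ _) _.
rewrite -sum1_size natr_sum big_seq_cond [leRHS]big_seq_cond.
apply: ler_sum => a; rewrite andbT => /(allP aW) aM.
exact: sum_residue_bound.
Qed.
End Crt.

(** * Chebyshev's bound and doubly exponential blocks of primes *)

Lemma dyadic_split (F : nat -> rat) (P : pred nat) a b : (a <= b)%N ->
  \sum_(2 ^ a <= n < 2 ^ b | P n) F n =
  \sum_(a <= k < b) \sum_(2 ^ k <= n < 2 ^ k.+1 | P n) F n.
Proof.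
elim: b => [|b IH]; first by rewrite leqn0 => /eqP ->; rewrite !big_geq.
rewrite leq_eqVlt => /orP[/eqP ->|]; first by rewrite !big_geq.
rewrite ltnS => ab.
rewrite (@big_cat_nat _ _ _ (2 ^ b)%N) /= ?leq_exp2l //.
by rewrite IH // big_nat_recr.
Qed.

Lemma bin_le_exp2 n m : ('C(n, m) <= 2 ^ n)%N.
Proof.
have [mn|nm] := leqP m n; last by rewrite bin_small.
rewrite -[2%N]/(1 + 1)%N expnDn (bigD1 (Ordinal (mn : m < n.+1)%N)) //=.
by rewrite !exp1n !muln1 leq_addr.
Qed.

Lemma prod_primes_dvd (s : seq nat) N : uniq s -> all prime s ->
  all (fun p => p %| N)%N s -> (\prod_(p <- s) p %| N)%N.
Proof.
elim: s => [|p s IH]; first by rewrite big_nil dvd1n.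
rewrite /= big_cons => /andP[ps us] /andP[pp as_] /andP[pN sN].
rewrite Gauss_dvd; first by rewrite pN IH.
rewrite big_seq_cond; apply: (big_ind (fun m => coprime p m)).
- by rewrite coprimen1.
- by move=> x y hx hy; rewrite coprimeMr hx.
move=> r; rewrite andbT => rs; rewrite prime_coprime //.
have pr : prime r by exact: (allP as_).
by rewrite dvdn_prime2 //; apply: contraNneq ps => ->.
Qed.

(** Chebyshev's argument: the primes between n = 2^k and 2n all divide the binomial coefficient of
    2n over n, which is at most 2^(2n). *)
Lemma count_primes_dyadic k : (0 < k)%N ->
  (count prime (index_iota (2 ^ k) (2 ^ k.+1)) * k <= 2 ^ k.+1)%N.
Proof.
(* The case k = 1 is computed: there n = 2 is itself a prime of the interval and would not divide
   the binomial coefficient by the argument below. *)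
case: k => [//|[|k]] _; first by [].
set n := (2 ^ k.+2)%N; set s := [seq p <- index_iota n (2 ^ k.+3) | prime p].
have n0 : (0 < n)%N by rewrite expn_gt0.
have e2 : (2 ^ k.+3 = n + n)%N by rewrite addnn -mul2n -expnS.
have hs p : p \in s -> [/\ prime p, n < p & p <= n + n]%N.
  rewrite mem_filter mem_index_iota => /andP[pp /andP[h1 h2]]; split => //.
    rewrite ltn_neqAle h1 andbT; apply: contraTneq pp => <-.
    apply/negP => /even_prime[]; last by rewrite /n oddX.
    by rewrite /n !expnS; have := expn_gt0 2 k; lia.
  by rewrite -e2 ltnW.
have dv : (\prod_(p <- s) p %| 'C(n + n, n))%N.
  apply: prod_primes_dvd; first by rewrite filter_uniq ?iota_uniq.
    by apply/allP => p /hs[].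
  apply/allP => p /hs[pp np pn].
  have : (p %| (n + n)`!)%N by rewrite dvdn_fact // prime_gt0.
  rewrite -(bin_fact (leq_addr n n)) addnK !Euclid_dvdM //.
  suff /negbTE -> : ~~ (p %| n`!)%N by rewrite !orbF.
  elim: (n) np => [|m IH] mp; first by rewrite fact0 dvdn1; case: eqP pp => [->|].
  rewrite factS Euclid_dvdM // negb_or IH ?(ltnW mp) // andbT.
  by rewrite gtnNdvd.
have : (n ^ size s <= \prod_(p <- s) p)%N.
  elim: (s) hs => [|p r IH] hs; first by rewrite big_nil.
  rewrite big_cons /= expnS leq_mul //; first by have [] := hs p (mem_head _ _) => ? /ltnW.
  by apply: IH => x xr; apply: hs; rewrite inE xr orbT.
move=> h; have := leq_trans h (dvdn_leq _ dv); rewrite bin_gt0 leq_addr => /(_ isT) h2.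
have := leq_trans h2 (bin_le_exp2 _ _); rewrite /n -expnM leq_exp2l // -e2.
by rewrite /s size_filter mulnC.
Qed.

Lemma big_iota_recr (R : Type) (idx : R) (op : Monoid.law idx) n (F : nat -> R) :
  \big[op/idx]_(t <- iota 0 n.+1) F t = op (\big[op/idx]_(t <- iota 0 n) F t) (F n).
Proof. by have := @big_nat_recr _ _ op n 0 F (leq0n n); rewrite /index_iota !subn0. Qed.

(** The squaring of the end points makes the sum of 1/p bounded by an absolute constant on each
    block, so that every block costs at most a fixed factor of density. *)
Definition pblock (E t : nat) : seq nat :=
  [seq p <- index_iota (2 ^ 2 ^ t) (2 ^ 2 ^ t.+1) | prime p && ~~ (p %| E)%N].

(** The level grows by one with each step down from the top block. The truncation errors then form a
    geometric series, while the total remainder keeps the size of that of the top block. *)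
Definition blocks (E b s : nat) : seq block :=
  [seq ((b + (s - t.+1))%N, pblock E t) | t <- iota 0 s].

Definition plist E s := flatten [seq pblock E t | t <- iota 0 s].

Lemma support_blocks E b s : support (blocks E b s) = plist E s.
Proof. by rewrite /support /blocks -map_comp. Qed.

Lemma mem_plist E s p :
  (p \in plist E s) = [&& prime p, ~~ (p %| E)%N & p < 2 ^ 2 ^ s]%N.
Proof.
elim: s => [|s IH].
  by rewrite in_nil; apply/esym/negP => /and3P[/prime_gt1 h _ h2]; lia.
rewrite /plist -addn1 iotaD map_cat flatten_cat mem_cat -/(plist E s) IH /=.
rewrite cats0 add0n mem_filter mem_index_iota addn1.
have h : (2 ^ 2 ^ s <= 2 ^ 2 ^ s.+1)%N by rewrite !leq_exp2l.
case: (prime p) => //=; case: (p %| E)%N => //=.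
by case: (ltnP p (2 ^ 2 ^ s)) => //= h1; apply/esym; apply: leq_trans h.
Qed.

Lemma uniq_plist E s : uniq (plist E s).
Proof.
elim: s => [//|s IH].
rewrite /plist -addn1 iotaD map_cat flatten_cat -/(plist E s) /= cats0 add0n.
rewrite cat_uniq IH filter_uniq ?iota_uniq // andbT /=.
apply/hasPn => p; rewrite mem_filter mem_index_iota mem_plist.
by move=> /andP[_ /andP[h _]]; rewrite (ltnNge p) h !andbF.
Qed.

(** Each of the 2^t dyadic intervals of the block contributes at most 2/k <= 2/2^t. *)
Lemma sum_pblock E t : \sum_(p <- pblock E t) (p%:R)^-1 <= 2 :> rat.
Proof.
rewrite big_filter.
apply: le_trans (_ : \sum_(2 ^ 2 ^ t <= p < 2 ^ 2 ^ t.+1 | prime p) (p%:R)^-1 <= _).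
  rewrite big_mkcond [leRHS]big_mkcond; apply: ler_sum => p _.
  by case: (prime p) => //=; case: ifP => //; rewrite invr_ge0 ler0n.
rewrite dyadic_split ?leq_exp2l //.
apply: le_trans (_ : \sum_(2 ^ t <= k < 2 ^ t.+1) 2 / (2 ^ t)%:R <= _).
  rewrite big_nat_cond [leRHS]big_nat_cond; apply: ler_sum => k.
  rewrite andbT => /andP[tk _].
  have k0 : (0 < k)%N by apply: leq_trans tk; rewrite expn_gt0.
  have := count_primes_dyadic k0.
  set c := count _ _ => hc.
  apply: le_trans (_ : c%:R / (2 ^ k)%:R <= _).
    rewrite /c -sum1_count natr_sum mulr_suml big_nat_cond [leRHS]big_nat_cond.
    apply: ler_sum => p /andP[/andP[h _] _]; rewrite mul1r.
    by rewrite lef_pV2 ?posrE ?ltr0n ?ler_nat ?expn_gt0 // (leq_trans _ h) ?expn_gt0.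
  rewrite ler_pdivrMr ?ltr0n ?expn_gt0 // mulrAC ler_pdivlMr ?ltr0n ?expn_gt0 //.
  rewrite -!natrM ler_nat -expnS; apply: leq_trans hc.
  by rewrite leq_mul2l tk orbT.
rewrite sumr_const_nat expnS mul2n -addnn addnK -[leLHS]mulr_natr divfK //.
by rewrite pnatr_eq0 -lt0n expn_gt0.
Qed.

Lemma weierstrass (I : Type) (s : seq I) (w : I -> rat) :
  (forall i, 0 <= w i) -> \sum_(i <- s) w i <= 2^-1 ->
  \prod_(i <- s) (1 + w i) <= 2.
Proof.
move=> w0 h.
have h1 : 1 <= \prod_(i <- s) (1 + w i).
  elim/big_ind: _ => // [x y hx hy|i _]; first exact: mulr_ege1.
  by rewrite lerDl.
have : \prod_(i <- s) (1 + w i) * (1 - \sum_(i <- s) w i) <= 1.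
  elim: (s) => [|i r IH]; first by rewrite !big_nil; lra.
  rewrite !big_cons.
  set P := \prod_(_ <- _) _ in IH *; set S := \sum_(_ <- _) _ in IH *.
  have P0 : 0 <= P by apply: prodr_ge0 => j _; have := w0 j; lra.
  have S0 : 0 <= S by apply: sumr_ge0.
  have := w0 i => wi; apply: le_trans _ IH.
  rewrite -subr_ge0.
  have -> : P * (1 - S) - (1 + w i) * P * (1 - (w i + S)) =
    P * (w i) * (w i + S) by ring.
  by rewrite !mulr_ge0 // addr_ge0.
set P := \prod_(_ <- _) _ in h1 *; nra.
Qed.

Lemma bernoulli_rat (y : rat) n : 0 <= y -> 1 + n%:R * y <= (1 + y) ^+ n.
Proof.
move=> y0; elim: n => [|n IH]; first by rewrite mul0r addr0 expr0.
rewrite exprS -natr1.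
have h : (1 + y) * (1 + n%:R * y) <= (1 + y) * (1 + y) ^+ n.
  by apply: ler_wpM2l => //; lra.
apply: le_trans h; have : 0 <= n%:R * y * y by rewrite !mulr_ge0.
by lra.
Qed.

(** Bernoulli's inequality 1 + y <= (1 + y/n)^n reduces the claim to a sum of at most 1/2. *)
Lemma prod_1add_bound (I : Type) (s : seq I) (y : I -> rat) n : (0 < n)%N ->
  (forall i, 0 <= y i) -> \sum_(i <- s) y i <= n%:R / 2 ->
  \prod_(i <- s) (1 + y i) <= 2 ^+ n.
Proof.
move=> n0 y0 h; have nr : 0 < n%:R :> rat by rewrite ltr0n.
apply: le_trans (_ : (\prod_(i <- s) (1 + y i / n%:R)) ^+ n <= _).
  rewrite -prodrXl; apply: ler_prod => i _; rewrite addr_ge0 //=.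
  have := bernoulli_rat n (divr_ge0 (y0 i) (ltW nr)).
  by rewrite mulrCA divff ?mulr1 // lt0r_neq0.
have p0 : 0 <= \prod_(i <- s) (1 + y i / n%:R).
  by apply: prodr_ge0 => i _; rewrite addr_ge0 // divr_ge0 // ltW.
rewrite lerXn2r // ?nnegrE //; apply: weierstrass => [i|].
  by rewrite divr_ge0 // ltW.
by rewrite -mulr_suml ler_pdivrMr // mulrC.
Qed.

Lemma opaque_nat n : {m : nat | m = n}.
Proof. by exists n. Qed.

(* The exponent is sealed so that [2 ^+ 24] is never evaluated. *)
Definition cK := sval (opaque_nat 24).

Lemma cKE : cK = 24%N.
Proof. exact: svalP (opaque_nat 24). Qed.

Lemma prod_01 (I : eqType) (s : seq I) (F : I -> rat) :
  (forall i, i \in s -> 0 <= F i <= 1) -> 0 <= \prod_(i <- s) F i <= 1.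
Proof.
move=> h; rewrite big_seq; elim/big_ind: _ => [|x y|i /h //]; first by rewrite ler01 lexx.
by move=> /andP[x0 x1] /andP[y0 y1]; rewrite mulr_ge0 //= mulr_ile1.
Qed.

(** * The sieve with one or two classes per prime *)

Section Instance.
Variables (kap E : nat).
Hypothesis kap2 : (0 < kap <= 2)%N.
Hypothesis g23 : forall p, prime p -> ~~ (p %| E)%N -> (3 * kap <= 2 * p)%N.

Let g p : rat := kap%:R / p%:R.

Lemma ok_g p : prime p -> ~~ (p %| E)%N -> 0 <= g p <= 2 / 3.
Proof.
move=> pp pE; rewrite /g divr_ge0 ?ler0n // andTb ler_pdivrMr; last by rewrite ltr0n prime_gt0.
have := g23 pp pE; rewrite -(ler_nat rat) !natrM; lra.
Qed.

Lemma pblock_g t p : p \in pblock E t -> 0 <= g p <= 2 / 3.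
Proof. by rewrite mem_filter => /andP[/andP[pp pE] _]; apply: ok_g. Qed.

Lemma sum_pblock_g t : \sum_(p <- pblock E t) g p <= 4.
Proof.
rewrite /g -mulr_sumr; have h := sum_pblock E t.
have h0 : 0 <= \sum_(p <- pblock E t) (p%:R)^-1 :> rat.
  by apply: sumr_ge0 => p _; rewrite invr_ge0.
have : kap%:R <= 2 :> rat by rewrite ler_nat; case/andP: kap2.
have : 0 <= kap%:R :> rat by []. by nra.
Qed.

(** For 0 <= g <= 2/3 one has (1 - g)(1 + 3g) >= 1, so a bound for the product of the 1 + 3g
    suffices. The sum of the 3g is at most 12 = 24/2, whence the exponent 24. *)
Lemma prod_pblock_g t : (2 ^+ cK)^-1 <= \prod_(p <- pblock E t) (1 - g p).
Proof.
have h1 : \prod_(p <- pblock E t) (1 + 3 * g p) <= 2 ^+ cK.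
  apply: prod_1add_bound => [|p|]; [by rewrite cKE|by rewrite mulr_ge0 // divr_ge0|].
  by rewrite -mulr_sumr cKE; have := sum_pblock_g t; lra.
have h2 : 1 <= \prod_(p <- pblock E t) (1 - g p) * \prod_(p <- pblock E t) (1 + 3 * g p).
  rewrite -big_split /= big_seq; elim/big_ind: _ => // [x y hx hy|p pE].
    exact: mulr_ege1.
  have /andP[] := pblock_g pE; nra.
have h3 : 0 <= \prod_(p <- pblock E t) (1 - g p).
  rewrite big_seq; apply: prodr_ge0 => p /pblock_g /andP[]; lra.
rewrite -[leLHS]mul1r ler_pdivrMr ?exprn_gt0 //.
by apply: le_trans h2 _; apply: ler_wpM2l.
Qed.

Lemma dens_blocks_ge b s : (2 ^+ (cK * s))^-1 <= dens (fun=> kap) (blocks E b s).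
Proof.
rewrite /dens /blocks big_map; elim: s => [|s IH]; first by rewrite big_nil muln0 expr0 invr1.
rewrite big_iota_recr /= mulnS addnC exprD invfM.
rewrite ler_pM ?invr_ge0 ?exprn_ge0 //; exact: prod_pblock_g.
Qed.

(** The smallest truncation degree is then 2 * 44 + 1 = 89, within the range of [fact_ge]. *)
Definition beta := 44%N.

(** n! >= 16^(n - 16), and 4 (n - 16) >= 24 + 3n exactly when n >= 88. *)
Lemma fact_ge n : (88 <= n)%N -> (2 ^ cK * 8 ^ n <= n`!)%N.
Proof.
move=> h; have h16 m : (16 ^ m <= (16 + m)`!)%N.
  elim: m => [|m IH]; first by rewrite fact_gt0.
  by rewrite addnS factS expnS leq_mul // leqW // leq_addr.
apply: leq_trans (_ : 16 ^ (n - 16) <= _)%N; last first.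
  by apply: leq_trans (h16 _) _; rewrite subnKC //; lia.
rewrite -[8%N]/(2 ^ 3)%N -[16%N]/(2 ^ 4)%N -!expnM -expnD leq_exp2l //.
by rewrite cKE; move: h; rewrite -[16%N]/(2 ^ 4)%N; lia.
Qed.

Definition bdelta (B : block) : rat := (2 ^+ (B.1.*2.+1))^-1.

Lemma bdelta_ge0 B : 0 <= bdelta B.
Proof. by rewrite invr_ge0 exprn_ge0. Qed.

(** The first omitted term is at most 4^n / n! <= 2^(-n) 2^(-24), and 2^(-24) is at most the density
    of the block. *)
Lemma esym_bdelta s B : B \in blocks E beta s ->
  esymf B.1.*2.+1 [seq g p | p <- B.2] <= bdelta B * \prod_(p <- B.2) (1 - g p).
Proof.
move=> /mapP[t _ ->] /=; rewrite /bdelta /=.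
set n := _.*2.+1.
have n88 : (88 <= n)%N by rewrite /n /beta; lia.
clearbody n.
have h0 : forall x, x \in [seq g p | p <- pblock E t] -> 0 <= x.
  by move=> x /mapP[p /pblock_g /andP[h _] ->].
have h1 := esym_bound n h0; rewrite big_map in h1.
have h2 : (\sum_(p <- pblock E t) g p) ^+ n <= 4 ^+ n.
  rewrite lerXn2r // ?nnegrE ?sum_pblock_g //.
  by rewrite big_seq; apply: sumr_ge0 => p /pblock_g /andP[].
have fr : 0 < n`!%:R :> rat by rewrite ltr0n fact_gt0.
apply: le_trans (_ : (2 ^+ n)^-1 * (2 ^+ cK)^-1 <= _); last first.
  by rewrite ler_wpM2l ?prod_pblock_g // invr_ge0 exprn_ge0.
rewrite -(ler_pM2r fr); apply: le_trans (le_trans h1 h2) _.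
have := fact_ge n88; rewrite -(ler_nat rat) natrM !natrX.
set N := (n`!)%:R; have -> : (8 : rat) = 2 * 4 by []. 
rewrite exprMn => hN.
rewrite -invfM mulrC ler_pdivlMr ?mulr_gt0 ?exprn_gt0 //.
by apply: le_trans hN; rewrite le_eqVlt; apply/orP; left; apply/eqP; ring.
Qed.

Lemma sum_bdelta s : \sum_(B <- blocks E beta s) bdelta B <= 2^-1.
Proof.
rewrite /blocks big_map.
have -> : \sum_(t <- iota 0 s) bdelta ((beta + (s - t.+1))%N, pblock E t) =
   \sum_(0 <= t < s) (2 ^+ ((beta + t).*2.+1))^-1.
  rewrite [RHS]big_nat_rev /= /index_iota subn0.
  by apply: eq_bigr => t _; rewrite /bdelta /= add0n.
apply: le_trans (_ : \sum_(0 <= t < s) (2 ^+ t.+2)^-1 <= _).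
  apply: ler_sum => t _.
  have : (t.+2 <= (beta + t).*2.+1)%N by rewrite /beta; lia.
  move: (_.*2.+1) => n tn.
  by rewrite lef_pV2 ?posrE ?exprn_gt0 // ler_eXn2l.
suff -> : \sum_(0 <= t < s) (2 ^+ t.+2)^-1 = 2^-1 - (2 ^+ s.+1)^-1 :> rat.
  by rewrite gerBl invr_ge0 exprn_ge0.
elim: s => [|s IH]; first by rewrite big_geq // expr1 subrr.
rewrite big_nat_recr //= IH (exprS 2 s.+1) invfM.
set y := (_ ^+ _)^-1; lra.
Qed.

Definition remc := (8 * beta + 12)%N.

Lemma sum_trunc b s :
  (\sum_(t <- iota 0 s) 2 ^ t.+2 * (b + (s - t.+1)).*2.+1 <= 2 ^ s * (8 * b + 12))%N.
Proof.
(* The added terms of lower order make the induction go through. *)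
suff h : (\sum_(t <- iota 0 s) 2 ^ t.+2 * (b + (s - t.+1)).*2.+1 + (2 * s + 3) * 4 + 8 * b
   <= 2 ^ s * (8 * b + 12))%N.
  by apply: leq_trans h; rewrite -addnA leq_addr.
elim: s => [|s IH]; first by rewrite big_nil expn0; lia.
rewrite big_iota_recr /=.
rewrite (_ : \sum_(t <- iota 0 s) _ = \sum_(t <- iota 0 s)
   2 ^ t.+2 * (b + (s - t.+1)).*2.+1 + \sum_(t <- iota 0 s) 2 ^ t.+2 * 2)%N; last first.
  rewrite -big_split /= big_seq [RHS]big_seq; apply: eq_bigr => t.
  rewrite mem_iota add0n => ts; rewrite -mulnDr; congr (_ * _)%N; lia.
have -> : (\sum_(t <- iota 0 s) 2 ^ t.+2 * 2 = 8 * (2 ^ s - 1))%N.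
  elim: (s) => [|n IHn]; first by rewrite big_nil.
  rewrite big_iota_recr /= IHn !expnS.
  by have := expn_gt0 2 n; lia.
move: IH; set S := \sum_(_ <- _) _; have := expn_gt0 2 s.
rewrite subnn addn0 !expnS; set X := (2 ^ s)%N.
have -> : (2 * (2 * X) * b.*2.+1 = 8 * (X * b) + 4 * X)%N by rewrite -mul2n; lia.
have -> : (2 * X * (8 * b + 12) = 16 * (X * b) + 24 * X)%N by lia.
have -> : (X * (8 * b + 12) = 8 * (X * b) + 12 * X)%N by lia.
lia.
Qed.

(** Block t has at most 2^(2^(t+1)) primes, so its norm is at most 2^(2^(t+2)) raised to the
    truncation degree. With z = 2^(2^s) the sifting limit, the total error is z^364. *)
Lemma rem_blocks_le s : rem (fun=> kap) (blocks E beta s) <= 2 ^+ (2 ^ s * remc).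
Proof.
have hB t m : 0 <= cumsym m [seq kap%:R : rat | p <- pblock E t] <= 2 ^+ (2 ^ t.+2 * m).
  have h0 : forall x : rat, x \in [seq kap%:R | p <- pblock E t] -> 0 <= x.
    by move=> x /mapP[p _ ->].
  rewrite (le_trans ler01 (cumsym_ge1 _ h0)) /=.
  apply: le_trans (cumsym_bound _ h0) _.
  rewrite exprM lerXn2r ?nnegrE ?exprn_ge0 ?addr_ge0 // ?big_map.
    by apply: sumr_ge0.
  rewrite big_const_seq count_predT iter_addr_0 -[X in 1 + X]mulr_natl -natrM nat1r.
  rewrite -natrX ler_nat.
  have h1 : (size (pblock E t) <= 2 ^ 2 ^ t.+1)%N.
    rewrite size_filter; apply: leq_trans (count_size _ _) _.
    by rewrite size_iota leq_subr.
  have h2 : (2 ^ 2 ^ t.+2 = 2 ^ 2 ^ t.+1 * 2 ^ 2 ^ t.+1)%N.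
    by rewrite -expnD addnn -mul2n -expnS.
  have h3 : (4 <= 2 ^ 2 ^ t.+1)%N.
    apply: (@leq_trans (2 ^ 2)%N) => //.
    by rewrite leq_exp2l // expnS leq_pmulr // expn_gt0.
  have /andP[_ k2] := kap2.
  have : (size (pblock E t) * kap <= 2 ^ 2 ^ t.+1 * 2)%N by apply: leq_mul.
  have : (4 * 2 ^ 2 ^ t.+1 <= 2 ^ 2 ^ t.+2)%N by rewrite h2 leq_mul2r h3 orbT.
  lia.
apply: le_trans (_ : 2 ^+ (\sum_(t <- iota 0 s) 2 ^ t.+2 * (beta + (s - t.+1)).*2.+1) <= _).
  rewrite /rem /blocks big_map expr_sum; apply: ler_prod => t _; exact: hB.
by rewrite ler_eXn2l // sum_trunc.
Qed.

Definition sift s n := all (fun p => ~~ (p %| n)%N) (plist E s).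
Definition Vd s := dens (fun=> kap) (blocks E beta s).

Lemma sift_bounds (I s : nat) (L : nat -> nat) :
  (forall p, p \in plist E s -> exists W : seq nat,
     [/\ uniq W, size W = kap, all (fun a => a < p)%N W &
       forall i, (p %| L i)%N = (i %% p \in W)%N]) ->
  \sum_(0 <= i < I) (sift s (L i))%:R <= 2 * I%:R * Vd s + 2 ^+ (2 ^ s * remc) /\
  I%:R * Vd s / 2 - s.+1%:R * 2 ^+ (2 ^ s * remc) <=
    \sum_(0 <= i < I) (sift s (L i))%:R.
Proof.
move=> hL; pose bad p : pred nat := fun i => (p %| L i)%N.
pose ok : pred nat := [in plist E s].
have lev D : uniq D -> all ok D ->
  `| \sum_(0 <= i < I) \prod_(p <- D) (bad p i)%:R
      - I%:R * \prod_(p <- D) (kap%:R / p%:R) |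
    <= \prod_(p <- D) kap%:R :> rat.
  apply: (crt_level (k := fun=> kap)) => p okp; split; last exact: hL.
  by move: okp; rewrite /ok /= mem_plist => /and3P[].
have g01 p : ok p -> 0 <= g p <= 1.
  rewrite /ok /= mem_plist => /and3P[pp pE _]; have /andP[-> /=] := ok_g pp pE.
  by set y := g p => h; lra.
have uB : uniq (support (blocks E beta s)) by rewrite support_blocks uniq_plist.
have oB : all ok (support (blocks E beta s)).
  by rewrite support_blocks; apply/allP.
have dB B : B \in blocks E beta s -> 0 <= bdelta B /\
  esymf B.1.*2.+1 [seq g p | p <- B.2] <= bdelta B * \prod_(p <- B.2) (1 - g p).
  by move=> hB; split; [exact: bdelta_ge0|exact: (esym_bdelta hB)].
have es i : sifted bad (blocks E beta s) i = sift s (L i).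
  rewrite /sift /plist /sifted /blocks all_map; elim: (iota 0 s) => //= t r ->.
  by rewrite all_cat -all_predC.
have [h1 h2] := sieve_bounds lev g01 uB oB dB (sum_bdelta s).
have hr := rem_blocks_le s.
have e : \sum_(0 <= i < I) (sifted bad (blocks E beta s) i)%:R =
   \sum_(0 <= i < I) (sift s (L i))%:R :> rat by apply: eq_bigr => i _; rewrite es.
rewrite e size_map size_iota in h1 h2; split.
  by apply: le_trans h1 _; rewrite lerD2l.
apply: le_trans h2; rewrite lerD2l lerN2; exact: ler_wpM2l.
Qed.

Lemma Vd_bounds s : (2 ^+ (cK * s))^-1 <= Vd s <= 1.
Proof.
rewrite /Vd dens_blocks_ge /= /dens /blocks big_map.
suff /andP[] : (0 : rat) <= \prod_(t <- iota 0 s) \prod_(p <- pblock E t) (1 - kap%:R / p%:R : rat) <= 1 by [].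
by apply: prod_01 => t _; apply: prod_01 => p /pblock_g /andP[]; rewrite /g; lra.
Qed.
End Instance.

(** * Upper bound for the Mertens product *)

Lemma sum_reindex_le (F : nat -> rat) (s t : seq nat) (h : nat -> nat) :
  (forall n, 0 <= F n) -> uniq s -> uniq t -> injective h ->
  {subset s <= [seq h i | i <- t]} ->
  \sum_(n <- s) F n <= \sum_(i <- t) F (h i).
Proof.
move=> F0 us ut hi st; rewrite -[leRHS](big_map h xpredT F).
have umt : uniq [seq h i | i <- t] by rewrite map_inj_uniq.
have /(perm_big _) -> /= : perm_eq s [seq x <- [seq h i | i <- t] | x \in s].
  apply: uniq_perm => [||x]; [exact: us|exact: (filter_uniq _ umt)|rewrite mem_filter].
  by case: (boolP (x \in s)) => //= /st ->.
by rewrite big_filter [leRHS](bigID [in s]) /= lerDl; apply: sumr_ge0.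
Qed.

Lemma sum_multiples_le (F : nat -> rat) p N : (0 < p)%N -> (forall n, 0 <= F n) ->
  \sum_(1 <= n < N.+1 | (p %| n)%N) F n <= \sum_(1 <= m < N.+1) F (p * m)%N.
Proof.
move=> p0 F0; rewrite -big_filter; apply: sum_reindex_le => //.
- by rewrite filter_uniq ?iota_uniq.
- exact: iota_uniq.
- by move=> x y /eqP; rewrite eqn_pmul2l // => /eqP.
move=> n; rewrite mem_filter mem_index_iota => /andP[/dvdnP[m ->] /andP[h1 h2]].
rewrite mulnC map_f // mem_index_iota.
by move: h1; rewrite muln_gt0 => /andP[-> _] /=; apply: leq_ltn_trans h2; rewrite leq_pmulr.
Qed.

Definition smooth (D : seq nat) n := all [in D] (primes n).

(** Euler's product, one prime at a time: the multiples of p contribute at most 1/p of the whole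
    sum, so 1 - 1/p times the sum is at most the sum over the n prime to p, which are smooth for the
    smaller list. *)
Lemma smooth_sum_bound (D : seq nat) N : uniq D -> all prime D ->
  (\sum_(1 <= n < N.+1 | smooth D n) (n%:R)^-1) * \prod_(p <- D) (1 - (p%:R)^-1) <= 1 :> rat.
Proof.
elim: D => [|p D IH].
  move=> _ _; rewrite big_nil mulr1.
  apply: le_trans (_ : \sum_(1 <= n < N.+1 | n == 1%N) (n%:R)^-1 <= _).
    rewrite big_nat_cond [leRHS]big_nat_cond big_mkcond [leRHS]big_mkcond /=.
    apply: ler_sum => n _; case: (boolP (_ && smooth [::] n)); last first.
      by case: ifP => // _; rewrite invr_ge0.
    move=> /andP[n1 hn]; rewrite n1 /=.
    case: (eqVneq n 1%N) => [-> //|n1'] /=; exfalso.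
    have /andP[n0 _] := n1; have n2 : (1 < n)%N by lia.
    move/allP: hn => /(_ (pdiv n)); rewrite mem_primes pdiv_prime // pdiv_dvd n0 /=.
    by move/(_ isT).
  case: N => [|N]; first by rewrite big_geq.
  by rewrite big_ltn_cond //= invr1 big_nat_cond big1 ?addr0 // => n /andP[/andP[h _] /eqP]; lia.
move=> /= /andP[pD uD] /andP[pp aD].
have {IH} := IH uD aD; rewrite big_cons.
set P := \prod_(_ <- _) _; set A := \sum_(_ <= _ < _ | _) _ => IH.
set B := \sum_(_ <= _ < _ | _) _.
have pr : 0 < p%:R :> rat by rewrite ltr0n prime_gt0.
suff h : B * (1 - (p%:R)^-1) <= A.
  rewrite mulrA; apply: le_trans IH; apply: ler_wpM2r => //.
  rewrite /P big_seq; apply: prodr_ge0 => r /(allP aD) /prime_gt0 r0.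
  by rewrite subr_ge0 invf_le1 ?ltr0n // ler1n.
rewrite mulrBr mulr1 lerBlDr.
rewrite {1}/B (bigID (fun n => p %| n)%N) /= addrC; apply: lerD.
  rewrite /A big_nat_cond [leRHS]big_nat_cond big_mkcond [leRHS]big_mkcond /=.
  apply: ler_sum => n _; case: (boolP (_ && _)) => /=; last first.
    by case: ifP => // _; rewrite invr_ge0.
  move=> /andP[-> /andP[hs pn]] /=; suff -> : smooth D n by [].
  apply/allP => r rn; have := allP hs r rn; rewrite !inE => /orP[/eqP e|//].
  by move: rn; rewrite mem_primes e (negbTE pn) !andbF.
rewrite (eq_bigl (fun n => (p %| n) && smooth (p :: D) n)%N); last by move=> n; rewrite andbC.
rewrite big_mkcondr /=.
apply: le_trans (sum_multiples_le _ (prime_gt0 pp) _) _.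
  by move=> n; case: ifP => // _; rewrite invr_ge0.
rewrite /B mulr_suml [leRHS]big_mkcond /= big_nat_cond [leRHS]big_nat_cond.
apply: ler_sum => m; rewrite andbT => /andP[m1 _].
have hm : smooth (p :: D) (p * m) = smooth (p :: D) m.
  rewrite /smooth; apply/allP/allP => h r.
    by move=> rm; apply: h; rewrite primesM ?(prime_gt0 pp) //; apply/orP; right.
  rewrite primesM ?(prime_gt0 pp) // => /orP[|/h //]; rewrite primes_prime // inE => /eqP ->.
  by rewrite !inE eqxx.
by rewrite hm; case: ifP => //; rewrite natrM invfM mulrC.
Qed.

Lemma harmonic_ge K : K%:R / 2 <= \sum_(1 <= n < 2 ^ K) (n%:R)^-1 :> rat.
Proof.
rewrite (dyadic_split _ _ (leq0n K)).
have -> : K%:R / 2 = \sum_(0 <= k < K) 2^-1 :> rat.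
  by rewrite sumr_const_nat subn0 mulr_natl.
apply: ler_sum => k _.
apply: le_trans (_ : \sum_(2 ^ k <= n < 2 ^ k.+1) ((2 ^ k.+1)%:R)^-1 <= _).
  rewrite sumr_const_nat expnS mul2n -addnn addnK -mulr_natr natrD.
  have : 0 < (2 ^ k)%:R :> rat by rewrite ltr0n expn_gt0.
  set x := _%:R => x0; rewrite le_eqVlt; apply/orP; left; apply/eqP; field.
  by rewrite lt0r_neq0 //=; lra.
rewrite big_nat_cond [leRHS]big_nat_cond; apply: ler_sum => n /andP[/andP[h1 h2] _].
rewrite lef_pV2 ?posrE ?ltr0n ?expn_gt0 // ?ler_nat; first exact: ltnW.
by apply: leq_trans h1; rewrite expn_gt0.
Qed.

(** Every positive n below 2^(2^s) is smooth for the list, so the inverse of the product is at least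
    a harmonic sum. *)
Lemma mertens_upper s :
  \prod_(p <- plist 1 s) (1 - (p%:R)^-1) <= 2 / (2 ^ s)%:R :> rat.
Proof.
have aP : all prime (plist 1 s) by apply/allP => p; rewrite mem_plist => /andP[].
have P0 : 0 <= \prod_(p <- plist 1 s) (1 - (p%:R)^-1) :> rat.
  rewrite big_seq; apply: prodr_ge0 => r /(allP aP) /prime_gt0 r0.
  by rewrite subr_ge0 invf_le1 ?ltr0n // ler1n.
have := smooth_sum_bound (2 ^ 2 ^ s).-1 (uniq_plist 1 s) aP.
rewrite prednK ?expn_gt0 //.
have h : (2 ^ s)%:R / 2 <= \sum_(1 <= n < 2 ^ 2 ^ s | smooth (plist 1 s) n) (n%:R)^-1 :> rat.
  apply: le_trans (harmonic_ge _) _.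
  rewrite big_nat_cond [leRHS]big_nat_cond big_mkcond [leRHS]big_mkcond /=.
  apply: ler_sum => n _; rewrite !andbT; case: (boolP (0 < n < 2 ^ 2 ^ s)%N) => [h12|//]; move: (h12) => /andP[n1 n2] /=.
  suff -> : smooth (plist 1 s) n by [].
  apply/allP => p; rewrite mem_primes => /and3P[pp n0 pn].
  rewrite mem_plist pp /= (leq_ltn_trans (dvdn_leq n0 pn)) // andbT.
  by rewrite dvdn1; apply: contraTneq pp => ->.
move=> h2; have h3 := le_trans (ler_wpM2r P0 h) h2.
have : 0 < (2 ^ s)%:R :> rat by rewrite ltr0n expn_gt0.
move: h3; set x := _%:R; set P := \prod_(_ <- _) _ => h3 x0.
by rewrite ler_pdivlMr //; lra.
Qed.

(** The primes of [rs] divide the modulus and are left out of the sieve; their factors complete the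
    density to the full Mertens product. *)
Lemma Vd1_bound (rs : seq nat) s : uniq rs -> all prime rs ->
  all (fun r => r < 2 ^ 2 ^ s)%N rs ->
  Vd 1 (\prod_(r <- rs) r) s * \prod_(r <- rs) (1 - (r%:R)^-1) <= 2 / (2 ^ s)%:R.
Proof.
move=> ur ar br; apply: le_trans (mertens_upper s).
have dvQ p : prime p -> (p %| \prod_(r <- rs) r)%N = (p \in rs).
  move=> pp; elim: (rs) ar => [|r t IH] /=; first by rewrite big_nil in_nil dvdn1; case: eqP pp => [->|].
  by move=> /andP[pr /IH h]; rewrite big_cons Euclid_dvdM // dvdn_prime2 // inE h.
have /(perm_big _) -> /= : perm_eq (plist 1 s) (plist (\prod_(r <- rs) r) s ++ rs).
  apply: uniq_perm; first exact: uniq_plist.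
    rewrite cat_uniq uniq_plist ur andbT /=; apply/hasPn => r rr.
    by rewrite mem_plist dvQ ?rr ?andbF //; apply: (allP ar).
  move=> p; rewrite mem_cat !mem_plist.
  case: (boolP (prime p)) => pp /=; last by apply/esym/negP => /(allP ar) h; case/negP: pp.
  rewrite dvQ // dvdn1; have -> : (p != 1)%N by apply: contraTneq pp => ->.
  by rewrite /=; case: (boolP (p \in rs)) => [/(allP br)|] //=; rewrite orbF.
rewrite big_cat /= ler_wpM2r //.
  rewrite big_seq; apply: prodr_ge0 => r /(allP ar) /prime_gt0 r0.
  by rewrite subr_ge0 invf_le1 ?ltr0n // ler1n.
rewrite /Vd /dens /blocks big_map /plist big_flatten big_map /= le_eqVlt.
by apply/orP; left; apply/eqP; apply: eq_bigr => t _; apply: eq_bigr => p _; rewrite div1r.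
Qed.

(** * Rough numbers in bad residue classes *)

Lemma coprime_solve m a b : (0 < m)%N -> (0 < b)%N -> coprime m b ->
  exists c, (m %| a + b * c)%N.
Proof.
move=> m0 b0 co; pose x := (chinese m b 0 a + m * a * b)%N.
have ax : (a <= x)%N.
  by apply: leq_trans (leq_addl _ _); rewrite mulnAC leq_pmull ?muln_gt0 ?m0.
have hb : (b %| x - a)%N by rewrite -eqn_mod_dvd // /x addnC modnMDl chinese_modr.
exists ((x - a) %/ b)%N; rewrite mulnC divnK // subnKC //.
have hm : (m %| m * a * b)%N by rewrite -mulnA dvdn_mulr.
by rewrite /x dvdn_addl // /dvdn chinese_modl // mod0n.
Qed.

Lemma linear_root p (a b : nat) : prime p -> ~~ (p %| b)%N ->
  exists2 c, (c < p)%N & forall i, (p %| a + b * i)%N = (i %% p == c)%N.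
Proof.
move=> pp pb; have p0 := prime_gt0 pp.
have co : coprime p b by rewrite prime_coprime.
have b0 : (0 < b)%N by case: b pb {co} => //; rewrite dvdn0.
have [c hc] := coprime_solve a p0 b0 co.
exists (c %% p)%N; first by rewrite ltn_mod.
move=> i; transitivity (a + b * i == a + b * c %[mod p])%N.
  by rewrite /dvdn (eqP hc).
rewrite eqn_modDl; have [ic|/ltnW ci] := leqP i c.
  by rewrite eq_sym eqn_mod_dvd ?leq_mul2l ?ic ?orbT // -mulnBr Gauss_dvdr // -eqn_mod_dvd // eq_sym.
by rewrite eqn_mod_dvd ?leq_mul2l ?ci ?orbT // -mulnBr Gauss_dvdr // -eqn_mod_dvd.
Qed.

(** 144 = 9 * 16, with 9 from [rough_bad_sum] and 1/16 the bound wanted for the inverse sum of the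
    bad divisors; 368 is the exponent of their range from z to z^368, and 512 = 2^9 comes from the
    gap between the sifting depths [s0] and [s0 + 9]. Sealed for the same reason as [cK]. *)
Definition cS := sval (opaque_nat (144 * (368 * 512))).

Lemma cSE : cS = (144 * (368 * 512))%N.
Proof. exact: svalP (opaque_nat (144 * (368 * 512))). Qed.

Lemma remcE : remc = 364%N. Proof. by []. Qed.

Section Classes.
Variables (rs : seq nat) (badc : pred nat).
Hypothesis urs : uniq rs.
Hypothesis prs : all prime rs.
Let Q := (\prod_(r <- rs) r)%N.
Let phi := (\prod_(r <- rs) r.-1)%N.
Hypothesis badc_mod : forall n, badc (n %% Q)%N = badc n.

Let Q0 : (0 < Q)%N.
Proof.
by rewrite /Q big_seq prodn_cond_gt0 // => r /(allP prs) /prime_gt0.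
Qed.

Lemma shifted_sum (F : nat -> nat) a :
  (forall n, F (n %% Q)%N = F n) -> (\sum_(0 <= c < Q) F (a + c) = \sum_(0 <= c < Q) F c)%N.
Proof.
move=> FQ; elim: a => [|a <-]; first by [].
have : (\sum_(0 <= c < Q.+1) F (a + c) = \sum_(0 <= c < Q.+1) F (a + c))%N by [].
rewrite {1}big_nat_recl // big_nat_recr //= addnC addn0 -(FQ (a + Q)%N) modnDr FQ.
move=> /addIn <-; by apply: eq_bigr => c _; rewrite addnS.
Qed.

Lemma phi_prod : \prod_(r <- rs) (1 - (r%:R)^-1) = phi%:R / Q%:R :> rat.
Proof.
rewrite /phi /Q !natr_prod -prodf_div big_seq [RHS]big_seq; apply: eq_bigr => r.
move=> /(allP prs) pr; have r1 := prime_gt1 pr; have r0 := prime_gt0 pr.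
by rewrite -subn1 natrB // mulrBl divff ?mul1r // pnatr_eq0 -lt0n.
Qed.

Let B := (\sum_(0 <= c < Q) badc c)%N.

Lemma phi0 : (0 < phi)%N.
Proof.
rewrite /phi big_seq prodn_cond_gt0 // => r /(allP prs) /prime_gt1; case: r => // -[].
Qed.

Lemma phi_leQ : (phi <= Q)%N.
Proof. by apply: leq_prod => r _; apply: leq_pred. Qed.

Lemma class_sift t a I : (all (fun r => r < 2 ^ 2 ^ t)%N rs) ->
  \sum_(0 <= i < I) (sift Q t (a + Q * i))%:R <=
    4 * I%:R * Q%:R / (phi%:R * (2 ^ t)%:R) + 2 ^+ (2 ^ t * remc) :> rat.
Proof.
move=> br.
have g1 p : prime p -> ~~ (p %| Q)%N -> (3 * 1 <= 2 * p)%N by move=> /prime_gt1; lia.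
have [|h _] := @sift_bounds 1 Q isT g1 I t (fun i => a + Q * i)%N.
  move=> p; rewrite mem_plist => /and3P[pp pQ _].
  have [c cp hc] := linear_root a pp pQ; exists [:: c]; split; rewrite //= ?cp //.
  by move=> i; rewrite hc inE.
apply: le_trans h _; rewrite lerD2r.
have := Vd1_bound urs prs br; rewrite -/Q phi_prod => hV.
have p0 : 0 < phi%:R :> rat by rewrite ltr0n phi0.
have q0 : 0 < Q%:R :> rat by rewrite ltr0n.
have t0 : 0 < (2 ^ t)%:R :> rat by rewrite ltr0n expn_gt0.
have I0 : 0 <= I%:R :> rat by [].
rewrite ler_pdivlMr ?mulr_gt0 //.
have {hV} hV : Vd 1 Q t * phi%:R * (2 ^ t)%:R <= 2 * Q%:R.
  by move: hV; rewrite mulrA ler_pdivrMr // mulrAC ler_pdivlMr.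
have := ler_wpM2l I0 hV; lra.
Qed.

(** 9 = 4 * 2 + 1: taking I terms of each class covers the interval with I Q <= 2 * 2^k, and the
    hypothesis on k makes the sieve error worth at most one further unit. *)
Lemma dyadic_bad_count t k : all (fun r => r < 2 ^ 2 ^ t)%N rs ->
  (Q * 2 ^ t * 2 ^ (2 ^ t * remc) <= 2 ^ k)%N ->
  \sum_(2 ^ k <= n < 2 ^ k.+1) (sift Q t n && badc n)%:R <=
     9 * B%:R / (phi%:R * (2 ^ t)%:R) * (2 ^ k)%:R :> rat.
Proof.
move=> br hk; set I := (2 ^ k %/ Q).+1.
have Qk : (Q <= 2 ^ k)%N.
  by apply: leq_trans hk; rewrite -mulnA leq_pmulr // muln_gt0 !expn_gt0.
have p0 : 0 < phi%:R :> rat by rewrite ltr0n phi0.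
have q0 : 0 < Q%:R :> rat by rewrite ltr0n.
have t0 : 0 < (2 ^ t)%:R :> rat by rewrite ltr0n expn_gt0.
have k0 : 0 < (2 ^ k)%:R :> rat by rewrite ltr0n expn_gt0.
apply: le_trans (_ : \sum_(0 <= c < Q) \sum_(0 <= i < I)
   ((sift Q t (2 ^ k + c + Q * i))%:R * (badc (2 ^ k + c)%N)%:R : rat) <= _).
  have -> : \sum_(0 <= c < Q) \sum_(0 <= i < I)
     ((sift Q t (2 ^ k + c + Q * i))%:R * (badc (2 ^ k + c)%N)%:R) =
     \sum_(0 <= j < I * Q) (sift Q t (2 ^ k + j) && badc (2 ^ k + j)%N)%:R :> rat.
    rewrite exchange_big /= big_nat_mul; apply: eq_bigr => i _.
    rewrite mulSn -{1}[(i * Q)%N]add0n big_addn addnK.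
    apply: eq_bigr => c _; rewrite -natrM mulnb addnA [(Q * i)%N]mulnC.
    by rewrite -(badc_mod (_ + _ + i * Q)%N) [X in badc (X %% _)%N]addnC modnMDl badc_mod.
  have -> : \sum_(2 ^ k <= n < 2 ^ k.+1) (sift Q t n && badc n)%:R =
     \sum_(0 <= j < 2 ^ k) (sift Q t (2 ^ k + j) && badc (2 ^ k + j)%N)%:R :> rat.
    rewrite -{1}[(2 ^ k)%N]add0n big_addn expnS mul2n -addnn addnK.
    by apply: eq_bigr => j _; rewrite addnC.
  rewrite [leRHS](@big_cat_nat _ _ _ (2 ^ k)%N) //=.
    by rewrite lerDl; apply: sumr_ge0.
  by rewrite ltnW // ltn_ceil.
apply: le_trans (_ : \sum_(0 <= c < Q)
   ((4 * I%:R * Q%:R / (phi%:R * (2 ^ t)%:R) + 2 ^+ (2 ^ t * remc)) * (badc (2 ^ k + c)%N)%:R : rat) <= _).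
  apply: ler_sum => c _; rewrite -mulr_suml ler_wpM2r //; exact: class_sift.
rewrite -mulr_sumr -natr_sum (shifted_sum (F := fun n => badc n)); last first.
  by move=> n; rewrite badc_mod.
rewrite -/B.
have hI : I%:R * Q%:R <= 2 * (2 ^ k)%:R :> rat.
  rewrite -!natrM ler_nat /I mulSn; have := leq_trunc_div (2 ^ k) Q; lia.
have hr : phi%:R * (2 ^ t)%:R * 2 ^+ (2 ^ t * remc) <= (2 ^ k)%:R :> rat.
  rewrite -natrX -!natrM ler_nat; apply: leq_trans hk.
  by rewrite -!mulnA leq_mul // phi_leQ.
have B0 : 0 <= B%:R :> rat by [].
have -> : 9 * B%:R / (phi%:R * (2 ^ t)%:R) * (2 ^ k)%:R =
  9 * (2 ^ k)%:R / (phi%:R * (2 ^ t)%:R) * B%:R :> rat by ring.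
rewrite ler_wpM2r // -[4 * _ * _]mulrA.
move: hI hr; set x := I%:R * _; set R := 2 ^+ _; set K := (2 ^ k)%:R in k0 *.
set D := phi%:R * _ => hI hr.
have D0 : 0 < D by rewrite mulr_gt0.
rewrite ler_pdivlMr // mulrDl divfK ?lt0r_neq0 //; lra.
Qed.

Lemma rough_bad_sum a s w : all (fun r => r < 2 ^ 2 ^ s)%N rs ->
  (Q * 2 ^ s * 2 ^ (2 ^ s * remc) <= 2 ^ 2 ^ (s + a))%N ->
  \sum_(2 ^ 2 ^ (s + a) <= m < 2 ^ (2 ^ (s + a) * w)) (sift Q s m && badc m)%:R / m%:R <=
    9 * (w * 2 ^ a)%:R * B%:R / phi%:R :> rat.
Proof.
move=> br hk.
have p0 : 0 < phi%:R :> rat by rewrite ltr0n phi0.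
have t0 : 0 < (2 ^ s)%:R :> rat by rewrite ltr0n expn_gt0.
have [->|w0] := posnP w.
  rewrite muln0 expn0 big_geq ?expn_gt0 //.
  by rewrite !mul0n mulr0 !mul0r.
rewrite dyadic_split ?leq_pmulr //.
apply: le_trans (_ : \sum_(2 ^ (s + a) <= k < 2 ^ (s + a) * w)
   9 * B%:R / (phi%:R * (2 ^ s)%:R) <= _).
  rewrite big_nat_cond [leRHS]big_nat_cond; apply: ler_sum => k /andP[/andP[k1 _] _].
  have k0 : 0 < (2 ^ k)%:R :> rat by rewrite ltr0n expn_gt0.
  have hk' : (Q * 2 ^ s * 2 ^ (2 ^ s * remc) <= 2 ^ k)%N.
    by apply: leq_trans hk _; rewrite leq_exp2l.
  have := dyadic_bad_count br hk'; rewrite -ler_pdivrMr //; apply: le_trans.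
  rewrite mulr_suml big_nat_cond [leRHS]big_nat_cond; apply: ler_sum => n /andP[/andP[h _] _].
  rewrite ler_wpM2l // lef_pV2 ?posrE // ?ler_nat // ltr0n (leq_trans _ h) ?expn_gt0 //.
rewrite sumr_const_nat -[leLHS]mulr_natl.
apply: le_trans (_ : (2 ^ (s + a) * w)%:R * (9 * B%:R / (phi%:R * (2 ^ s)%:R)) <= _).
  by rewrite ler_wpM2r ?ler_nat ?leq_subr // divr_ge0 ?mulr_ge0.
rewrite expnD !natrM le_eqVlt; apply/orP; left; apply/eqP; field.
by rewrite !lt0r_neq0.
Qed.
End Classes.

(** The coprimality of the two values makes their roots modulo p distinct, so that exactly two
    classes are removed; 2 divides [E] to ensure 2/p <= 2/3. *)
Lemma two_form_sift E I s (A1 B1 A2 B2 : nat) : (2 %| E)%N ->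
  (forall p, p \in plist E s -> ~~ (p %| B1)%N /\ ~~ (p %| B2)%N) ->
  (forall i, coprime (A1 + B1 * i) (A2 + B2 * i)) ->
  \sum_(0 <= i < I) (sift E s ((A1 + B1 * i) * (A2 + B2 * i)))%:R <=
    2 * I%:R * Vd 2 E s + 2 ^+ (2 ^ s * remc) /\
  I%:R * Vd 2 E s / 2 - s.+1%:R * 2 ^+ (2 ^ s * remc) <=
    \sum_(0 <= i < I) (sift E s ((A1 + B1 * i) * (A2 + B2 * i)))%:R.
Proof.
move=> E2 pB co.
have g p : prime p -> ~~ (p %| E)%N -> (3 * 2 <= 2 * p)%N.
  move=> pp pE; have p2 : p != 2%N by apply: contraNneq pE => ->.
  by have := prime_gt1 pp; lia.
apply: (@sift_bounds 2 E isT g I s (fun i => (A1 + B1 * i) * (A2 + B2 * i))%N).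
move=> p pP; have [p1 p2] := pB p pP.
have pp : prime p by move: pP; rewrite mem_plist => /and3P[].
have [c1 h1 e1] := linear_root A1 pp p1; have [c2 h2 e2] := linear_root A2 pp p2.
exists [:: c1; c2]; split; rewrite //= ?h1 ?h2 // ?inE ?andbT.
  apply: contraT; rewrite negbK => /eqP e.
  have d1 : (p %| A1 + B1 * c1)%N by rewrite e1 modn_small.
  have d2 : (p %| A2 + B2 * c1)%N by rewrite e2 e modn_small.
  have := dvdn_gcd p (A1 + B1 * c1) (A2 + B2 * c1).
  by rewrite d1 d2 (eqP (co c1)) dvdn1 => /eqP ep; rewrite ep in pp.
by move=> i; rewrite Euclid_dvdM // e1 e2 !inE.
Qed.

Lemma rough_ge E s n p : sift E s n -> prime p -> (p %| n)%N -> ~~ (p %| E)%N ->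
  (2 ^ 2 ^ s <= p)%N.
Proof.
move=> h pp pn pE; rewrite leqNgt; apply/negP => lt.
by have := allP h p; rewrite mem_plist pp pE lt pn => /(_ isT).
Qed.

Lemma rough_factors z n w : (1 < z)%N -> (0 < n)%N ->
  (forall p, prime p -> (p %| n)%N -> (z <= p)%N) -> (n < z ^ w.+1)%N ->
  exists s : seq nat, [/\ (size s <= w)%N, all (fun p => prime p && (p %| n)%N) s &
    n = (\prod_(p <- s) p)%N].
Proof.
move=> z1; elim: w n => [|w IH] n n0 hp hn; have [n1|n1] := leqP n 1.
- by exists [::]; rewrite big_nil; split => //; apply/eqP; rewrite eqn_leq n1.
- have := hp _ (pdiv_prime n1) (pdiv_dvd n).
  by have := dvdn_leq n0 (pdiv_dvd n); move: hn; rewrite expn1; lia.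
- by exists [::]; rewrite big_nil; split => //; apply/eqP; rewrite eqn_leq n1.
have pp := pdiv_prime n1; have pn := pdiv_dvd n; set p := pdiv n in pp pn.
have zp := hp p pp pn; have p0 := prime_gt0 pp.
have [m em] : exists m, n = (m * p)%N by exists (n %/ p)%N; rewrite divnK.
have m0 : (0 < m)%N by move: n0; rewrite em muln_gt0 => /andP[].
have hm r : (r %| m -> r %| n)%N by move=> h; rewrite em dvdn_mulr.
have [||s [h1 h2 h3]] := IH m m0.
- by move=> r pr /hm; apply: hp.
- rewrite -(ltn_pmul2r p0) -em; apply: leq_trans hn _.
  by rewrite (expnS z w.+1) mulnC leq_mul2l zp orbT.
exists (p :: s); rewrite big_cons -h3 mulnC; split => //=.
rewrite pp pn /=; apply/allP => r /(allP h2) /andP[-> /hm ->] //.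
Qed.

(** V >= 1/Z gives J V >= Z^2 P R, which absorbs every error term; the main terms J V / 2 and J V /
    4 are then incompatible. *)
Lemma sieve_contradiction (S J V R P Z c : rat) :
  16 <= Z -> 1 <= P -> 1 <= R -> Z^-1 <= V -> V <= 1 ->
  J = Z * (Z * Z * (P * R)) -> c <= Z ->
  J * V / 2 - c * R <= S -> S <= 4 * J * V / 16 + (4 * V + 2 * R) * P -> False.
Proof.
move=> Z16 P1 R1 VZ V1 eJ sZ lo up; have Z1 : 1 <= Z by lra.
have JV : Z * Z * (P * R) <= J * V.
  rewrite eJ -[leLHS]mulr1; have -> : Z * (Z * Z * (P * R)) * V = Z * Z * (P * R) * (Z * V) by ring.
  rewrite ler_wpM2l ?mulr_ge0 //; try lra.
  by rewrite -(divff (_ : Z != 0)) ?ler_wpM2l //; lra.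
have X1 : P <= P * R by rewrite ler_peMr //; lra.
have X2 : R <= P * R by rewrite ler_peMl //; lra.
have X3 : Z * R <= Z * (P * R) by rewrite ler_wpM2l //; lra.
have X0 : 0 <= P * R by lra.
have X4 : 16 * (P * R) <= Z * (P * R) by rewrite ler_wpM2r.
have X5 : 16 * (Z * (P * R)) <= Z * Z * (P * R).
  by rewrite -[Z * Z * _]mulrA ler_wpM2r ?mulr_ge0 //; lra.
have X6 : c * R <= Z * R by rewrite ler_wpM2r //; lra.
have X7 : V * P <= P by rewrite ler_piMl //; lra.
have : P * R <= 0 by lra.
by lra.
Qed.

Lemma leq_24_exp n : (24 * (n + 9) <= 2 ^ (n + 9))%N.
Proof.
elim: n => [//|n]; rewrite addSn expnS => h; have : (0 < n + 9)%N by rewrite addnS.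
by move: h; move: (n + 9)%N => m; set X := (2 ^ m)%N; lia.
Qed.

(** * Two linear forms without bad prime factors *)

Section Search.
Variables (rs : seq nat) (badc : pred nat).
Hypothesis urs : uniq rs.
Hypothesis prs : all prime rs.
Let Q := (\prod_(r <- rs) r)%N.
Hypothesis badc_mod : forall n, badc (n %% Q)%N = badc n.
Hypothesis few : (cS * (\sum_(0 <= c < Q) badc c) <= \prod_(r <- rs) r.-1)%N.
Hypothesis badc_inv : forall n m, (n * m = 1 %[mod Q])%N -> badc n -> badc m.
Hypothesis badc1 : ~~ badc 1%N.
Variables (a1 b1 a2 b2 E : nat).
Hypotheses (a10 : (0 < a1)%N) (a20 : (0 < a2)%N) (b10 : (0 < b1)%N) (b20 : (0 < b2)%N).
Hypotheses (E2 : (2 %| E)%N).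
Hypothesis rE : forall r, r \in rs -> (r %| E)%N.
Hypothesis bE : forall p, prime p -> ~~ (p %| E)%N -> ~~ (p %| b1)%N /\ ~~ (p %| b2)%N.
Let L1 j := (a1 + b1 * j)%N.
Let L2 j := (a2 + b2 * j)%N.
Hypothesis LE : forall p j, prime p -> (p %| E)%N -> ~~ (p %| L1 j)%N /\ ~~ (p %| L2 j)%N.
Hypothesis coL : forall j, coprime (L1 j) (L2 j).
Hypothesis LQ : forall j, (L1 j = 1 %[mod Q])%N /\ (L2 j = 1 %[mod Q])%N.

Let rough s j := sift E s (L1 j * L2 j).

Let bP s m : sift E s m ->
  forall p, p \in plist E s -> ~~ (p %| b1 * m)%N /\ ~~ (p %| b2 * m)%N.
Proof.
move=> sm p pP; have pm := allP sm p pP; move: pP; rewrite mem_plist => /and3P[pp pE _].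
by have [h1 h2] := bE pp pE; rewrite !Euclid_dvdM // !negb_or h1 h2 pm.
Qed.

Lemma Vd2_bounds s : (2 ^+ (cK * s))^-1 <= Vd 2 E s <= 1.
Proof.
apply: Vd_bounds => // p pp pE; have p2 : p != 2%N by apply: contraNneq pE => ->.
by have := prime_gt1 pp; lia.
Qed.

(** The j for which m divides the form lie in one progression of step m. Along it the slopes are
    multiplied by m, and they remain prime to the sifting primes because m itself is sifted. *)
Lemma multiples_count (a b : nat) m s J :
  (a, b) = (a1, b1) \/ (a, b) = (a2, b2) -> (0 < m)%N -> sift E s m ->
  \sum_(0 <= j < J | (m %| a + b * j)%N) (rough s j)%:R <=
    2 * (J %/ m).+1%:R * Vd 2 E s + 2 ^+ (2 ^ s * remc) :> rat.
Proof.
move=> hab m0 sm.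
have Vge : 0 <= Vd 2 E s.
  by have /andP[h _] := Vd2_bounds s; apply: le_trans h; rewrite invr_ge0 exprn_ge0.
have [/existsP ex|no] := boolP [exists j : 'I_J, (m %| a + b * j)%N]; last first.
  rewrite big_nat_cond big1.
    by rewrite addr_ge0 ?mulr_ge0 ?exprn_ge0.
  move=> j /andP[/andP[_ jJ] h]; case/negP: no; apply/existsP; by exists (Ordinal jJ).
case: ex => [[j1 /= _] hj1].
have ex : exists j, (m %| a + b * j)%N by exists j1.
case: (ex_minnP ex) => j0 h0 min {ex hj1}.
have co : coprime m b.
  rewrite /coprime -dvdn1; apply/negPn/negP => h.
  have g1 : (1 < gcdn m b)%N.
    by rewrite ltn_neqAle eq_sym -dvdn1 h gcdn_gt0 m0.
  have pp := pdiv_prime g1; have := pdiv_dvd (gcdn m b); set p := pdiv _ in pp *.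
  rewrite dvdn_gcd => /andP[pm pb]; have pL := dvdn_trans pm h0.
  have [pE|pE] := boolP (p %| E)%N.
    have [n1 n2] := LE j0 pp pE; case: hab pb pL => -[-> ->] pb pL.
      by rewrite /L1 pL in n1.
    by rewrite /L2 pL in n2.
  have [n1 n2] := bE pp pE; case: hab pb => -[_ ->] pb; first by rewrite pb in n1.
  by rewrite pb in n2.
rewrite -big_filter; apply: le_trans (_ :
  \sum_(i <- iota 0 (J %/ m).+1) (rough s (j0 + m * i))%:R <= _).
  apply: sum_reindex_le => //; first by rewrite filter_uniq ?iota_uniq.
  - exact: iota_uniq.
  - by move=> x y /addnI /eqP; rewrite eqn_pmul2l // => /eqP.
  move=> j; rewrite mem_filter mem_index_iota => /andP[mj /andP[_ jJ]].
  have j0j := min _ mj.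
  have : (m %| b * (j - j0))%N.
    by rewrite mulnBr -(subnDl a) -eqn_mod_dvd ?leq_add2l ?leq_mul2l ?j0j ?orbT // (eqP mj) (eqP h0).
  rewrite Gauss_dvdr // => /dvdnP[i ei].
  have ej : j = (j0 + m * i)%N by rewrite mulnC -ei subnKC.
  apply/mapP; exists i => //; rewrite mem_iota add0n ltnS /= leq_divRL //.
  by rewrite mulnC; lia.
have [|i|h _] := @two_form_sift E (J %/ m).+1 s (L1 j0) (b1 * m) (L2 j0) (b2 * m) E2.
- exact: bP.
- have := coL (j0 + m * i); rewrite /L1 /L2 !mulnDr !addnA.
  by rewrite -!mulnA.
apply: le_trans h; rewrite /index_iota subn0 le_eqVlt; apply/orP; left; apply/eqP.
apply: eq_bigr => i _; rewrite /rough /L1 /L2; congr ((sift _ _ (_ * _))%:R); lia.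
Qed.

(** Since L is 1 modulo [Q], the cofactor of v is bad by [badc_inv], and the smaller of v and its
    cofactor is the divisor sought. The cofactor is not 1 because 1 is not bad. *)
Lemma bad_cofactor s j L v : L = L1 j \/ L = L2 j -> rough s j ->
  prime v -> (v %| L)%N -> badc v ->
  exists m, [/\ (m %| L)%N, (m * m <= L)%N, (2 ^ 2 ^ s <= m)%N, badc m &
    forall p, prime p -> (p %| m)%N -> (2 ^ 2 ^ s <= p)%N /\ ~~ (p %| E)%N].
Proof.
move=> hL rj pv vL bv.
have L0 : (0 < L)%N.
  by case: hL => ->; rewrite ?/L1 ?/L2 addn_gt0 ?a10 ?a20.
have hp p : prime p -> (p %| L)%N -> (2 ^ 2 ^ s <= p)%N /\ ~~ (p %| E)%N.
  move=> pp pL; have pE : ~~ (p %| E)%N.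
    apply/negP => pE; have [n1 n2] := LE j pp pE.
    by case: hL pL => -> pL; rewrite pL in n1 n2.
  split => //; apply: (rough_ge rj) => //.
  by case: hL pL => -> pL; [apply: dvdn_mulr|apply: dvdn_mull].
have [h|h] := leqP (v * v) L.
  exists v; split => //; first by have [] := hp v pv vL.
  by move=> p pp pv'; apply: hp => //; apply: dvdn_trans vL.
have [m em] : exists m, L = (v * m)%N by exists (L %/ v)%N; rewrite mulnC divnK.
have v0 := prime_gt0 pv.
have mv : (m < v)%N by rewrite -(ltn_pmul2l v0) -em.
have bm : badc m.
  by apply: (badc_inv (n := v)) => //; rewrite -em; case: hL => ->; case: (LQ j).
have m1 : (1 < m)%N.
  rewrite ltn_neqAle; case: m em bm {mv} => [|m] em bm; first by rewrite em muln0 in L0.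
  by rewrite andbT; apply: contraNneq badc1 => ->.
have mL : (m %| L)%N by rewrite em dvdn_mull.
exists m; split => //.
- by rewrite em leq_mul2r ltnW ?orbT.
- have [] := hp (pdiv m) (pdiv_prime m1) (dvdn_trans (pdiv_dvd _) mL).
  by move=> h1 _; apply: leq_trans h1 (dvdn_leq _ (pdiv_dvd m)); lia.
by move=> p pp pm; apply: hp => //; apply: dvdn_trans mL.
Qed.
Let s0 := (Q + a1 + b1 + a2 + b2)%N.
(** 2^9 = 512 exceeds 364 + 2, so that [z] dominates the sieve error at depth [s0] together with the
    factors [Q] and [2 ^ s0]. *)
Let s := (s0 + 9)%N.
Let z := (2 ^ 2 ^ s)%N.

Lemma scale_Q : (Q * 2 ^ s0 * 2 ^ (2 ^ s0 * remc) <= 2 ^ 2 ^ s)%N.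
Proof.
have h : (s0 < 2 ^ s0)%N by apply: ltn_expl.
have hQ : (Q <= 2 ^ 2 ^ s0)%N.
  apply: leq_trans (ltnW (ltn_expl (2 ^ s0) (isT : (1 < 2)%N))).
  by apply: leq_trans (ltnW h); rewrite /s0 -!addnA leq_addr.
apply: leq_trans (_ : 2 ^ 2 ^ s0 * 2 ^ 2 ^ s0 * 2 ^ (2 ^ s0 * remc) <= _)%N.
  by rewrite leq_mul2r leq_mul ?orbT // leq_exp2l // ltnW.
rewrite -!expnD leq_exp2l // /s expnD remcE.
by have := expn_gt0 2 s0; rewrite -[(2 ^ 9)%N]/(512%N); lia.
Qed.

Lemma scale_L j : (j < z ^ 735)%N -> (L1 j < z ^ 736)%N /\ (L2 j < z ^ 736)%N.
Proof.
move=> jz.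
have hs : (s < z)%N by apply: ltn_trans (ltn_expl _ _) (ltn_expl _ _).
have h a b : (0 < a)%N -> (a + b <= s)%N -> (a + b * j < z ^ 736)%N.
  move=> a0 hab; rewrite (expnS z 735).
  apply: leq_ltn_trans (_ : (a + b) * z ^ 735 < _)%N.
    rewrite mulnDl leq_add ?leq_mul2l ?(ltnW jz) ?orbT // leq_pmulr //.
    exact: leq_ltn_trans jz.
  rewrite ltn_mul2r (leq_ltn_trans _ jz) //=; exact: leq_ltn_trans hs.
by split; apply: h => //; rewrite /s /s0; lia.
Qed.

(** Two depths of sifting: depth [s0] serves to sum the 1/m, where z must be a high power of the
    sifting limit, and depth [s] is what [multiples_count] requires of m. *)
Let RB m := [&& sift Q s0 m, badc m & sift E s m].

Lemma rough_bad_inverse_sum :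
  \sum_(z <= m < z ^ 368 | RB m) (m%:R)^-1 <= 16^-1 :> rat.
Proof.
have br : all (fun r => r < 2 ^ 2 ^ s0)%N rs.
  apply/allP => r rr; have h : (s0 < 2 ^ 2 ^ s0)%N.
    by apply: ltn_trans (ltn_expl _ _) (ltn_expl _ _).
  apply: leq_ltn_trans h; apply: leq_trans (_ : Q <= _)%N; last first.
    by rewrite /s0 -!addnA leq_addr.
  have Q0 : (0 < Q)%N by rewrite /Q big_seq prodn_cond_gt0 // => t /(allP prs) /prime_gt0.
  by apply: dvdn_leq => //; rewrite /Q (big_rem r) //= dvdn_mulr.
have [c ec] := opaque_nat (368 * 2 ^ 9).
have cc : cS = (144 * c)%N by rewrite cSE ec (_ : (2 ^ 9 = 512)%N).
have := rough_bad_sum urs prs badc_mod 368 br scale_Q.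
rewrite -/s expnM -/z -ec.
set B := (\sum_(0 <= c < _) _)%N; set phi := (\prod_(r <- rs) r.-1)%N => h.
have p0 : 0 < phi%:R :> rat.
  rewrite ltr0n /phi big_seq prodn_cond_gt0 // => r /(allP prs) /prime_gt1.
  by case: r => // -[].
apply: le_trans (_ : 9 * c%:R * B%:R / phi%:R <= _); last first.
  rewrite (ler_pdivrMr _ _ p0).
  have := few; rewrite -/B -/phi cc -(ler_nat rat) !natrM; lra.
apply: le_trans h; rewrite big_mkcond /=; apply: ler_sum => m _.
rewrite /RB; case: (sift Q s0 m) => /=; last by rewrite mul0r.
case: (badc m) => /=; last by rewrite mul0r.
by rewrite mul1r; case: ifP => // _; rewrite invr_ge0.
Qed.

Lemma rough_cover J : (J <= z ^ 735)%N ->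
  (forall j, (j < J)%N -> rough s j -> exists v, [/\ prime v, (v %| L1 j * L2 j)%N & badc v]) ->
  \sum_(0 <= j < J) (rough s j)%:R <=
  \sum_(z <= m < z ^ 368 | RB m)
     (\sum_(0 <= j < J | (m %| L1 j)%N) (rough s j)%:R +
      \sum_(0 <= j < J | (m %| L2 j)%N) (rough s j)%:R) :> rat.
Proof.
move=> hJ hbad.
have -> : \sum_(z <= m < z ^ 368 | RB m)
     (\sum_(0 <= j < J | (m %| L1 j)%N) (rough s j)%:R +
      \sum_(0 <= j < J | (m %| L2 j)%N) (rough s j)%:R) =
   \sum_(0 <= j < J) \sum_(z <= m < z ^ 368 | RB m)
     ((m %| L1 j)%N%:R + (m %| L2 j)%N%:R) * (rough s j)%:R :> rat.
  rewrite exchange_big /=; apply: eq_bigr => m _.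
  rewrite big_mkcond [X in _ + X]big_mkcond -big_split /=; apply: eq_bigr => j _.
  by rewrite mulrDl; do 2![case: (m %| _)%N]; rewrite ?mul1r ?mul0r.
rewrite big_nat_cond [leRHS]big_nat_cond; apply: ler_sum => j; rewrite andbT => jJ.
have [rj|_] := boolP (rough s j); last first.
  by apply: sumr_ge0 => m _; rewrite mulr0.
have [v [pv vL bv]] := hbad j jJ rj.
have [l1 l2] := scale_L (leq_trans jJ hJ).
have [L [hL vL']] : exists L, (L = L1 j \/ L = L2 j) /\ (v %| L)%N.
  by move: vL; rewrite Euclid_dvdM // => /orP[h|h]; [exists (L1 j)|exists (L2 j)]; split; auto.
have [m [mL mm zm bm pm]] := bad_cofactor hL rj pv vL' bv.
have mz : (m < z ^ 368)%N.
  rewrite -(ltn_exp2r _ _ (isT : (0 < 2)%N)) -expnM -mulnn.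
  by apply: leq_ltn_trans mm _; case: hL => ->.
have RBm : RB m.
  have small t : (t <= s)%N -> forall p, prime p -> (p < 2 ^ 2 ^ t)%N -> ~~ (p %| m)%N.
    move=> ts p pp lt; apply/negP => pdm; have [ge _] := pm p pp pdm.
    have : (p < 2 ^ 2 ^ s)%N by apply: leq_trans lt _; rewrite !leq_exp2l.
    by rewrite ltnNge ge.
  rewrite /RB bm /=; apply/andP; split; apply/allP => p; rewrite mem_plist => /and3P[pp _].
    by apply: small => //; rewrite /s leq_addr.
  exact: small.
rewrite big_mkcond (bigD1_seq m) /= ?mem_index_iota ?iota_uniq //; last by rewrite zm mz.
rewrite RBm.
rewrite -[leLHS]addr0; apply: lerD; last first.
  by apply: sumr_ge0 => k _; case: ifP => // _; rewrite mulr_ge0 ?addr_ge0.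
rewrite mulr1 -natrD ler1n addn_gt0; case: hL mL => -> ->; rewrite ?orbT //.
Qed.

(** About J V / 2 values of j at least make both forms rough. Those with a bad prime factor have a
    bad divisor m between z and z^368, and their main term is at most 4 J V times the sum of the
    1/m, so at most J V / 4. Rough values below z^736 have at most 735 prime factors. *)
Lemma good_progression : exists j, forall L, L = L1 j \/ L = L2 j ->
  exists f : seq nat, [/\ (size f <= 735)%N, all (fun p => prime p && ~~ badc p) f &
    L = (\prod_(p <- f) p)%N].
Proof.
have z1 : (16 <= z)%N.
  by rewrite /z -[16%N]/(2 ^ 2 ^ 2)%N !leq_exp2l // /s; lia.
(* 735 = 3 + 368 + 364: a margin z^3, the range of the bad divisors, and the sieve error z^364. *)
pose J := (z ^ 735)%N; pose good j := all (fun p => ~~ badc p) (primes (L1 j * L2 j)).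
have [/existsP[[j jJ] /= /andP[rj gj]]|no] :=
    boolP [exists j : 'I_J, rough s j && good j].
  exists j => L hL; have [l1 l2] := scale_L jJ.
  have hp p : prime p -> (p %| L)%N -> (p %| L1 j * L2 j)%N.
    by move=> _; case: hL => -> pL; [apply: dvdn_mulr|apply: dvdn_mull].
  have L0 : (0 < L1 j * L2 j)%N by rewrite muln_gt0 /L1 /L2 !addn_gt0 a10 a20.
  have [||||f [f1 f2 f3]] := @rough_factors z L 735.
  - exact: leq_trans z1.
  - by move: L0; rewrite muln_gt0; case: hL => -> /andP[].
  - move=> p pp pL; apply: (rough_ge rj pp (hp p pp pL)); apply/negP => pE.
    have [n1 n2] := LE j pp pE.
    by case: hL pL => -> pL; rewrite pL in n1 n2.
  - by case: hL => ->.
  exists f; split => //; apply/allP => p /(allP f2) /andP[pp pL]; rewrite pp /=.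
  by apply: (allP gj); rewrite mem_primes pp L0 hp.
have cov : \sum_(0 <= j < J) (rough s j)%:R <= \sum_(z <= m < z ^ 368 | RB m)
     (\sum_(0 <= j < J | (m %| L1 j)%N) (rough s j)%:R +
      \sum_(0 <= j < J | (m %| L2 j)%N) (rough s j)%:R) :> rat.
  apply: rough_cover => // j jJ rj; move: no; rewrite negb_exists => /forallP /(_ (Ordinal jJ)).
  rewrite /= rj /= => /allPn[v]; rewrite mem_primes negbK => /and3P[pv _ vL] bv.
  by exists v.
have [|lo] := @two_form_sift E J s a1 b1 a2 b2 E2 _ coL.
  by move=> p; rewrite mem_plist => /and3P[pp pE _]; apply: bE.
rewrite -/(rough s _) => {}lo.
have /andP[V0 V1] := Vd2_bounds s.
have J0 : 0 <= J%:R :> rat by [].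
have up : \sum_(0 <= j < J) (rough s j)%:R <=
    4 * J%:R * Vd 2 E s / 16 + (4 * Vd 2 E s + 2 * 2 ^+ (2 ^ s * remc)) * (z ^ 368)%:R.
  apply: le_trans cov _.
  apply: le_trans (_ : \sum_(z <= m < z ^ 368 | RB m) (4 * J%:R * Vd 2 E s * (m%:R)^-1 +
     (4 * Vd 2 E s + 2 * 2 ^+ (2 ^ s * remc))) <= _).
    rewrite big_nat_cond [leRHS]big_nat_cond; apply: ler_sum => m /andP[/andP[zm _] /and3P[_ _ sm]].
    have m0 : (0 < m)%N by apply: leq_trans zm; apply: leq_trans z1.
    have c1 := multiples_count J (or_introl (erefl (a1, b1))) m0 sm.
    have c2 := multiples_count J (or_intror (erefl (a2, b2))) m0 sm.
    apply: le_trans (lerD c1 c2) _.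
    have hJ : (J %/ m).+1%:R <= J%:R * (m%:R)^-1 + 1 :> rat.
      rewrite -natr1 lerD2r ler_pdivlMr ?ltr0n // -natrM ler_nat; exact: leq_trunc_div.
    have VV : 0 <= Vd 2 E s by apply: le_trans V0; rewrite invr_ge0 exprn_ge0.
    by have := ler_wpM2r VV hJ; lra.
  rewrite big_split /= -mulr_sumr; apply: lerD.
    rewrite ler_wpM2l ?rough_bad_inverse_sum //.
    by rewrite !mulr_ge0 //; apply: le_trans V0; rewrite invr_ge0 exprn_ge0.
  set C := 4 * _ + _; have C0 : 0 <= C.
    rewrite addr_ge0 ?mulr_ge0 ?exprn_ge0 //.
    by apply: le_trans V0; rewrite invr_ge0 exprn_ge0.
  rewrite big_mkcond; apply: le_trans (_ : \sum_(z <= m < z ^ 368) C <= _).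
    by apply: ler_sum => m _; case: ifP.
  rewrite sumr_const_nat -[leLHS]mulr_natr ler_wpM2l // ler_nat; exact: leq_subr.
move: lo up; set S := \sum_(_ <= _ < _) _; set V := Vd 2 E s in V0 V1 *.
set R := 2 ^+ (2 ^ s * remc); set P : rat := (z ^ 368)%:R; set Z : rat := z%:R => lo up.
have eR : R = Z ^+ 364 by rewrite /R remcE exprM /Z /z natrX.
have Z16 : 16 <= Z by rewrite /Z (ler_nat _ 16).
have Z1 : 1 <= Z by lra.
have Zn n : 1 <= Z ^+ n by apply: exprn_ege1.
have VZ : Z^-1 <= V.
  apply: le_trans V0; rewrite /Z /z natrX lef_pV2 ?posrE ?exprn_gt0 // ler_weXn2l ?ler1n //.
  by rewrite cKE leq_24_exp.
have eJ : J%:R = Z * (Z * Z * (P * R)).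
  by rewrite /J /P natrX eR natrX -/Z -!exprD -expr2 -exprD -exprS.
have sZ : s.+1%:R <= Z.
  by rewrite /Z ler_nat; apply: ltn_trans (ltn_expl _ _) (ltn_expl _ _).
have P1 : 1 <= P by rewrite /P natrX.
have R1 : 1 <= R by rewrite eR.
by case: (sieve_contradiction Z16 P1 R1 VZ V1 eJ sZ lo up).
Qed.
End Search.

(** * Norm forms of cyclotomic fields of prime conductor *)

Section FreeAction.
Local Open Scope group_scope.
Local Open Scope ring_scope.
Variables (k : finFieldType) (d r : nat) (C : 'M[k]_d.+1).
Hypotheses (pr : prime r) (rk : (r%:R : k) != 0).
Hypothesis sumC : \sum_(i < r) C ^+ i = 0.

Lemma cyclotomic_expr : C ^+ r = 1.
Proof. by apply/eqP; rewrite -subr_eq0 subrX1 sumC mulr0. Qed.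

(* No nonzero vector is fixed by [C], so the [C]-orbits on the nonzero vectors
   of a stable space all have length [r]. *)
Lemma stable_card (A : 'M[k]_d.+1) : (A *m C <= A)%MS ->
  (#|k| ^ \rank A = 1 %[mod r])%N.
Proof.
move=> AC; have r0 := prime_gt0 pr.
have CK : C *m C ^+ r.-1 = 1%:M by rewrite -[_ *m _]/(C * _) -exprS prednK // cyclotomic_expr.
have injC : injective (fun v : 'rV[k]_d.+1 => v *m C).
  by move=> u v /(congr1 (mulmx^~ (C ^+ r.-1))); rewrite -!mulmxA CK !mulmx1.
pose s := perm injC.
have sn n v : (s ^+ n)%g v = v *m C ^+ n.
  elim: n => [|n IH]; first by rewrite perm1 mulmx1.
  by rewrite expgSr permM IH permE /= exprSr mulmxA.
have pg : r.-group <[s]>%g.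
  rewrite /pgroup -orderE; apply: pnat_dvd (pnat_id pr).
  by rewrite order_dvdn; apply/eqP/permP => v; rewrite sn cyclotomic_expr mulmx1 perm1.
have ACn n : (A *m C ^+ n <= A)%MS.
  elim: n => [|n IH]; first by rewrite mulmx1.
  by rewrite exprSr mulmxA; apply: submx_trans (submxMr _ IH) AC.
have acts : [acts <[s]>%g, on rowg A | 'P].
  rewrite cycle_subG; apply/astabsP => u; rewrite /= !inE /aperm permE.
  apply/idP/idP => h; last by apply: submx_trans (submxMr _ h) AC.
  by rewrite -[u]mulmx1 -CK mulmxA; apply: submx_trans (submxMr _ h) (ACn _).
have := pgroup_fix_mod pg acts; rewrite card_rowg => ->.
suff -> : 'Fix_(rowg A | 'P)(<[s]>)%g = [set 0] by rewrite cards1.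
rewrite afix_cycle; apply/setP => u; rewrite in_setI in_set1 [u \in rowg A]inE; apply/andP/eqP => [[_]|->].
  move=> /afix1P; rewrite /= /aperm permE => uC.
  have un n : u *m C ^+ n = u.
    by elim: n => [|n IH]; rewrite ?mulmx1 // exprS mulmxA uC.
  have : u *m \sum_(i < r) C ^+ i = r%:R *: u.
    rewrite mulmx_sumr (eq_bigr (fun=> u)) // sumr_const card_ord.
    by rewrite scaler_nat.
  by rewrite sumC mulmx0 => /esym/eqP; rewrite scaler_eq0 (negbTE rk) => /eqP.
split; first exact: sub0mx.
by apply/afix1P; rewrite /= /aperm permE mul0mx.
Qed.
End FreeAction.

(** * Determinants of intertwining matrices over a local ring *)

Section KeyLemma.
(** [R] is a local ring inside [F] whose maximal ideal is generated by [pi], and [rho] is its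
    reduction, meaningful on [R] only. As a predicate it covers both the localizations of the
    integers in the rationals and those of rings of integers inside [algC]. *)
Variables (F : fieldType) (k : finFieldType) (R : F -> Prop) (rho : F -> k) (pi : F).
Hypotheses (R1 : R 1) (RB : forall x y, R x -> R y -> R (x - y))
  (RM : forall x y, R x -> R y -> R (x * y)).
Hypotheses (rho1 : rho 1 = 1) (rhoB : forall x y, R x -> R y -> rho (x - y) = rho x - rho y)
  (rhoM : forall x y, R x -> R y -> rho (x * y) = rho x * rho y).
Hypotheses (rho_surj : forall c, exists2 a, R a & rho a = c).
Hypotheses (RV : forall x, R x -> rho x != 0 -> R x^-1).
Hypotheses (pi0 : pi != 0) (Rpi : R pi) (rho_pi : rho pi = 0).
Hypothesis Rdiv : forall x, R x -> rho x = 0 -> R (x / pi).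

Let R0 : R 0. Proof. by rewrite -(subrr 1); apply: RB. Qed.
Let RN x : R x -> R (- x). Proof. by move=> h; rewrite -sub0r; apply: RB. Qed.
Let RD x y : R x -> R y -> R (x + y).
Proof. by move=> hx hy; rewrite -[y]opprK; apply: RB => //; apply: RN. Qed.
Let rho0 : rho 0 = 0. Proof. by rewrite -(subrr 1) rhoB // subrr. Qed.
Let rhoN x : R x -> rho (- x) = - rho x.
Proof. by move=> h; rewrite -sub0r rhoB // rho0 sub0r. Qed.
Let rhoD x y : R x -> R y -> rho (x + y) = rho x + rho y.
Proof. by move=> hx hy; rewrite -{1}[y]opprK rhoB ?rhoN ?opprK //; apply: RN. Qed.

Lemma R_sum (I : Type) (s : seq I) P (f : I -> F) : (forall i, R (f i)) ->
  R (\sum_(i <- s | P i) f i) /\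
  rho (\sum_(i <- s | P i) f i) = \sum_(i <- s | P i) rho (f i).
Proof.
move=> Rf; apply: (big_ind2 (fun x y => R x /\ rho x = y)) => [|x y z t [h1 h2] [h3 h4]|//].
  by rewrite rho0.
by split; [apply: RD|rewrite rhoD // h2 h4].
Qed.

Lemma R_prod (I : Type) (s : seq I) P (f : I -> F) : (forall i, R (f i)) ->
  R (\prod_(i <- s | P i) f i) /\
  rho (\prod_(i <- s | P i) f i) = \prod_(i <- s | P i) rho (f i).
Proof.
move=> Rf; apply: (big_ind2 (fun x y => R x /\ rho x = y)) => [|x y z t [h1 h2] [h3 h4]|//].
  by rewrite rho1.
by split; [apply: RM|rewrite rhoM // h2 h4].
Qed.

Definition Rmx m n (A : 'M[F]_(m, n)) := forall i j, R (A i j).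

Lemma Rmx_mul m n p (A : 'M_(m, n)) (B : 'M_(n, p)) : Rmx A -> Rmx B ->
  Rmx (A *m B) /\ map_mx rho (A *m B) = map_mx rho A *m map_mx rho B.
Proof.
move=> hA hB; have h i j := R_sum (index_enum 'I_n) xpredT (fun t => RM (hA i t) (hB t j)).
split => [i j|]; first by rewrite mxE; have [] := h i j.
apply/matrixP => i j; rewrite !mxE (proj2 (h i j)); apply: eq_bigr => t _.
by rewrite !mxE rhoM.
Qed.

Lemma Rmx_det n (A : 'M_n) : Rmx A -> R (\det A) /\ rho (\det A) = \det (map_mx rho A).
Proof.
move=> hA; rewrite /determinant.
have hs (b : bool) : R ((-1) ^+ b) /\ rho ((-1) ^+ b) = (-1) ^+ b.
  by case: b; rewrite ?expr0 ?expr1 // rhoN // rho1; split => //; apply: RN.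
have hp (s : 'S_n) := R_prod (index_enum 'I_n) xpredT (fun i => hA i (s i)).
have h (s : 'S_n) : R ((-1) ^+ s * \prod_i A i (s i)).
  by apply: RM; [have [] := hs s|have [] := hp s].
have [h1 ->] := R_sum (index_enum _) xpredT h; split => //; apply: eq_bigr => s _.
have [h2 e2] := hs s; have [h3 e3] := hp s.
by rewrite rhoM // e2 e3; congr (_ * _); apply: eq_bigr => i _; rewrite mxE.
Qed.

Lemma Rmx_adj n (A : 'M_n) : Rmx A -> Rmx (\adj A).
Proof.
move=> hA i j; rewrite mxE /cofactor; apply: RM.
  by rewrite -signr_odd; case: (odd _); rewrite ?expr0 ?expr1 //; apply: RN.
have h : Rmx (row' j (col' i A)) by move=> a b; rewrite !mxE.
by have [] := Rmx_det h.
Qed.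

Variables (d r : nat) (C : 'M[F]_d.+1).
Hypotheses (pr : prime r) (rk : (r%:R : k) != 0).
Hypothesis RC : Rmx C.
Hypothesis sumC : \sum_(i < r) C ^+ i = 0.

Let Cb := map_mx rho C.

Let RX n : R (pi ^+ n).
Proof. by elim: n => [|n IH]; rewrite ?expr0 // exprS; apply: RM. Qed.

Lemma reduced_sumC : \sum_(i < r) Cb ^+ i = 0.
Proof.
have h i : Rmx (C ^+ i) /\ map_mx rho (C ^+ i) = Cb ^+ i.
  elim: i => [|i [h1 h2]].
    rewrite !expr0; split => [a b|]; first by rewrite mxE; case: (a == b).
    by apply/matrixP => a b; rewrite !mxE; case: (a == b); rewrite ?rho1 ?rho0.
  by have [h3 h4] := Rmx_mul RC h1; rewrite !exprS; split => //; rewrite [LHS]h4 h2.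
apply/matrixP => a b; rewrite summxE [RHS]mxE.
have [_ e] := R_sum (index_enum 'I_r) xpredT (fun i : 'I_r => (h i).1 a b).
have : rho ((\sum_(i < r) C ^+ i) a b) = 0 by rewrite sumC mxE rho0.
rewrite summxE e => e0; rewrite -[RHS]e0; apply: eq_bigr => i _.
by rewrite -(h i).2 mxE.
Qed.

Lemma lift_mx m n (B : 'M[k]_(m, n)) : exists2 A : 'M[F]_(m, n), Rmx A & map_mx rho A = B.
Proof.
have h i j : exists a, R a /\ rho a = B i j by have [a] := rho_surj (B i j); exists a.
have [f hf] := fin_all_exists (fun ij : 'I_m * 'I_n => h ij.1 ij.2).
exists (\matrix_(i, j) f (i, j)) => [i j|]; first by rewrite mxE; have [] := hf (i, j).
by apply/matrixP => i j; rewrite !mxE; have [] := hf (i, j).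
Qed.

(* Row-reducing [A] modulo [pi] and dividing the vanishing rows by [pi] lowers
   the valuation of the determinant by the corank, and keeps the
   intertwining relation. *)
Lemma intertwiner_det n (A C1 : 'M[F]_d.+1) u : Rmx A -> Rmx C1 -> A *m C = C1 *m A ->
  R u -> rho u != 0 -> \det A = u * pi ^+ n -> (#|k| ^ n = 1 %[mod r])%N.
Proof.
elim/ltn_ind: n A C1 u => n IH A C1 u RA RC1 AC Ru ru detA.
have [RdA rdA] := Rmx_det RA.
pose Ab := map_mx rho A; pose rk0 := \rank Ab.
have stab1 : (#|k| ^ rk0 = 1 %[mod r])%N.
  apply: (stable_card pr rk reduced_sumC).
  have [_ <-] := Rmx_mul RA RC; rewrite AC; have [_ ->] := Rmx_mul RC1 RA.
  exact: submxMl.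
have stabd : (#|k| ^ d.+1 = 1 %[mod r])%N.
  by have := stable_card pr rk reduced_sumC (submx1 ((1%:M : 'M_d.+1) *m Cb)); rewrite mxrank1.
have [n0|n0] := posnP n; first by rewrite n0.
have rk_lt : (rk0 < d.+1)%N.
  rewrite ltn_neqAle rank_leq_row andbT; apply/negP => full.
  have : Ab \in unitmx by rewrite -row_full_unit /row_full -/rk0.
  rewrite unitmxE -rdA detA rhoM // unitfE.
  by rewrite -(prednK n0) exprS rhoM // rho_pi mul0r mulr0 eqxx.
pose Lb := invmx (col_ebase Ab).
have [L RL rL] := lift_mx Lb.
have uLb : Lb \in unitmx by rewrite unitmx_inv col_ebase_unit.
have [RdL rdL] := Rmx_det RL.
have rdL0 : rho (\det L) != 0 by rewrite rdL rL -unitfE -unitmxE.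
have dL0 : \det L != 0 by apply: contraNneq rdL0 => ->; rewrite rho0.
have uL : L \in unitmx by rewrite unitmxE unitfE.
have RLi : Rmx (invmx L).
  by rewrite /invmx uL => i j; rewrite mxE; apply: RM; [apply: RV|apply: Rmx_adj].
pose A' := L *m A; pose G := L *m C1 *m invmx L.
have [RA' rA'] := Rmx_mul RL RA.
have [RLC _] := Rmx_mul RL RC1; have [RG rG] := Rmx_mul RLC RLi.
have GA : A' *m C = G *m A' by rewrite /A' /G -!mulmxA AC (mulKmx uL).
have eA' : map_mx rho A' = pid_mx rk0 *m row_ebase Ab.
  by rewrite rA' rL /Lb -[map_mx rho A]mulmx_ebase !mulmxA mulVmx ?col_ebase_unit // mul1mx.
have A'0 (i j : 'I_d.+1) : (rk0 <= i)%N -> rho (A' i j) = 0.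
  move=> ri; have := congr1 (fun M : 'M__ => M i j) eA'; rewrite mxE => ->.
  by rewrite mxE big1 // => t _; rewrite mxE ltnNge ri andbF mul0r.
(* The row space of [A] modulo [pi] is stable under [Cb], so the lower left block of [G] vanishes
   modulo [pi]. This is what keeps [G1] integral when the rows are divided. *)
have G0 (i j : 'I_d.+1) : (rk0 <= i)%N -> (j < rk0)%N -> rho (G i j) = 0.
  move=> ri rj; have [_ e1] := Rmx_mul RG RA'; have [_ e2] := Rmx_mul RA' RC.
  have : map_mx rho G *m pid_mx rk0 = pid_mx rk0 *m (row_ebase Ab *m Cb *m invmx (row_ebase Ab)).
    apply: (can_inj (mulmxK (row_ebase_unit Ab))).
    by rewrite -!mulmxA mulVmx ?row_ebase_unit // mulmx1 -eA' -e1 -GA e2 eA' -!mulmxA.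
  move/(congr1 (fun M : 'M__ => M i j)).
  rewrite [RHS]mxE big1 => [|t _]; last first.
    by rewrite mxE ltnNge ri andbF mul0r.
  rewrite mxE (bigD1 j) //= big1 ?addr0 => [|t tj].
    by rewrite !mxE eqxx rj mulr1.
  by rewrite !mxE val_eqE (negbTE tj) mulr0.
pose e (i : 'I_d.+1) := if (i < rk0)%N then 1 else pi.
have e0 i : e i != 0 by rewrite /e; case: ifP => // _; apply: oner_neq0.
pose A1 := \matrix_(i, j) (A' i j / e i); pose G1 := \matrix_(i, j) (G i j * e j / e i).
have RA1 : Rmx A1.
  move=> i j; rewrite mxE /e; case: ltnP => ri; first by rewrite invr1 mulr1.
  by apply: Rdiv; rewrite ?A'0.
have RG1 : Rmx G1.
  move=> i j; rewrite mxE /e; case: (ltnP i) => ri; case: (ltnP j) => rj; rewrite ?mulr1 ?invr1 ?mulr1 //.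
  - exact: RM.
  - by apply: Rdiv; rewrite ?G0.
  - by rewrite mulfK.
have AC1 : A1 *m C = G1 *m A1.
  apply/matrixP => i j; have := congr1 (fun M : 'M__ => M i j) GA; rewrite !mxE => eGA.
  transitivity ((\sum_t A' i t * C t j) / e i).
    by rewrite mulr_suml; apply: eq_bigr => t _; rewrite mxE mulrAC.
  rewrite eGA mulr_suml; apply: eq_bigr => t _; rewrite !mxE.
  by field; rewrite !e0.
have detA' : \det A' = \det A1 * pi ^+ (d.+1 - rk0).
  have -> : A' = diag_mx (\row_i e i) *m A1.
    by apply/matrixP => i j; rewrite mul_diag_mx !mxE mulrC divfK.
  rewrite det_mulmx det_diag mulrC; congr (_ * _).
  rewrite (eq_bigr (fun i : 'I_d.+1 => if (i < rk0)%N then 1 else pi)); last by move=> i _; rewrite mxE.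
  rewrite -(big_mkord xpredT (fun i => if (i < rk0)%N then 1 else pi)).
  rewrite (@big_cat_nat _ _ _ rk0) //= ?(ltnW rk_lt) // big_nat_cond big1 ?mul1r; last first.
    by move=> i /andP[/andP[_ ->]].
  rewrite big_nat_cond (eq_bigr (fun=> pi)); last by move=> i /andP[/andP[h _] _]; rewrite ltnNge h.
  by rewrite -big_nat_cond prodr_const_nat.
have [le|lt] := leqP (d.+1 - rk0) n.
  have stab2 : (#|k| ^ (n - (d.+1 - rk0)) = 1 %[mod r])%N.
    apply: (IH _ _ A1 G1 (\det L * u)) => //.
    - by rewrite ltn_subrL n0 andbT subn_gt0.
    - exact: RM.
    - by rewrite rhoM // mulf_neq0.
    apply: (mulIf (expf_neq0 (d.+1 - rk0) pi0)).
    by rewrite -detA' det_mulmx detA -!mulrA -exprD subnK.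
  have stab3 : (#|k| ^ (d.+1 - rk0) = 1 %[mod r])%N.
    move: stabd; rewrite -{1}(subnK (ltnW rk_lt)) expnD -modnMmr stab1 modnMmr muln1.
    by [].
  by rewrite -(subnK le) expnD -modnMm stab2 stab3 modnMm mul1n.
(* A corank larger than n is impossible: the unit [\det L * u] would be divisible by [pi]. *)
have [RdA1 _] := Rmx_det RA1.
have : rho (\det L * u) = 0.
  have -> : \det L * u = \det A1 * pi ^+ (d.+1 - rk0 - n).-1 * pi.
    apply: (mulIf (expf_neq0 n pi0)).
    rewrite -[LHS]mulrA -detA -det_mulmx -/A' detA' -!mulrA -exprS -exprD.
    by congr (_ * _ ^+ _); rewrite addnS -addSn prednK ?subn_gt0 // subnK // ltnW.
  by rewrite rhoM ?rho_pi ?mulr0 //; apply: RM.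
by rewrite rhoM // => /eqP; rewrite mulf_eq0 (negbTE rdL0) (negbTE ru).
Qed.
End KeyLemma.

(** The companion matrix of 1 + X + ... + X^(d+1) acting on row vectors. Throughout r = d + 2, so
    for r prime this is the r-th cyclotomic polynomial. *)
Definition cyclo_mx (K : pzRingType) d : 'M[K]_d.+1 :=
  \matrix_(i, j) (if i.+1 == j then 1 else if i == ord_max then -1 else 0).

Definition nform_mx (K : pzRingType) d (x : 'I_d.+1 -> K) : 'M[K]_d.+1 :=
  \sum_i x i *: (cyclo_mx K d) ^+ i.

(** The norm of the sum of the x_i zeta^i, zeta the class of X: the determinant of multiplication by
    it on the algebra K[X] / (1 + ... + X^(d+1)). *)
Definition nform (K : comPzRingType) d (x : 'I_d.+1 -> K) : K := \det (nform_mx x).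

Section Cyclo.
Variables (K : nzRingType) (d : nat).
Local Notation C := (cyclo_mx K d).

Lemma delta_cyclo (i : 'I_d.+1) : delta_mx 0 i = delta_mx 0 ord0 *m C ^+ i :> 'rV_d.+1.
Proof.
case: i; elim=> [|n IH] hn; first by rewrite expr0 mulmx1; congr delta_mx; apply: val_inj.
rewrite exprSr mulmxA -(IH (ltnW hn)) -rowE; apply/rowP => j.
rewrite !mxE eqxx /= -val_eqE /= eq_sym; case: eqP => //= _.
by case: eqP => // /(congr1 val) /= e; rewrite e ltnn in hn.
Qed.

(** The first basis vector is cyclic, so it suffices to evaluate there: its successive images are
    the basis vectors and then minus their sum. *)
Lemma cyclo_sum : \sum_(i < d.+2) C ^+ i = 0.
Proof.
have h0 : delta_mx 0 ord0 *m (\sum_(i < d.+2) C ^+ i) = 0 :> 'rV_d.+1.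
  rewrite mulmx_sumr big_ord_recr /= (eq_bigr (fun i : 'I_d.+1 => delta_mx 0 i)); last first.
    by move=> i _; rewrite -delta_cyclo.
  rewrite exprSr mulmxA -[d in C ^+ d]/(nat_of_ord (@ord_max d)) -delta_cyclo -rowE.
  apply/rowP => j; rewrite !mxE summxE (bigD1 j) //= big1 ?addr0; last first.
    by move=> i ij; rewrite mxE eqxx eq_sym (negbTE ij).
  rewrite mxE !eqxx /=; case: eqP => [e|_]; last by rewrite subrr.
  by have := ltn_ord j; rewrite -e /= ltnn.
apply/row_matrixP => i; rewrite row0 rowE delta_cyclo -mulmxA.
have -> : C ^+ i *m (\sum_(j < d.+2) C ^+ j) = (\sum_(j < d.+2) C ^+ j) *m C ^+ i.
  by rewrite mulmx_sumr mulmx_suml; apply: eq_bigr => j _; rewrite -![_ *m _]/(_ * _) -!exprD addnC.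
by rewrite mulmxA h0 mul0mx.
Qed.

End Cyclo.

Lemma nform_mx_comm (K : comNzRingType) d (x : 'I_d.+1 -> K) :
  nform_mx x *m cyclo_mx K d = cyclo_mx K d *m nform_mx x.
Proof.
rewrite mulmx_suml mulmx_sumr; apply: eq_bigr => i _.
by rewrite -scalemxAl -scalemxAr -![_ *m _]/(_ * _) -exprSr exprS.
Qed.

Section Map.
Variables (K K' : comNzRingType) (g : {rmorphism K -> K'}) (d : nat).

Lemma map_cyclo : map_mx g (cyclo_mx K d) = cyclo_mx K' d.
Proof.
apply/matrixP => i j; rewrite !mxE; case: (_ == _); first by rewrite rmorph1.
by case: (_ == _); rewrite ?rmorphN1 ?rmorph0.
Qed.

Lemma map_nform_mx (x : 'I_d.+1 -> K) : map_mx g (nform_mx x) = nform_mx (fun i => g (x i)).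
Proof.
rewrite /nform_mx map_mx_sum; apply: eq_bigr => i _.
by rewrite map_mxZ rmorphXn /= map_cyclo.
Qed.

Lemma map_nform (x : 'I_d.+1 -> K) : g (nform x) = nform (fun i => g (x i)).
Proof. by rewrite /nform -map_nform_mx det_map_mx. Qed.
End Map.

(** The powers of [w] form an eigenvector of the companion matrix, and [nform_mx x] kills it. *)
Lemma nform_root (K : fieldType) d (x : 'I_d.+1 -> K) w :
  \sum_(i < d.+2) w ^+ i = 0 -> \sum_i x i * w ^+ i = 0 -> nform x = 0.
Proof.
move=> hw hx; pose W : 'cV[K]_d.+1 := \col_i w ^+ i.
have CW : cyclo_mx K d *m W = w *: W.
  apply/colP => i; rewrite !mxE; have [->|ni] := eqVneq i ord_max.
    rewrite (eq_bigr (fun j : 'I_d.+1 => - w ^+ j)) => [|j _]; last first.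
      rewrite !mxE eqxx /=; case: eqP => [e|_]; last by rewrite mulN1r.
      by have := ltn_ord j; rewrite -e /= ltnn.
    by move/eqP: hw; rewrite big_ord_recr /= -exprS sumrN addr_eq0 => /eqP ->; rewrite opprK.
  have hi : (i.+1 < d.+1)%N.
    by rewrite ltn_neqAle ltn_ord andbT eqSS; apply: contra ni => /eqP e; apply/eqP/val_inj.
  rewrite (bigD1 (Ordinal hi)) //= !mxE eqxx mul1r exprS big1 ?addr0 // => j ji.
  rewrite !mxE (negbTE ni); case: eqP => [e|_]; last by rewrite mul0r.
  by case/eqP: ji; apply: val_inj.
have CnW n : cyclo_mx K d ^+ n *m W = w ^+ n *: W.
  elim: n => [|n IH]; first by rewrite !expr0 mul1mx scale1r.
  by rewrite exprSr -[_ * _]/(_ *m _) -mulmxA CW -scalemxAr IH scalerA -exprS.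
have AW : nform_mx x *m W = 0.
  rewrite mulmx_suml (eq_bigr (fun i => (x i * w ^+ i) *: W)); last first.
    by move=> i _; rewrite -scalemxAl CnW scalerA.
  by rewrite -scaler_suml hx scale0r.
apply/eqP; rewrite /nform -det_tr; apply/det0P; exists W^T.
  apply/eqP => /(congr1 (fun M : 'M__ => M 0 ord0)); rewrite !mxE /= expr0.
  by apply/eqP; apply: oner_neq0.
by rewrite -trmx_mul AW trmx0.
Qed.

(** The cyclotomic polynomial is irreducible over the rationals, hence prime to a nonzero polynomial
    of smaller degree; a Bezout relation evaluated at the companion matrix inverts [nform_mx x] up
    to a constant. *)
Lemma nform_neq0 d (x : 'I_d.+1 -> rat) : prime d.+2 -> (exists i, x i != 0) -> nform x != 0.
Proof.
move=> pr [i0 xi0]; pose p := \poly_(i < d.+1) x (inord i).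
pose Phi : {poly rat} := \sum_(i < d.+2) 'X^i.
have p0 : p != 0.
  apply: contraNneq xi0 => /(congr1 (fun s : {poly rat} => s`_i0)).
  by rewrite coef_poly ltn_ord inord_val coef0 => ->.
have hp : horner_mx (cyclo_mx rat d) p = nform_mx x.
  rewrite /p poly_def rmorph_sum; apply: eq_bigr => i _.
  by rewrite inord_val /= linearZ /= rmorphXn /= horner_mx_X.
have hPhi : horner_mx (cyclo_mx rat d) Phi = 0.
  rewrite -(cyclo_sum rat d) rmorph_sum; apply: eq_bigr => i _.
  by rewrite rmorphXn /= horner_mx_X.
have co : coprimep p Phi.
  rewrite /coprimep; apply/negPn/negP => h.
  have [z zr] : exists z : algC, root (map_poly ratr (gcdp p Phi)) z.
    apply: (closed_rootP _ _); rewrite size_map_poly; exact: h.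
  move: zr; rewrite gcdp_map root_gcd => /andP[zp zPhi].
  have sz : \sum_(i < d.+2) z ^+ i = 0.
    move: zPhi; rewrite rmorph_sum /root horner_sum => /eqP {2}<-; apply: eq_bigr => i _.
    by rewrite /= rmorphXn /= map_polyX hornerXn.
  have zr1 : z ^+ d.+2 = 1 by apply/eqP; rewrite -subr_eq0 subrX1 sz mulr0.
  have z1 : z != 1.
    apply: contra_eqN sz => /eqP ->; rewrite (eq_bigr (fun=> 1)); last by move=> i _; rewrite expr1n.
    by rewrite sumr_const card_ord pnatr_eq0.
  have prim : d.+2.-primitive_root z.
    have [m prm] := prim_order_exists (ltn0Sn _) zr1.
    have /primeP[_ /(_ m)] := pr; rewrite (prim_order_dvd prm) zr1 eqxx => /(_ isT).
    case/orP => /eqP em; last by rewrite -em.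
    by move: z1; rewrite -[z]expr1 -em (prim_expr_order prm) eqxx.
  have [q [eq _] dv] := minCpolyP z.
  have := dvdp_leq p0 (etrans (esym (dv p)) zp).
  have -> : size q = d.+2.
    rewrite -(size_map_poly (ratr : rat -> algC)) -eq (minCpoly_cyclotomic prim).
    by rewrite size_cyclotomic totient_prime.
  by rewrite ltnNge (size_poly _ _).
have [[a b] /= ab] := Bezout_coprimepP _ _ co.
have [c cu ec] : exists2 c, c != 0 & a * p + b * Phi = c%:P.
  move: ab; rewrite -size_poly_eq1 => /size_poly1P[c c0 e]; by exists c.
have := congr1 (horner_mx (cyclo_mx rat d)) ec.
rewrite rmorphD !rmorphM /= hp hPhi mulr0 addr0 horner_mx_C => e.
have : \det (horner_mx (cyclo_mx rat d) a *m nform_mx x) = c ^+ d.+1.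
  by rewrite -[_ *m _]/(_ * _) e det_scalar.
rewrite det_mulmx; apply: contra_eq_neq; rewrite /nform => ->.
by rewrite mulr0 eq_sym expf_neq0.
Qed.

(** * Norm forms with integer entries at a rational prime *)

Section Localization.
Variable p : nat.
Hypothesis pp : prime p.

Let R (x : rat) := (denq x)%:~R != 0 :> 'F_p.
Let rho (x : rat) : 'F_p := (numq x)%:~R / (denq x)%:~R.

Lemma loc_frac (a b : int) : b%:~R != 0 :> 'F_p ->
  R (a%:~R / b%:~R) /\ rho (a%:~R / b%:~R) = a%:~R / b%:~R.
Proof.
move=> b0; set x : rat := a%:~R / b%:~R.
have bz : b != 0 by apply: contraNneq b0 => ->.
have e : (a * denq x = numq x * b)%R.
  apply: (intr_inj (R := rat)); rewrite !rmorphM /=.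
  rewrite numqE; move: (denq x)%:~R => dx; rewrite /x; field.
  by rewrite intr_eq0 bz.
have dv : (denq x %| b)%Z.
  rewrite -(Gauss_dvdzr (m := denq x) (n := numq x)) -?e ?dvdz_mull //.
  by rewrite coprimez_sym /coprimez -/(coprimez _ _) coprimezE coprime_num_den.
have Rx : R x.
  by have /dvdzP[c ec] := dv; apply: contraNneq b0; rewrite ec rmorphM /= => ->; rewrite mulr0.
split => //; apply: (mulIf b0); rewrite divfK // /rho mulrAC.
by apply: (mulIf Rx); rewrite divfK // -!rmorphM /= e.
Qed.

Lemma locE x : x = (numq x)%:~R / (denq x)%:~R. Proof. by rewrite divq_num_den. Qed.

Lemma int_F0 (a : int) : (a%:~R == 0 :> 'F_p) = (p %| `|a|)%N.
Proof.
have h (n : nat) : (n%:R == 0 :> 'F_p) = (p %| n)%N by rewrite (dvdn_pcharf (pchar_Fp pp)).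
by case: (intP a) => [|n|n] //=; rewrite ?mulrNz ?oppr_eq0 ?abszN; rewrite -?pmulrn h.
Qed.

(** [intertwiner_det] for the localization of the integers at p. The matrix [nform_mx x] commutes
    with the companion matrix, which therefore serves on both sides. *)
Lemma nform_logn (d : nat) (x : 'I_d.+1 -> int) : prime d.+2 -> p != d.+2 ->
  nform x != 0 -> (p ^ logn p `|nform x| = 1 %[mod d.+2])%N.
Proof.
move=> pr pd N0.
pose A : 'M[rat]_d.+1 := nform_mx (fun i => (x i)%:~R).
have RB u v : R u -> R v -> R (u - v) /\ rho (u - v) = rho u - rho v.
  move=> hu hv; have h : (denq u * denq v)%:~R != 0 :> 'F_p by rewrite rmorphM /= mulf_neq0.
  have [h1 h2] := loc_frac (numq u * denq v - numq v * denq u) h.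
  have e : u - v = (numq u * denq v - numq v * denq u)%:~R / (denq u * denq v)%:~R.
    rewrite {1}(locE u) {1}(locE v) rmorphB !rmorphM /=; field.
    by rewrite !intr_eq0 !denq_neq0.
  rewrite e; split => //; rewrite h2 rmorphB !rmorphM /= /rho; field.
  by apply/andP.
have RM u v : R u -> R v -> R (u * v) /\ rho (u * v) = rho u * rho v.
  move=> hu hv; have h : (denq u * denq v)%:~R != 0 :> 'F_p by rewrite rmorphM /= mulf_neq0.
  have [h1 h2] := loc_frac (numq u * numq v) h.
  have e : u * v = (numq u * numq v)%:~R / (denq u * denq v)%:~R.
    rewrite {1}(locE u) {1}(locE v) !rmorphM /=; field.
    by rewrite !intr_eq0 !denq_neq0.
  rewrite e; split => //; rewrite h2 !rmorphM /= /rho; field.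
  by apply/andP.
have Rint (a : int) : R a%:~R /\ rho a%:~R = a%:~R.
  by have := @loc_frac a 1 (oner_neq0 _); rewrite !divr1.
have RV u : R u -> rho u != 0 -> R u^-1.
  move=> hu ru; have hn : (numq u)%:~R != 0 :> 'F_p.
    by apply: contraNneq ru => e; rewrite /rho e mul0r.
  have [h _] := loc_frac (denq u) hn.
  by rewrite (locE u) invf_div.
have Rdiv u : R u -> rho u = 0 -> R (u / p%:R).
  move=> hu /eqP; rewrite mulf_eq0 invr_eq0 [X in _ || X](negbTE hu) orbF int_F0 => /dvdnP[m em].
  have -> : u / p%:R = (sgz (numq u) * m%:Z)%:~R / (denq u)%:~R.
    rewrite {1}(locE u) {1}(intEsg (numq u)) em PoszM !rmorphM /=; field.
    by rewrite intr_eq0 denq_neq0 pnatr_eq0 -lt0n prime_gt0.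
  by have [] := loc_frac (sgz (numq u) * m%:Z) hu.
have detA : \det A = (nform x)%:~R by rewrite -[LHS]/(nform _) -map_nform.
have n0 : (0 < `|nform x|)%N by rewrite absz_gt0.
have [m pm em] := pfactor_coprime pp n0.
have -> : (p ^ logn p `|nform x| = #|'F_p| ^ logn p `|nform x|)%N by rewrite card_Fp.
have surj (c : 'F_p) : exists2 a, R a & rho a = c.
  have [h1 h2] := Rint (val c); exists (val c)%:~R => //.
  by rewrite h2 -pmulrn natr_Zp.
have p0 : p%:R != 0 :> rat by rewrite pnatr_eq0 -lt0n prime_gt0.
have [Rp rp] := Rint p.
have rho_p : rho p%:R = 0 by rewrite [LHS]rp -pmulrn pchar_Fp_0.
have Cint i j : exists a : int, cyclo_mx rat d i j = a%:~R.
  rewrite mxE; case: ifP => _; first by exists 1.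
  by case: ifP => _; [exists (-1)|exists 0].
have RC : Rmx R (cyclo_mx rat d).
  by move=> i j; have [a ->] := Cint i j; have [] := Rint a.
have RA : Rmx R A.
  move=> i j; rewrite /A -(map_nform_mx intr) mxE; by have [] := Rint (nform_mx x i j).
have Rx1 : R 1 by have [] := Rint 1.
have r1 : rho 1 = 1 by have [_ h] := Rint 1; exact: h.
have rk : (d.+2%:R : 'F_p) != 0.
  by have := int_F0 d.+2; rewrite -pmulrn => ->; rewrite absz_nat dvdn_prime2.
have [Ru ru] := Rint (sgz (nform x) * m).
apply: (@intertwiner_det rat 'F_p R rho p%:R Rx1 (fun u v hu hv => (RB u v hu hv).1)
   (fun u v hu hv => (RM u v hu hv).1) r1 (fun u v hu hv => (RB u v hu hv).2)
   (fun u v hu hv => (RM u v hu hv).2) surj RV p0 Rp rho_p Rdiv d d.+2 (cyclo_mx rat d) pr rk RC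
   (cyclo_sum _ _) _ A (cyclo_mx rat d) (sgz (nform x) * m)%:~R) => //.
- exact: nform_mx_comm.
- rewrite ru int_F0 abszM absz_nat (_ : `|sgz (nform x)|%N = 1%N).
    by rewrite mul1n -prime_coprime.
  by case: sgzP N0.
rewrite detA {1}(intEsg (nform x)) em PoszM !rmorphM /= -mulrA; congr (_ * (_ * _)).
by rewrite -em -pmulrn natrX.
Qed.
End Localization.

(** * Prime powers as norms up to a bounded factor *)

Lemma exp_mod_order (r v : nat) : (1 < r)%N -> coprime v r ->
  exists f, [/\ (0 < f)%N, (v ^ f = 1 %[mod r])%N &
    forall M, (v ^ M = 1 %[mod r])%N -> (f %| M)%N].
Proof.
move=> r1 co.
have ex : exists f, (0 < f)%N && (v ^ f == 1 %[mod r])%N.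
  exists (totient r); rewrite totient_gt0 (ltnW r1) /=; apply/eqP.
  exact: Euler_exp_totient.
case: (ex_minnP ex) => f /andP[f0 /eqP vf] min; exists f; split => // M vM.
have vfn n : (v ^ (f * n) = 1 %[mod r])%N.
  by rewrite expnM -modnXm vf modnXm exp1n.
have h : (v ^ (M %% f) = 1 %[mod r])%N.
  by move: vM; rewrite {1}(divn_eq M f) mulnC expnD -modnMml vfn modnMml mul1n.
apply/negPn/negP; rewrite /dvdn -lt0n => h0.
by have := min (M %% f)%N; rewrite h0 h eqxx => /(_ isT); rewrite leqNgt ltn_mod f0.
Qed.

Definition mx_size d : int :=
  \sum_(i < d.+1) \sum_(a < d.+1) \sum_(b < d.+1) `|((cyclo_mx int d) ^+ i) a b|.

Lemma nform_bound d (x : 'I_d.+1 -> int) (B : int) : (forall i, `|x i| <= B) ->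
  `|nform x| <= d.+1`!%:Z * mx_size d ^+ d.+1 * B ^+ d.+1.
Proof.
move=> hx; have B0 : 0 <= B by apply: le_trans (hx ord0).
have entry a b : `|nform_mx x a b| <= mx_size d * B.
  rewrite /nform_mx summxE; apply: le_trans (ler_norm_sum _ _ _) _.
  rewrite /mx_size mulr_suml; apply: ler_sum => i _; rewrite mxE normrM mulrC.
  apply: ler_pM => //; rewrite (bigD1 a) //= (bigD1 b) //= -addrA lerDl.
  by rewrite addr_ge0 // sumr_ge0 // => c _; rewrite sumr_ge0.
have M0 : 0 <= mx_size d * B by apply: le_trans (entry ord0 ord0).
apply: le_trans (ler_norm_sum _ _ _) _.
apply: le_trans (_ : \sum_(s : 'S_d.+1) (mx_size d * B) ^+ d.+1 <= _).
  apply: ler_sum => s _; rewrite normrM normrX normrN1 expr1n mul1r normr_prod.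
  rewrite -[X in _ <= _ ^+ X]card_ord -prodr_const; apply: ler_prod => i _.
  by rewrite normr_ge0 entry.
by rewrite sumr_const card_Sn exprMn -mulrA -[leLHS]mulr_natl natz.
Qed.

(** Depends on r only, so that the factors kappa range over a finite list that is the same for all
    primes v. *)
Definition kbound d : nat := absz (d.+1`!%:Z * mx_size d ^+ d.+1)%R.

(* Pigeonhole: among the integer vectors of a box with more than [v ^ f] points
   two have the same value at a primitive [r]-th root of unity of the field
   with [v ^ f] elements. *)
Lemma norm_of_prime_power d v : prime d.+2 -> prime v -> v != d.+2 ->
  exists f (x : 'I_d.+1 -> int) (kappa : int),
    [/\ (0 < f)%N, forall M, (v ^ M = 1 %[mod d.+2])%N -> (f %| M)%N,
      nform x = kappa * v%:Z ^+ f, kappa != 0 & (`|kappa| <= kbound d)%N].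
Proof.
move=> pr pv vr; set r := d.+2 in pr vr *.
have co : coprime v r by rewrite prime_coprime // dvdn_prime2.
have [f [f0 vf fmin]] := exp_mod_order (isT : 1 < r)%N co.
have [F chF cF] := pPrimePowerField pv f0.
have v0 := prime_gt0 pv.
have [w w0 hw] : exists2 w : F, w != 0 & \sum_(i < r) w ^+ i = 0.
  have dvr : (r %| #|[set: {unit F}]|)%N.
    by rewrite card_finField_unit cF -subn1 -eqn_mod_dvd ?expn_gt0 ?v0 ?vf.
  have [u _ ou] := pgroup.Cauchy (G := [set: {unit F}]%G) pr dvr.
  exists (val u); first by apply/negP => /eqP e; have := valP u; rewrite unitfE e eqxx.
  have e1 : (val u) ^+ r = 1.
    by have := congr1 val (expg_order u); rewrite ou FinRing.val_unitX FinRing.val_unit1.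
  have n1 : val u != 1.
    apply/negP => /eqP e; have : u = 1%g by apply: val_inj.
    by move/eqP; rewrite -order_eq1 ou.
  have : (val u - 1) * \sum_(i < r) val u ^+ i = 0 by rewrite -subrX1 e1 subrr.
  by move/eqP; rewrite mulf_eq0 subr_eq0 (negbTE n1) => /eqP.
have [B hB1 hB2] : exists2 B, (B ^ d.+1 <= v ^ f)%N & (v ^ f < B.+1 ^ d.+1)%N.
  have exb : exists B, (B ^ d.+1 <= v ^ f)%N by exists 0%N; rewrite exp0n.
  have ub B : (B ^ d.+1 <= v ^ f -> B <= v ^ f)%N.
    by apply: leq_trans; case: B => // B; rewrite -{1}(expn1 B.+1) leq_pexp2l.
  case: (ex_maxnP exb ub) => B h1 h2; exists B => //.
  by rewrite ltnNge; apply/negP => /h2; rewrite ltnn.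
pose g (x : {ffun 'I_d.+1 -> 'I_B.+1}) : F := \sum_i (x i)%:R * w ^+ i.
have [x [y [xy gxy]]] : exists x y, x <> y /\ g x = g y.
  have : ~~ injectiveb g.
    apply/negP => /injectiveP inj; have := leq_card g inj.
    by rewrite card_ffun !card_ord cF leqNgt hB2.
  by move=> /injectivePn[x [y h1 h2]]; exists x, y; split => //; apply/eqP.
pose z (i : 'I_d.+1) : int := (x i)%:Z - (y i)%:Z.
have zB i : `|z i| <= B%:Z.
  have := ltn_ord (x i); have := ltn_ord (y i); rewrite /z; lia.
have z0 : exists i, (z i)%:~R != 0 :> rat.
  have [/existsP[i hi]|] := boolP [exists i, x i != y i].
    by exists i; rewrite intr_eq0 subr_eq0; apply: contra hi => /eqP [e]; apply/eqP/val_inj.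
  rewrite negb_exists => /forallP h; case: xy; apply/ffunP => i; apply/eqP.
  by have := h i; rewrite negbK.
have N0 : nform z != 0.
  by have := nform_neq0 pr z0; rewrite -map_nform intr_eq0.
have vN : (v %| `|nform z|)%N.
  have : (nform z)%:~R = 0 :> F.
    rewrite (map_nform intr); apply: (nform_root hw).
    rewrite -[RHS](subrr (g x)) {2}gxy /g -sumrB; apply: eq_bigr => i _.
    by rewrite /z rmorphB mulrBl.
  have h (n : nat) : (n%:R == 0 :> F) = (v %| n)%N by rewrite (dvdn_pcharf chF).
  move/eqP; rewrite {1}(intEsg (nform z)) rmorphM mulf_eq0 /= -pmulrn h.
  by case/orP => //; case: sgzP N0 => // _ _; rewrite ?mulrN1z ?oppr_eq0 oner_eq0.
have n0 : (0 < `|nform z|)%N by rewrite absz_gt0.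
(* The exponent of v in the norm is positive, and by [nform_logn] it is a multiple of the order f of
   v modulo r. *)
have dvf : (v ^ f %| `|nform z|)%N.
  apply: dvdn_trans (pfactor_dvdnn v _); apply: dvdn_exp2l.
  apply: dvdn_leq; first by rewrite logn_gt0 mem_primes pv n0 vN.
  by apply: fmin; apply: nform_logn.
have [kap eN] : exists kap, nform z = kap * v%:Z ^+ f.
  have : ((v ^ f)%N%:Z %| nform z)%Z by rewrite dvdzE absz_nat.
  by move=> /dvdzP[c ->]; exists c; rewrite -natz natrX natz.
exists f, z, kap; split => //; first by apply: contraNneq N0; rewrite eN => ->; rewrite mul0r.
have vf0 : 0 < v%:Z ^+ f by rewrite exprn_gt0.
have := nform_bound zB; rewrite eN normrM (gtr0_norm vf0) => hb.
have kb0 : 0 <= d.+1`!%:Z * mx_size d ^+ d.+1.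
  by rewrite mulr_ge0 ?exprn_ge0 // !sumr_ge0 // => a _; rewrite !sumr_ge0 // => b _; rewrite sumr_ge0.
rewrite -lez_nat /kbound !abszE (ger0_norm kb0) -(ler_pM2r vf0).
apply: le_trans hb _; apply: ler_wpM2l => //.
by move: hB1; rewrite -lez_nat -!natz !natrX !natz.
Qed.

Local Open Scope nat_scope.

(** * The auxiliary primes *)

Lemma geom_expand q y : exists Z,
  \sum_(i < q) (1 + y) ^ i = q + 'C(q, 2) * y + y * y * Z.
Proof.
have hp i : exists z, (1 + y) ^ i = 1 + i * y + y * y * z.
  elim: i => [|i [z ez]]; first by exists 0; rewrite expn0 mul0n muln0.
  by exists (i + z + y * z); rewrite expnS ez; ring.
elim: q => [|q [Z eZ]]; first by exists 0; rewrite big_ord0 mul0n muln0.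
have [z ez] := hp q; exists (Z + z).
by rewrite big_ord_recr /= eZ ez binS bin1; ring.
Qed.

Lemma lift_exponent q t w : prime q -> 2 < q -> 0 < t -> exists K,
  \sum_(i < q) (1 + q ^ t * w) ^ i = q * (1 + q ^ t * (q./2 * w + q ^ t.-1 * K)).
Proof.
move=> pq q2 t0; have oq : odd q by case: (even_prime pq) => // e; rewrite e in q2.
have [Z ->] := geom_expand q (q ^ t * w).
exists (w * w * Z); rewrite bin2odd //.
have -> : q.-1./2 = q./2 by have := odd_double_half q; rewrite oq; lia.
by case: t t0 => // t _; rewrite expnS /=; ring.
Qed.

Lemma expn1D_geom y n : (1 + y) ^ n = 1 + y * \sum_(i < n) (1 + y) ^ i.
Proof.
elim: n => [|n IH]; first by rewrite big_ord0 muln0.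
by rewrite big_ord_recr /= mulnDr addnA -IH expnS; ring.
Qed.

Lemma lte_step q t w : prime q -> 2 < q -> 0 < t -> ~~ (q %| w) ->
  exists2 w', ~~ (q %| w') & (1 + q ^ t * w) ^ q = 1 + q ^ t.+1 * w'.
Proof.
move=> pq q2 t0 qw; have [K eK] := lift_exponent w pq q2 t0.
exists (w * (1 + q ^ t * (q./2 * w + q ^ t.-1 * K))); last first.
  by rewrite expn1D_geom eK expnS; ring.
rewrite Euclid_dvdM // negb_or qw /= dvdn_addl ?dvdn1 ?dvdn_mulr ?dvdn_exp //.
by apply: contraTneq q2 => ->.
Qed.

Lemma primes_cong1 N m : 0 < m -> (forall r, prime r -> r %| m -> r = 1 %[mod N]) ->
  m = 1 %[mod N].
Proof.
elim/ltn_ind: m => m IH m0 h; have [m1|m1] := leqP m 1.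
  by have -> : m = 1 by lia.
have pp := pdiv_prime m1; have /dvdnP[c ec] := pdiv_dvd m.
have c0 : 0 < c by move: m0; rewrite ec muln_gt0 => /andP[].
rewrite ec -modnMmr (h _ pp (pdiv_dvd m)) modnMmr muln1; apply: IH => //.
  by rewrite [X in _ < X]ec ltn_Pmulr // prime_gt1.
by move=> r pr rc; apply: h => //; rewrite ec dvdn_mulr.
Qed.

(** For the exponent n + 1: let a = l^(q-1) and let s be the order of a - 1 at q. By lifting the
    exponent, A = a^(q^n) is 1 + q^(s+n) v with v prime to q, and (A^q - 1)/(A - 1) = q m where m is
    not 1 modulo q^(s+n+1). Hence some prime r dividing m has r - 1 not divisible by q^(s+n+1),
    while a has order exactly q^(n+1) modulo r. *)
Lemma special_prime l q : prime l -> prime q -> 2 < q -> l != q ->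
  exists s, forall n, 1 < n -> exists r,
    [/\ prime r, r != l, forall M, l ^ M = 1 %[mod r] -> q ^ n %| M,
      l ^ (q.-1 * q ^ n) = 1 %[mod r] & ~~ (q ^ (s + n) %| r.-1)].
Proof.
move=> pl pq q2 lq; set a := l ^ q.-1; have q0 := prime_gt0 pq.
have l1 := prime_gt1 pl; have q1 := prime_gt1 pq.
have a1 : 1 < a by rewrite -(exp1n q.-1) ltn_exp2r //; lia.
have [w [qw ew]] : exists w, ~~ (q %| w) /\ a = 1 + q ^ logn q a.-1 * w.
  have [w cw ew] := @pfactor_coprime q a.-1 pq (ltac:(lia)).
  exists w; rewrite -prime_coprime // cw; split=> //; rewrite mulnC -ew; lia.
set s := logn q a.-1 in ew; have s0 : 0 < s.
  rewrite logn_gt0 mem_primes pq /=; apply/andP; split; first lia.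
  rewrite -subn1 -eqn_mod_dvd; last by lia.
  rewrite /a -(totient_prime pq); apply/eqP; apply: Euler_exp_totient.
  by rewrite coprime_sym prime_coprime // dvdn_prime2 // eq_sym.
have aq n : exists2 w, ~~ (q %| w) & a ^ (q ^ n) = 1 + q ^ (s + n) * w.
  elim: n => [|n [v qv ev]]; first by exists w; rewrite // expn1 addn0.
  have [|v' h1 h2] := @lte_step q (s + n) v pq q2 _ qv; first by rewrite addn_gt0 s0.
  by exists v' => //; rewrite expnSr expnM ev h2 addnS.
(* From here n is one less than in the statement; the hypothesis leaves n > 0, so that q divides
   [q ^ (s + n).-1] below. *)
exists s => -[//|n] n1.
have [v qv ev] := aq n; set A := a ^ (q ^ n) in ev.
have t0 : 0 < s + n by rewrite addn_gt0 s0.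
have [K eK] := lift_exponent v pq q2 t0; rewrite -ev in eK.
set m := 1 + _ in eK.
have [r [pr rm rn]] : exists r, [/\ prime r, r %| m & ~~ (q ^ (s + n).+1 %| r.-1)].
  have [/hasP[r]|/hasPn h] := boolP (has (fun r => ~~ (q ^ (s + n).+1 %| r.-1)) (primes m)).
    by rewrite mem_primes => /and3P[pr _ rm] h; exists r.
  have : m = 1 %[mod q ^ (s + n).+1].
    apply: primes_cong1 => // r pr rm; apply/eqP; rewrite eqn_mod_dvd ?prime_gt0 // subn1.
    by apply/negPn/h; rewrite mem_primes pr rm.
  move/eqP; rewrite /m eqn_mod_dvd ?leq_addr // addKn expnSr dvdn_pmul2l ?expn_gt0 ?q0 //.
  rewrite dvdn_addl; last by rewrite dvdn_mulr // dvdn_exp //; lia.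
  rewrite Euclid_dvdM // (negbTE qv) orbF => /dvdn_leq; lia.
have qm : ~~ (q %| m).
  rewrite /m dvdn_addl ?dvdn1; last by rewrite dvdn_mulr // dvdn_exp.
  by apply: contraTneq q2 => ->.
have rq : r != q by apply: contraNneq qm => <-.
have Aq : A ^ q = 1 %[mod r].
  rewrite ev expn1D_geom -ev eK; case/dvdnP: rm => c ->.
  by rewrite !mulnA addnC modnMDl.
have eAq : A ^ q = l ^ (q.-1 * q ^ n.+1) by rewrite /A /a -!expnM expnSr mulnA.
have rl : r != l.
  apply/eqP => e; have : r %| A ^ q by rewrite eAq e dvdn_exp // muln_gt0 expn_gt0 q0 -subn1 subn_gt0 q1.
  by rewrite /dvdn Aq modn_small ?prime_gt1.
have A1 : A <> 1 %[mod r].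
  move=> h; have : \sum_(i < q) A ^ i = q %[mod r].
    elim: (q) => [|i IH]; first by rewrite big_ord0.
    by rewrite big_ord_recr /= -modnDm IH -(modnXm i r A) h modnXm exp1n modnDm addn1.
  rewrite eK => h2; have : r %| q by rewrite /dvdn -h2; apply: dvdn_mull.
  by rewrite dvdn_prime2 // (negbTE rq).
exists r; split=> //; last by rewrite addnS.
  move=> M lM; have aM : a ^ M = 1 %[mod r].
    by rewrite /a -expnM mulnC expnM -modnXm lM modnXm exp1n.
  have co : coprime a r by rewrite coprimeXl // prime_coprime // dvdn_prime2 // eq_sym.
  have [f [f0 af fmin]] := exp_mod_order (prime_gt1 pr) co.
  have := fmin (q ^ n.+1); rewrite expnSr expnM -/A => /(_ Aq).
  rewrite -expnSr => /(dvdn_pfactor _ _ pq)[m' m'n ef].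
  have : m' = n.+1.
    apply/eqP; rewrite eqn_leq m'n ltnNge; apply/negP => mn; apply: A1.
    rewrite /A -(subnK mn) expnD -ef mulnC expnM -modnXm af modnXm exp1n //.
  by move=> e; rewrite -e -ef; apply: fmin.
by rewrite -eAq.
Qed.

(** * Solutions of the linear equation with good prime factors *)

Definition cofexp e r := (r.-1 %/ e)%N.
(** By Euler's criterion, n is prime to r and not an e-th power modulo r when e divides r - 1. *)
Definition badr e r n := ~~ (r %| n) && (n ^ cofexp e r != 1 %[mod r]).
(** Bad for every r: a single r modulo which a prime p is an e-th power is enough, because the order
    of p modulo r then divides (r - 1)/e. *)
Definition badc e rs n := all (fun r => badr e r n) rs.

Lemma badr_mod e r n : badr e r (n %% r) = badr e r n.
Proof. by rewrite /badr modnXm /dvdn modn_mod. Qed.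

(** With M = (r - 1)/e, X^(r-1) - 1 = (X^M - 1) g where g has degree M (e - 1), and the units that
    are not e-th powers are roots of g. *)
Lemma badr_count e r : prime r -> e %| r.-1 ->
  count (badr e r) (iota 0 r) <= cofexp e r * e.-1.
Proof.
move=> pr er; set M := cofexp e r.
have r1 : 0 < r.-1 by have := prime_gt1 pr; lia.
have e0 : 0 < e by rewrite (dvdn_gt0 _ er).
have eM : r.-1 = M * e by rewrite /M /cofexp divnK.
have M0 : 0 < M by move: r1; rewrite eM muln_gt0 => /andP[].
rewrite -size_filter; set s := filter _ _.
pose g : {poly 'F_r} := (\sum_(i < e) 'X^(M * i))%R.
have h (n : nat) : (n%:R == 0 :> 'F_r)%R = (r %| n).
  by rewrite (dvdn_pcharf (pchar_Fp pr)).
have g0 : (g != 0)%R.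
  apply/eqP => /(congr1 (horner^~ 0%R)); rewrite horner0 /g horner_sum.
  rewrite (bigD1 (Ordinal e0)) //= muln0 expr0 hornerC big1 ?addr0.
    by apply/eqP; rewrite oner_eq0.
  move=> i i0; rewrite hornerXn expr0n muln_eq0 (gtn_eqF M0) /=.
  by rewrite (_ : (i == 0 :> nat) = false) //; apply: contraNF i0 => /eqP h0; apply/eqP/val_inj.
have sg : size g <= (M * e.-1).+1.
  apply: leq_trans (size_sum _ _ _) _; apply/bigmax_leqP => i _.
  by rewrite size_polyXn ltnS leq_mul2l -ltnS prednK // ltn_ord orbT.
pose rs : seq 'F_r := [seq (c%:R)%R | c <- s].
have ur : uniq rs.
  rewrite map_inj_in_uniq ?filter_uniq ?iota_uniq // => x y.
  rewrite !mem_filter !mem_iota !add0n => /andP[_ /andP[_ xr]] /andP[_ /andP[_ yr]].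
  wlog xy : x y xr yr / x <= y.
    move=> W; have [xy|/ltnW yx] := leqP x y; first exact: W.
    by move=> e'; apply/esym/W.
  move=> /eqP; rewrite eq_sym -subr_eq0 -natrB // h => /dvdnP[c ec].
  by case: c ec => [|c]; nia.
have rr : all (root g) rs.
  apply/allP => _ /mapP[c cs ->]; move: cs; rewrite mem_filter => /andP[/andP[rc cM] _].
  have c1 : (c%:R ^+ r.-1 = 1 :> 'F_r)%R.
    have c0 : (c%:R != 0 :> 'F_r)%R by rewrite h.
    apply: (mulfI c0); rewrite -exprS prednK ?prime_gt0 // mulr1.
    by rewrite -[X in (_ ^+ X)%R](card_Fp pr) expf_card.
  have : ((c%:R ^+ M - 1) * g.[c%:R] = 0 :> 'F_r)%R.
    rewrite /g horner_sum (eq_bigr (fun i : 'I_e => (c%:R ^+ M) ^+ i)%R); last first.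
      by move=> i _; rewrite hornerXn exprM.
    by rewrite -subrX1 -exprM -eM c1 subrr.
  move/eqP; rewrite mulf_eq0 => /orP[|//]; rewrite -natrX.
  have cp : 0 < c ^ M by rewrite expn_gt0; case: (c) rc => //; rewrite dvdn0.
  rewrite -(natrB _ cp) h -eqn_mod_dvd // => e1; by rewrite e1 in cM.
have := max_poly_roots g0 rr ur; rewrite size_map => hs.
by have := leq_trans hs sg; rewrite ltnS.
Qed.

Lemma big_mkcond_nat (s : seq nat) (P : pred nat) :
  \sum_(c <- s | P c) 1 = \sum_(c <- s) (P c : nat).
Proof. by rewrite big_mkcond; apply: eq_bigr => c _; case: (P c). Qed.

Section Good.
Variables (e : nat) (rs : seq nat).
Hypotheses (urs : uniq rs) (prs : all prime rs) (ers : all (fun r => e %| r.-1) rs).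
Hypothesis few : cS * e.-1 ^ size rs <= e ^ size rs.
Hypothesis rs0 : 0 < size rs.
Let Q := \prod_(r <- rs) r.

Let Q_dvd r : r \in rs -> r %| Q.
Proof. by move=> h; rewrite /Q (big_rem r) //= dvdn_mulr. Qed.

Lemma badc_mod n : badc e rs (n %% Q) = badc e rs n.
Proof.
apply: eq_in_all => r rr; rewrite -badr_mod modn_dvdm ?badr_mod //; exact: Q_dvd.
Qed.

Lemma badc_inv n m : n * m = 1 %[mod Q] -> badc e rs n -> badc e rs m.
Proof.
move=> nm /allP h; apply/allP => r rr; have pr := allP prs r rr.
have nmr : n * m = 1 %[mod r].
  by rewrite -(modn_dvdm _ (Q_dvd rr)) nm modn_dvdm ?Q_dvd.
have /andP[rn nM] := h r rr; apply/andP; split.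
  apply/negP => rm; have : r %| n * m by apply: dvdn_mull.
  by rewrite /dvdn nmr modn_small ?prime_gt1.
apply: contraNneq nM => mM; apply/eqP.
have : n ^ cofexp e r * m ^ cofexp e r = 1 %[mod r].
  by rewrite -expnMn -modnXm nmr modnXm exp1n.
by rewrite -modnMmr mM modnMmr muln1.
Qed.

Lemma badc1 : ~~ badc e rs 1.
Proof.
case: (rs) rs0 => // r t _; rewrite /= negb_and /badr exp1n eqxx.
by rewrite andbF.
Qed.

(** By Chinese remaindering the counts for the several r multiply, giving at most (1 - 1/e)^R of the
    units modulo [Q], with R the length of [rs]. *)
Lemma few_badc : cS * \sum_(0 <= c < Q) badc e rs c <= \prod_(r <- rs) r.-1.
Proof.
pose k r := count (badr e r) (iota 0 r).
have okp p : p \in rs -> prime p /\ exists W : seq nat,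
    [/\ uniq W, size W = k p, all (fun a => a < p) W & forall i, badr e p i = (i %% p \in W)].
  move=> pr; split; first exact: (allP prs).
  exists (filter (badr e p) (iota 0 p)); split.
  - by rewrite filter_uniq ?iota_uniq.
  - by rewrite size_filter.
  - by apply/allP => a; rewrite mem_filter mem_iota => /andP[_ /andP[]].
  move=> i; rewrite mem_filter mem_iota add0n ltn_mod badr_mod.
  by rewrite prime_gt0 ?andbT //; apply: (allP prs).
have [W [uW sW aW hW]] := crt_residues (bad := badr e) (ok := [in rs]) okp urs (allss _).
have -> : \sum_(0 <= c < Q) badc e rs c = \prod_(r <- rs) k r.
  rewrite -sW (eq_big_nat _ _ (F2 := fun c => (c \in W : nat))); last first.
    by move=> c /andP[_ cQ]; rewrite [badc _ _ _]hW modn_small.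
  rewrite -big_mkcond_nat sum1_count -size_filter; apply: perm_size; apply: uniq_perm => //.
    by rewrite filter_uniq ?iota_uniq.
  move=> c; rewrite mem_filter mem_index_iota /=; case: (boolP (c \in W)) => //= cW.
  exact: (allP aW).
apply: leq_trans (_ : cS * \prod_(r <- rs) (cofexp e r * e.-1) <= _).
  rewrite leq_mul2l; apply/orP; right; rewrite big_seq [leqRHS]big_seq.
  by apply: leq_prod => r rr; apply: badr_count; [apply: (allP prs)|apply: (allP ers)].
have hprod c : \prod_(r <- rs) (cofexp e r * c) = (\prod_(r <- rs) cofexp e r) * c ^ size rs.
  by rewrite big_split /= big_const_seq count_predT iter_muln_1.
have -> : \prod_(r <- rs) r.-1 = \prod_(r <- rs) (cofexp e r * e).
  rewrite big_seq [RHS]big_seq; apply: eq_bigr => r rr.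
  by rewrite /cofexp divnK //; apply: (allP ers).
by rewrite !hprod mulnCA leq_mul2l few orbT.
Qed.

(** [L1] and [L2] form a progression of solutions. The initial one satisfies b0 = 1 modulo h, which
    keeps both forms prime to h, and h b0 = 1 + lam^2 modulo lam^3, which makes x0, and not only b0,
    equal to 1 modulo lam. *)
Lemma good_pair (lam h : nat) : 1 < lam -> 2 %| lam -> (forall r, r \in rs -> r %| lam) ->
  0 < h -> h = 1 %[mod lam] ->
  exists b x, h * b = 1 + lam ^ 2 * x /\ forall L, L = b \/ L = x ->
    exists f : seq nat, [/\ size f <= 735,
      all (fun p => [&& prime p, ~~ (p %| lam) & ~~ badc e rs p]) f & L = \prod_(p <- f) p].
Proof.
move=> lam1 lam2 rlam h0 h1; have lam0 : 0 < lam by lia.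
have coh : coprime lam h.
  by rewrite -coprime_modr h1 coprime_modr coprimen1.
have lam30 : 0 < lam ^ 3 by rewrite expn_gt0 lam0.
have co3 : coprime (lam ^ 3) (h ^ 2) by rewrite coprimeXl // coprimeXr.
have h20 : 0 < h ^ 2 by rewrite expn_gt0 h0.
(* The multiple of [(lam ^ 3).-1] stands for -(1 + lam^2) modulo lam^3, in natural numbers. *)
have [c hc] := coprime_solve (h + (lam ^ 3).-1 * (1 + lam ^ 2)) lam30 h20 co3.
pose b0 := 1 + h * c.
have hb0 : h * b0 = 1 + lam ^ 2 %[mod lam ^ 3].
  apply/eqP; rewrite -(eqn_modDr ((lam ^ 3).-1 * (1 + lam ^ 2))).
  have -> : 1 + lam ^ 2 + (lam ^ 3).-1 * (1 + lam ^ 2) = lam ^ 3 * (1 + lam ^ 2).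
    by rewrite -{2}(prednK lam30); ring.
  rewrite modnMr; have -> : h * b0 + (lam ^ 3).-1 * (1 + lam ^ 2) =
    h + (lam ^ 3).-1 * (1 + lam ^ 2) + h ^ 2 * c by rewrite /b0; ring.
  exact: hc.
have hb0p : 0 < h * b0 by rewrite muln_gt0 h0.
have [x0 ex0] : exists x0, h * b0 = 1 + lam ^ 2 * x0.
  have : h * b0 = 1 %[mod lam ^ 2].
    have d : lam ^ 2 %| lam ^ 3 by rewrite dvdn_exp2l.
    by rewrite -(modn_dvdm _ d) hb0 modn_dvdm // addnC modnDl.
  move/eqP; rewrite eqn_mod_dvd // => /dvdnP[x0 e0].
  by exists x0; rewrite [lam ^ 2 * _]mulnC -e0 subnKC.
have x01 : x0 = 1 %[mod lam].
  move: hb0; rewrite ex0 => /eqP; rewrite eqn_modDl (expnSr lam 2) => /eqP.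
  rewrite -[X in _ = X %% _ -> _](muln1 (lam ^ 2)) -!muln_modr.
  by move=> /eqP; rewrite eqn_pmul2l ?expn_gt0 ?lam0 // => /eqP.
have b01 : b0 = 1 %[mod lam].
  have : h * b0 = 1 %[mod lam].
    by rewrite ex0 expnSr mulnAC addnC modnMDl.
  by rewrite -modnMml h1 modnMml mul1n.
pose L1 j := b0 + lam ^ 3 * h * j; pose L2 j := x0 + lam * h ^ 2 * j.
have eL j : h * L1 j = 1 + lam ^ 2 * L2 j.
  by rewrite /L1 /L2 mulnDr ex0; ring.
have L1l j : L1 j = 1 %[mod lam] by rewrite /L1 expnS -!mulnA addnC mulnC modnMDl b01.
have L2l j : L2 j = 1 %[mod lam] by rewrite /L2 -!mulnA addnC mulnC modnMDl x01.
have coL j : coprime (L1 j) (L2 j).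
  rewrite /coprime -dvdn1; set g := gcdn _ _.
  have : g %| 1 + lam ^ 2 * L2 j by rewrite -eL dvdn_mull // dvdn_gcdl.
  by rewrite dvdn_addl // dvdn_mull // dvdn_gcdr.
have nd p j L : prime p -> p %| lam -> L = L1 j \/ L = L2 j -> ~~ (p %| L).
  move=> pp pl hL; have : L = 1 %[mod p].
    by rewrite -(modn_dvdm _ pl); case: hL => ->; rewrite ?L1l ?L2l modn_dvdm.
  by rewrite /dvdn => ->; rewrite modn_small ?prime_gt1.
have Ql : Q %| lam.
  by apply: prod_primes_dvd => //; apply/allP => r rr; apply: rlam.
have x00 : 0 < x0.
  by rewrite lt0n; apply/negP => /eqP e0; move: x01; rewrite e0 mod0n modn_small.
have [j hj] : exists j, forall L, L = L1 j \/ L = L2 j -> exists f : seq nat,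
    [/\ size f <= 735, all (fun p => prime p && ~~ badc e rs p) f & L = \prod_(p <- f) p].
  apply: (good_progression urs prs badc_mod few_badc badc_inv badc1
     (a1 := b0) (b1 := lam ^ 3 * h) (a2 := x0) (b2 := lam * h ^ 2) (E := lam * h)) => //.
  - by rewrite muln_gt0 lam30.
  - by rewrite muln_gt0 lam0.
  - by rewrite dvdn_mulr.
  - move=> p pp; rewrite Euclid_dvdM // negb_or => /andP[pl ph].
    by rewrite !(Euclid_dvdM _ _ pp) !negb_or pl ph.
  - move=> p j pp; rewrite Euclid_dvdM // => /orP[pl|ph].
      by split; [apply: (nd p j) => //; left|apply: (nd p j) => //; right].
    split; apply/negP => pL.
      have : p %| L1 j by [].
      rewrite /L1 /b0 -addnA dvdn_addl; last first.
        by rewrite dvdn_add // dvdn_mulr // dvdn_mull.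
      by rewrite dvdn1 => /eqP e1; rewrite e1 in pp.
    have : p %| 1 + lam ^ 2 * L2 j by rewrite -eL dvdn_mulr.
    by rewrite dvdn_addl ?dvdn_mull // dvdn1 => /eqP e1; rewrite e1 in pp.
  - by move=> j; split; rewrite -(modn_dvdm _ Ql) ?L1l ?L2l modn_dvdm.
exists (L1 j), (L2 j); split => // L hL.
have [f [f1 f2 f3]] := hj L hL; exists f; split => //; apply/allP => p pf.
have /andP[pp bp] := allP f2 p pf; rewrite pp bp andbT /=; apply/negP => pl.
have := nd p j L pp pl hL; rewrite f3 (big_rem p) //= dvdn_mulr //.
Qed.
End Good.

Local Open Scope ring_scope.

(** * Number fields and their primes *)

Local Notation pQtoC := (map_poly (ratr : rat -> algC)).

Section Subfield.
Variable K : cset.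
Hypothesis hK : is_subfield K.

Lemma sf0 : K 0. Proof. by have [] := hK. Qed.
Lemma sf1 : K 1. Proof. by have [_ []] := hK. Qed.
Lemma sfB x y : K x -> K y -> K (x - y). Proof. by have [_ [_ [h _]]] := hK; apply: h. Qed.
Lemma sfM x y : K x -> K y -> K (x * y). Proof. by have [_ [_ [_ [h _]]]] := hK; apply: h. Qed.
Lemma sfV x : K x -> K x^-1. Proof. by have [_ [_ [_ [_ h]]]] := hK; apply: h. Qed.
Lemma sfN x : K x -> K (- x). Proof. by rewrite -sub0r; apply: sfB; apply: sf0. Qed.
Lemma sfD x y : K x -> K y -> K (x + y).
Proof. by move=> hx hy; rewrite -[y]opprK; apply: sfB => //; apply: sfN. Qed.
Lemma sf_div x y : K x -> K y -> K (x / y).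
Proof. by move=> hx hy; apply: sfM => //; apply: sfV. Qed.
Lemma sfX x n : K x -> K (x ^+ n).
Proof. by move=> hx; elim: n => [|n IH]; [apply: sf1|rewrite exprS; apply: sfM]. Qed.
Lemma sf_sum (I : Type) (s : seq I) (F : I -> algC) : (forall i, K (F i)) ->
  K (\sum_(i <- s) F i).
Proof. by move=> h; apply: (big_ind K) => // [|x y]; [apply: sf0|apply: sfD]. Qed.
Lemma sf_nat n : K n%:R.
Proof. by elim: n => [|n IH]; [apply: sf0|rewrite -addn1 natrD; apply: sfD => //; apply: sf1]. Qed.
Lemma sf_int (n : int) : K n%:~R.
Proof. by case: n => n; rewrite ?NegzE ?mulrNz -pmulrn; try apply: sfN; apply: sf_nat. Qed.
Lemma sf_rat (a : rat) : K (ratr a).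
Proof. by rewrite /ratr; apply: sf_div; apply: sf_int. Qed.
Lemma sf_poly (p : {poly rat}) x : K x -> K (pQtoC p).[x].
Proof.
move=> hx; rewrite horner_coef; apply: sf_sum => i; rewrite coef_map.
by apply: sfM; [apply: sf_rat|apply: sfX].
Qed.

Lemma roi0 : ring_of_integers K 0. Proof. by split; [apply: sf0|apply: rpred0]. Qed.
Lemma roi1 : ring_of_integers K 1. Proof. by split; [apply: sf1|apply: rpred1]. Qed.
Lemma roiB x y : ring_of_integers K x -> ring_of_integers K y -> ring_of_integers K (x - y).
Proof. by move=> [h1 h2] [h3 h4]; split; [apply: sfB|apply: rpredB]. Qed.
Lemma roiM x y : ring_of_integers K x -> ring_of_integers K y -> ring_of_integers K (x * y).
Proof. by move=> [h1 h2] [h3 h4]; split; [apply: sfM|apply: rpredM]. Qed.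
Lemma roi_int (n : int) : ring_of_integers K n%:~R.
Proof. by split; [apply: sf_int|rewrite Aint_Cint // intr_int]. Qed.
Lemma roiN x : ring_of_integers K x -> ring_of_integers K (- x).
Proof. by rewrite -sub0r; apply: roiB; apply: roi0. Qed.
Lemma roiD x y : ring_of_integers K x -> ring_of_integers K y -> ring_of_integers K (x + y).
Proof. by move=> hx hy; rewrite -[y]opprK; apply: roiB => //; apply: roiN. Qed.
Lemma roiX x n : ring_of_integers K x -> ring_of_integers K (x ^+ n).
Proof. by move=> hx; elim: n => [|n IH]; [apply: roi1|rewrite exprS; apply: roiM]. Qed.
Lemma roi_sum (I : Type) (s : seq I) (F : I -> algC) : (forall i, ring_of_integers K (F i)) ->
  ring_of_integers K (\sum_(i <- s) F i).
Proof. by move=> h; apply: (big_ind (ring_of_integers K)) => // [|x y]; [apply: roi0|apply: roiD]. Qed.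
End Subfield.

Lemma poly_MXaddC (m : {poly rat}) : exists g a, m = g * 'X + a%:P.
Proof.
elim/poly_ind: m => [|g a _]; last by exists g, a.
by exists 0, 0; rewrite mul0r addr0.
Qed.

Lemma adjoin_field th : is_subfield (fun x => exists p, x = (pQtoC p).[th]).
Proof.
split; first by exists 0; rewrite rmorph0 horner0.
split; first by exists 1; rewrite rmorph1 hornerC.
split; first by move=> _ _ [p ->] [q ->]; exists (p - q); rewrite rmorphB /= hornerD hornerN.
split; first by move=> _ _ [p ->] [q ->]; exists (p * q); rewrite rmorphM /= hornerM.
move=> _ [p ->]; set x := (pQtoC p).[th].
have [->|x0] := eqVneq x 0; first by exists 0; rewrite rmorph0 horner0 invr0.
have [m [em mm] dv] := minCpolyP x.
have mx : (pQtoC m).[x] = 0 by apply/eqP; rewrite -[_ == 0]/(root _ _) dv.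
have m0 : m != 0 by rewrite monic_neq0.
have xg : forall g a, m = g * 'X + a%:P -> a != 0 /\ (pQtoC g).[x] * x = - ratr a.
  move=> g a eg; have e : (pQtoC g).[x] * x = - ratr a.
    move: mx; rewrite eg rmorphD rmorphM /= map_polyX map_polyC hornerD hornerMX hornerC.
    by move/eqP; rewrite addr_eq0 => /eqP.
  split => //; apply/eqP => a0; move: e; rewrite a0 rmorph0 oppr0 => /eqP.
  rewrite mulf_eq0 (negbTE x0) orbF -[_ == 0]/(root _ _) dv => mg.
  have g0 : g != 0 by apply: contraNneq m0 => g0; rewrite eg g0 a0 mul0r addr0.
  have := dvdp_leq g0 mg; rewrite eg size_MXaddC (negbTE g0) /=.
  by rewrite ltnn.
have [g [a eg]] := poly_MXaddC m; have [a0 e] := xg g a eg.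
exists (- a^-1 *: g \Po p).
rewrite map_comp_poly horner_comp -/x map_polyZ hornerZ rmorphN fmorphV.
apply: (mulIf x0); rewrite mulVf // -mulrA e mulNr mulrN opprK mulVf //.
by rewrite fmorph_eq0.
Qed.

Lemma root_min_size th (m p : {poly rat}) : minCpoly th = pQtoC m ->
  (forall q : {poly rat}, root (pQtoC q) th = (m %| q)) -> root (pQtoC p) th ->
  (size p < size m)%N -> p = 0.
Proof.
move=> em dv; rewrite dv => mp lt; apply/eqP; apply: contraTT lt => p0.
by rewrite -leqNgt dvdp_leq.
Qed.

(* [y] divides the constant coefficient of its minimal polynomial. *)
Lemma Aint_dvd_nat y : y \in Aint -> y != 0 -> exists N w,
  [/\ (0 < N)%N, w \in Aint, (exists p : {poly rat}, w = (pQtoC p).[y]) & y * w = N%:R].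
Proof.
move=> yA y0; have [m [em mm] dv] := minCpolyP y.
have my : (pQtoC m).[y] = 0 by apply/eqP; rewrite -[_ == 0]/(root _ _) dv.
have cint i : (ratr m`_i : algC) \is a Num.int.
  have /polyOverP h : minCpoly y \is a polyOver (Num.int : {pred algC}) := yA.
  by have := h i; rewrite em coef_map.
have [g [a eg]] := poly_MXaddC m.
have ey : y * (pQtoC g).[y] = - ratr a.
  move: my; rewrite eg rmorphD rmorphM /= map_polyX map_polyC hornerD hornerMX hornerC.
  by rewrite mulrC => /eqP; rewrite addr_eq0 => /eqP.
have a0 : a != 0.
  apply/eqP => a0; move: ey; rewrite a0 rmorph0 oppr0 => /eqP.
  rewrite mulf_eq0 (negbTE y0) /= => gy.
  have g0 : g = 0.
    apply: (root_min_size em dv gy); rewrite eg size_MXaddC a0 eqxx andbT.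
    by case: eqP => // g0; rewrite g0 in eg; have := monic_neq0 mm; rewrite eg a0 mul0r addr0 eqxx.
  by have := monic_neq0 mm; rewrite eg g0 a0 mul0r addr0 eqxx.
have aint : (ratr a : algC) \is a Num.int by have := cint 0%N; rewrite eg coefD coefMX coefC /= add0r.
have gA : (pQtoC g).[y] \in Aint.
  rewrite horner_coef; apply: rpred_sum => i _; rewrite coef_map rpredM ?rpredX //.
  by apply: Aint_Cint; have := cint i.+1; rewrite eg coefD coefMX coefC /= addr0.
have [n en] := intrP aint.
exists `|n|%N, (- ((-1) ^+ (n < 0)%R * (pQtoC g).[y])); split.
- rewrite absz_gt0; apply: contraNneq a0 => n0; move: en; rewrite n0 => /eqP.
  by rewrite fmorph_eq0.
- by rewrite rpredN rpredM // rpredX // rpredN rpred1.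
- exists (- ((-1) ^+ (n < 0)%R *: g)).
  rewrite rmorphN /= map_polyZ hornerN hornerZ; congr (- (_ * _)).
  by rewrite rmorphXn /= rmorphN1.
rewrite mulrN mulrCA ey mulrN opprK en; case: n en => n _ /=.
  by rewrite expr0 mul1r.
by rewrite expr1 NegzE mulrNz mulN1r opprK.
Qed.

(** If g is the minimal polynomial of f(th), then m divides the composite of g and f, so f(t) is a
    root of g. *)
Lemma conjugate_Aint th t (m f : {poly rat}) :
  (forall q : {poly rat}, root (pQtoC q) th = (m %| q)) -> root (pQtoC m) t ->
  (pQtoC f).[th] \in Aint -> (pQtoC f).[t] \in Aint.
Proof.
move=> dv mt; set x := (pQtoC f).[th] => xA.
have [g [eg mg] dg] := minCpolyP x.
have gx : root (pQtoC g) x by rewrite dg dvdpp.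
have : m %| g \Po f.
  by rewrite -dv map_comp_poly /root horner_comp.
move=> /dvdpP[c ec]; have : root (pQtoC (g \Po f)) t.
  by rewrite ec rmorphM /= rootM mt orbT.
rewrite map_comp_poly /root horner_comp -[_ == 0]/(root _ _) -eg => h.
apply: (root_monic_Aint h); first by rewrite eg map_monic.
exact: xA.
Qed.

Lemma minpoly_roots th (m : {poly rat}) : minCpoly th = pQtoC m -> m \is monic ->
  (forall q : {poly rat}, root (pQtoC q) th = (m %| q)) ->
  exists rs : seq algC, [/\ uniq rs, size m = (size rs).+1 & all (root (pQtoC m)) rs].
Proof.
move=> em mm dv; have m0 := monic_neq0 mm.
have [rs ers] := closed_field_poly_normal (pQtoC m).
have lc : lead_coef (pQtoC m) = 1 by apply/eqP; rewrite -[_ == _]/(_ \is monic) map_monic.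
rewrite lc scale1r in ers; exists rs; split.
- rewrite -separable_prod_XsubC -ers separable_map.
  rewrite unlock /coprimep; apply/negPn/negP => g1.
  set g := gcdp m m^`() in g1.
  have /dvdpP[h eh] : g %| m by rewrite dvdp_gcdl.
  have mth : root (pQtoC m) th by rewrite dv dvdpp.
  have h0 : h != 0 by apply: contraNneq m0 => h0; rewrite eh h0 mul0r.
  have g0 : g != 0 by apply: contraNneq m0 => g0; rewrite eh g0 mulr0.
  move: mth; rewrite eh rmorphM /= rootM => /orP[] ; rewrite dv => hd.
    have := dvdp_leq h0 hd; rewrite eh size_mul //.
    have : (0 < size g)%N by rewrite size_poly_gt0.
    move: g1; case: (size g) => [|[|n]] // _ _; rewrite addnS /= addnS.
    by rewrite ltnNge leq_addr.
  have : m %| m^`() by apply: dvdp_trans hd _; rewrite dvdp_gcdr.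
  have d0 : m^`() != 0.
    have s1 : (1 < size m)%N.
      rewrite ltnNge; apply/negP => /size1_polyC e1; have /eqP e2 := mm.
      rewrite e1 lead_coefC in e2; move: hd; rewrite -dv => _.
      have : root (pQtoC m) th by rewrite dv dvdpp.
      by rewrite e1 e2 rmorph1 (negbTE (root1 _)).
    apply/eqP => /(congr1 (fun p : {poly rat} => p`_(size m).-2)).
    rewrite coef_deriv coef0 (_ : (size m).-2.+1 = (size m).-1); last by case: (size m) s1 => [|[]].
    have /eqP := mm; rewrite /lead_coef => -> /eqP; rewrite pnatr_eq0.
    by case: (size m) s1 => [|[]].
  move/(dvdp_leq d0); rewrite leqNgt; case/negP; exact: lt_size_deriv.
- by rewrite -(size_map_poly (ratr : rat -> algC)) ers size_prod_XsubC.
by apply/allP => x xr; rewrite ers root_prod_XsubC.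
Qed.

Lemma det_Aint n (A : 'M[algC]_n) : (forall i j, A i j \in Aint) -> \det A \in Aint.
Proof.
move=> h; apply: rpred_sum => s _; apply: rpredM; first by rewrite rpredX // rpredN rpred1.
by apply: rpred_prod.
Qed.

(** Cramer's rule for the Vandermonde matrix of the conjugates: det V times a coordinate of x is an
    algebraic integer. [D] is a natural multiple of det V, and a rational algebraic integer is an
    integer. *)
Lemma bounded_denominators th : th \in Aint -> exists D d, (0 < D)%N /\
  forall x, x \in Aint -> (exists p, x = (pQtoC p).[th]) ->
  exists c : 'I_d -> int, D%:R * x = \sum_j (c j)%:~R * th ^+ j.
Proof.
move=> thA; have [m [em mm] dv] := minCpolyP th.
have [rs [urs srs ars]] := minpoly_roots em mm dv; set d := size rs in srs.
have rA (k : 'I_d) : rs`_k \in Aint.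
  have h : root (pQtoC m) rs`_k by apply: (allP ars); apply: mem_nth.
  have e : (pQtoC 'X).[th] = th by rewrite map_polyX hornerX.
  have := @conjugate_Aint th rs`_k m 'X dv h; rewrite e => /(_ thA).
  by rewrite map_polyX hornerX.
pose V : 'M[algC]_d := (Vandermonde d (\row_k rs`_k))^T.
have VE k j : V k j = rs`_k ^+ j by rewrite !mxE.
have V0 : \det V != 0.
  rewrite det_tr det_Vandermonde; apply/prodf_neq0 => i _; apply/prodf_neq0 => j ij.
  by rewrite !mxE subr_eq0 nth_uniq // neq_ltn ij orbT.
have VA : \det V \in Aint by apply: det_Aint => k j; rewrite VE rpredX.
have [N [w [N0 wA _ ew]]] := Aint_dvd_nat VA V0.
exists N, d; split => // x xA [p ep].
pose f := p %% m; have sf : (size f <= d)%N.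
  by rewrite -ltnS -srs ltn_modp monic_neq0.
have ex : x = (pQtoC f).[th].
  rewrite ep [in LHS](divp_eq p m) rmorphD rmorphM /= hornerD hornerM.
  have /eqP -> : root (pQtoC m) th by rewrite dv dvdpp.
  by rewrite mulr0 add0r.
have fE t : (pQtoC f).[t] = \sum_(j < d) ratr f`_j * t ^+ j.
  rewrite (@horner_coef_wide _ d); last by rewrite size_map_poly.
  by apply: eq_bigr => j _; rewrite coef_map.
have cint (j : 'I_d) : exists c : int, N%:R * ratr f`_j = c%:~R :> algC.
  suff h : (N%:R * ratr f`_j : algC) \in Aint.
    have hq : (N%:R * ratr f`_j : algC) \in Crat by rewrite rpredM ?Crat_rat // rpred_nat.
    by have /intrP := Cint_rat_Aint hq h.
  pose c : 'cV[algC]_d := \col_j ratr f`_j.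
  have Vc : V *m c = \col_k (pQtoC f).[rs`_k].
    apply/colP => k; rewrite !mxE fE; apply: eq_bigr => i _.
    by rewrite !mxE mulrC.
  have : \adj V *m (V *m c) = \det V *: c by rewrite mulmxA mul_adj_mx mul_scalar_mx.
  move/(congr1 (fun M : 'M__ => M j 0)); rewrite Vc !mxE => e.
  rewrite -ew mulrAC -e mulrC; apply: rpredM => //; apply: rpred_sum => k _.
  rewrite !mxE; apply: rpredM.
    rewrite /cofactor; apply: rpredM; first by rewrite rpredX // rpredN rpred1.
    by apply: det_Aint => a b; rewrite [_ a b]mxE [_ (lift _ a) b]mxE VE rpredX.
  apply: (conjugate_Aint dv); first by apply: (allP ars); apply: mem_nth.
  by rewrite -ex.
have [c hc] := fin_all_exists cint; exists c.
rewrite ex fE mulr_sumr; apply: eq_bigr => j _.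
by rewrite mulrA hc.
Qed.

Lemma finite_reps (T : finType) (A : cset) (f : algC -> T -> Prop) :
  (forall x, A x -> exists t, f x t) ->
  exists s : seq algC, (forall y, y \in s -> A y) /\
    forall x, A x -> exists y t, [/\ y \in s, f x t & f y t].
Proof.
move=> hf.
have h t : exists o : option algC, match o with
    Some y => A y /\ f y t | None => forall y, A y -> ~ f y t end.
  have [[y [Ay fy]]|no] := classic (exists y, A y /\ f y t); first by exists (Some y).
  by exists None => y Ay fy; apply: no; exists y.
have [g hg] := fin_all_exists h; exists (pmap g (enum T)); split.
  by move=> y; rewrite mem_pmap => /mapP[t _ e]; have := hg t; rewrite -e => -[].
move=> x Ax; have [t ft] := hf x Ax; have := hg t.
case e: (g t) => [y|] => [[Ay fy]|no]; last by case: (no x).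
by exists y, t; split => //; rewrite mem_pmap -e map_f // mem_enum.
Qed.

Lemma Aint_multiple z : exists2 N, (0 < N)%N & N%:R * z \in Aint.
Proof.
have [m [em mm] dv] := minCpolyP z; set n := (size m).-1.
have sm : size m = n.+1 by rewrite prednK // size_poly_gt0 monic_neq0.
pose N := (\prod_(i < n) `|denq m`_i|)%N.
have N0 : (0 < N)%N by rewrite prodn_gt0 // => i; rewrite absz_gt0 denq_neq0.
have Nm (i : 'I_n) : exists c : int, N%:R * m`_i = c%:~R.
  exists ((\prod_(j < n | j != i) `|denq m`_j|)%N%:Z * numq m`_i).
  rewrite rmorphM /= numqE /N (bigD1 i) //= natrM -pmulrn -[in RHS]absz_denq -pmulrn.
  by ring.
have mn : m`_n = 1 by have /eqP := mm; rewrite /lead_coef sm.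
exists N => //.
pose g := \poly_(i < n.+1) (N%:R ^+ (n - i) * m`_i).
have gn : g`_n = 1 by rewrite coef_poly ltnSn subnn expr0 mul1r.
have sg : size g = n.+1 by apply: size_poly_eq; rewrite subnn expr0 mul1r mn oner_neq0.
have zm : \sum_(i < n.+1) ratr m`_i * z ^+ i = 0 :> algC.
  have /eqP e : root (pQtoC m) z by rewrite dv dvdpp.
  rewrite -[RHS]e (@horner_coef_wide _ n.+1) ?size_map_poly ?sm //.
  by apply: eq_bigr => i _; rewrite coef_map.
apply: (@root_monic_Aint (pQtoC g)).
- rewrite /root (@horner_coef_wide _ n.+1) ?size_map_poly ?sg //.
  have e2 := congr1 ( *%R (N%:R ^+ n)) zm; rewrite mulr0 mulr_sumr in e2.
  rewrite -[X in _ == X]e2; apply/eqP.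
  apply: eq_bigr => i _; rewrite coef_map coef_poly ltn_ord /= rmorphM rmorphXn rmorph_nat exprMn.
  have -> : N%:R ^+ n = N%:R ^+ (n - i) * N%:R ^+ i :> algC.
    by rewrite -exprD subnK // -ltnS.
  by rewrite /=; ring.
- by rewrite map_monic monicE lead_coefE sg gn.
apply/polyOverP => i; rewrite coef_map coef_poly; case: ltnP => [|_]; last by rewrite /= ?rmorph0 ?raddf0 rpred0.
rewrite ltnS leq_eqVlt => /orP[/eqP ->|lt].
  by rewrite subnn expr0 mul1r mn /= rmorph1 rpred1.
have [c ec] := Nm (Ordinal lt); rewrite /= in ec.
rewrite -(prednK (_ : 0 < n - i)%N) ?subn_gt0 // exprSr -mulrA ec.
by rewrite /= rmorphM rmorphXn /= rmorph_nat ratr_int rpredM ?rpredX ?rpred_nat // intr_int.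
Qed.

Section NF.
Variable K : cset.
Hypothesis nfK : is_number_field K.
Let hK : is_subfield K := proj1 nfK.
Local Notation O := (ring_of_integers K).

Lemma nf_primitive : exists th, [/\ O th & forall x, K x -> exists p, x = (pQtoC p).[th]].
Proof.
have [_ [s [sK spanK]]] := nfK.
have [z [a ez] [ps eps]] := algC_PET s.
have [N N0 NA] := Aint_multiple z.
have Kz : K z.
  rewrite ez; apply: (big_ind K) => [|x y|i _]; [exact: sf0|exact: sfD|].
  rewrite -mulr_natl; apply: sfM => //; first exact: sf_nat.
  by apply: sK; apply: mem_nth.
have zN : z = (pQtoC ((N%:R)^-1 *: 'X)).[N%:R * z].
  rewrite map_polyZ map_polyX hornerZ hornerX fmorphV rmorph_nat mulKf //.
  by rewrite pnatr_eq0 -lt0n.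
exists (N%:R * z); split; first by split => //; apply: sfM => //; apply: sf_nat.
move=> x /spanK [r [sr [rC ->]]].
suff [p ->] : exists p, \sum_(i < size s) r`_i * s`_i = (pQtoC p).[z].
  exists (p \Po ((N%:R)^-1 *: 'X)); by rewrite map_comp_poly horner_comp -zN.
apply: (big_ind (fun x => exists p, x = (pQtoC p).[z])).
- by exists 0; rewrite rmorph0 horner0.
- by move=> _ _ [p ->] [p' ->]; exists (p + p'); rewrite rmorphD hornerD.
move=> i _; have /CratP[b ->] : r`_i \in Crat by apply: rC; apply: mem_nth; rewrite sr.
have := mem_nth 0 (ltn_ord i); move: s`_i => y; rewrite eps => /mapP[p _ ->].
by exists (b *: p); rewrite map_polyZ hornerZ.
Qed.

Definition Zcomb (om : seq algC) (c : nat -> int) := \sum_(i < size om) (c i)%:~R * om`_i.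

(** Generators, not a basis: the powers of a primitive integer together with one representative for
    each class of coordinates of D x modulo D that occurs. *)
Lemma O_fg : exists om : seq algC, (forall y, y \in om -> O y) /\
  forall x, O x -> exists c, x = Zcomb om c.
Proof.
have [th [[Kth thA] gen]] := nf_primitive.
have [D [d [D0 hD]]] := bounded_denominators thA.
pose f (x : algC) (t : {ffun 'I_d -> 'I_D}) :=
  exists c : 'I_d -> int, D%:R * x = \sum_j ((t j : nat)%:Z + D%:Z * c j)%:~R * th ^+ j.
have hf x : O x -> exists t, f x t.
  move=> [Kx xA]; have [c ec] := hD x xA (gen x Kx).
  have lt j : (`|c j %% D|%Z < D)%N.
    have := ltz_pmod (c j) (ltac:(by rewrite ltz_nat) : 0 < D%:Z).
    have := modz_ge0 (c j) (ltac:(by rewrite eqz_nat -lt0n) : D%:Z != 0).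
    lia.
  exists [ffun j => Ordinal (lt j)], (fun j => (c j %/ D)%Z).
  rewrite ec; apply: eq_bigr => j _; rewrite ffunE /=; congr (_%:~R * _).
  rewrite gez0_abs ?modz_ge0 ?eqz_nat -?lt0n // [LHS](divz_eq (c j) D); ring.
have [s [sO hs]] := finite_reps hf.
exists ([seq th ^+ (j : nat) | j <- iota 0 d] ++ s); split.
  move=> y; rewrite mem_cat => /orP[/mapP[j _ ->]|/sO //].
  by apply: roiX => //; split.
move=> x /hs [y [t [ys [c ec] [c' ec']]]].
have e : x = y + \sum_(j < d) (c j - c' j)%:~R * th ^+ j.
  have Dn : D%:R != 0 :> algC by rewrite pnatr_eq0 -lt0n.
  apply: (mulfI Dn); rewrite mulrDr ec ec' mulr_sumr -big_split /=.
  by apply: eq_bigr => j _; rewrite !rmorphD !rmorphM rmorphN /= -pmulrn; ring.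
pose cc (i : nat) : int := if insub i is Some j then c j - c' j else (i == d + index y s)%N%:Z.
exists cc; rewrite /Zcomb size_cat size_map size_iota big_split_ord /= e [LHS]addrC; congr (_ + _).
  apply: eq_bigr => j _; rewrite /cc valK nth_cat size_map size_iota ltn_ord.
  by rewrite (nth_map 0%N) ?size_iota // nth_iota.
rewrite (bigD1 (Ordinal (ltac:(by rewrite index_mem) : index y s < size s)%N)) //= big1 ?addr0.
  rewrite /cc insubF ?ltnNge ?leq_addr // eqxx mul1r nth_cat size_map size_iota.
  by rewrite ltnNge leq_addr /= addKn nth_index.
move=> i ni; rewrite /cc insubF ?ltnNge ?leq_addr // eqn_add2l.
rewrite (_ : (i == index y s :> nat) = false) ?mul0r //.
by apply: contraNF ni => /eqP h; apply/eqP/val_inj.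
Qed.

Lemma reps_mod (A : cset) N : (0 < N)%N -> csubset A O ->
  exists s : seq algC, (forall y, y \in s -> A y) /\
    forall x, A x -> exists y z, [/\ y \in s, O z & x = y + N%:R * z].
Proof.
move=> N0 AO; have [om [omO hom]] := O_fg.
pose f (x : algC) (t : {ffun 'I_(size om) -> 'I_N}) :=
  exists c : 'I_(size om) -> int, x = \sum_j ((t j : nat)%:Z + N%:Z * c j)%:~R * om`_j.
have hf x : A x -> exists t, f x t.
  move=> /AO /hom [c ->].
  have lt j : (`|c j %% N|%Z < N)%N.
    have := ltz_pmod (c j) (ltac:(by rewrite ltz_nat) : 0 < N%:Z).
    have := modz_ge0 (c j) (ltac:(by rewrite eqz_nat -lt0n) : N%:Z != 0).
    lia.
  exists [ffun j : 'I_(size om) => Ordinal (lt j)], (fun j => (c j %/ N)%Z).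
  apply: eq_bigr => j _; rewrite ffunE /=; congr (_%:~R * _).
  rewrite gez0_abs ?modz_ge0 ?eqz_nat -?lt0n // [LHS](divz_eq (c j) N); ring.
have [s [sA hs]] := finite_reps hf; exists s; split => // x /hs [y [t [ys [c ec] [c' ec']]]].
exists y, (\sum_(j < size om) (c j - c' j)%:~R * om`_j); split => //.
  apply: roi_sum => // j; apply: roiM => //; first exact: roi_int.
  by apply: omO; apply: mem_nth.
rewrite ec ec' mulr_sumr -big_split /=.
by apply: eq_bigr => j _; rewrite !rmorphD !rmorphM rmorphN /= -pmulrn; ring.
Qed.
End NF.

(** * Localization at a prime ideal and its uniformizer *)

Definition dec (A : Prop) : bool := if excluded_middle_informative A then true else false.

Lemma decP (A : Prop) : reflect A (dec A).
Proof. by rewrite /dec; case: excluded_middle_informative => h; constructor. Qed.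

Lemma sub_count_lt (T : eqType) (a b : pred T) s r :
  (forall x, a x -> b x) -> r \in s -> b r -> ~~ a r -> (count a s < count b s)%N.
Proof.
move=> ab + br ar; elim: s => //= x s IH; rewrite inE => /orP[/eqP <-|/IH lt].
  by rewrite br (negbTE ar) add0n ltnS; apply: sub_count.
by rewrite -addnS leq_add //; case ax: (a x) => //; rewrite (ab _ ax).
Qed.

Definition Zspan s x := exists c, x = Zcomb s c.

Lemma Zspan_mem s y : y \in s -> Zspan s y.
Proof.
move=> ys; exists (fun i => (i == index y s)%N%:Z); rewrite /Zcomb.
have lt : (index y s < size s)%N by rewrite index_mem.
rewrite (bigD1 (Ordinal lt)) //= big1 ?addr0; first by rewrite eqxx mul1r nth_index.
move=> i ni; rewrite (_ : (i == index y s :> nat) = false) ?mul0r //.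
by apply: contraNF ni => /eqP h; apply/eqP/val_inj.
Qed.

Lemma Zspan0 s : Zspan s 0.
Proof. by exists (fun=> 0); rewrite /Zcomb big1 // => i _; rewrite mul0r. Qed.

Lemma ZspanD s x y : Zspan s x -> Zspan s y -> Zspan s (x + y).
Proof.
move=> [c ->] [c' ->]; exists (fun i => c i + c' i); rewrite /Zcomb -big_split /=.
by apply: eq_bigr => i _; rewrite rmorphD mulrDl.
Qed.

Lemma ZspanZ s (n : int) x : Zspan s x -> Zspan s (n%:~R * x).
Proof.
move=> [c ->]; exists (fun i => n * c i); rewrite /Zcomb mulr_sumr.
by apply: eq_bigr => i _; rewrite rmorphM mulrA.
Qed.

(** The determinant trick: y is an eigenvalue of an integer matrix, with the row of the [ps] as
    eigenvector. *)
Lemma fg_Aint y ps : (exists2 p, p \in ps & p != 0) ->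
  (forall p, p \in ps -> Zspan ps (y * p)) -> y \in Aint.
Proof.
move=> [p0 p0s p00] h; set n := size ps.
have h' (i : 'I_n) : exists c : {ffun 'I_n -> int}, y * ps`_i = \sum_j (c j)%:~R * ps`_j.
  have [c ->] := h _ (mem_nth 0 (ltn_ord i)); exists [ffun j : 'I_n => c j].
  by apply: eq_bigr => j _; rewrite ffunE.
have [C hC] := fin_all_exists h'.
pose A : 'M[int]_n := \matrix_(i, j) C j i.
pose w : 'rV[algC]_n := \row_i ps`_i.
have ev : eigenvalue (map_mx intr A) y.
  apply/eigenvalueP; exists w.
    apply/rowP => i; rewrite !mxE hC; apply: eq_bigr => j _.
    by rewrite !mxE mulrC.
  apply/negP => /eqP w0; case/negP: p00; apply/eqP.
  have lt : (index p0 ps < n)%N by rewrite index_mem.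
  have := congr1 (fun M : 'rV_n => M 0 (Ordinal lt)) w0.
  by rewrite !mxE /= nth_index.
have := eigenvalue_root_char (map_mx intr A : 'M[algC]_n) y; rewrite ev => /esym.
rewrite -map_char_poly => hr.
apply: (root_monic_Aint hr); first by rewrite monic_map ?char_poly_monic.
by apply/polyOverP => i; rewrite coef_map /= intr_int.
Qed.

Section AtP.
Variables (K P : cset).
Hypothesis nfK : is_number_field K.
Hypothesis pP : is_prime_of K P.
Let hK : is_subfield K := proj1 nfK.
Local Notation O := (ring_of_integers K).

Lemma P_O x : P x -> O x. Proof. by have [h _] := pP; apply: h. Qed.
Lemma P_0 : P 0. Proof. by have [_ [h _]] := pP. Qed.
Lemma P_D x y : P x -> P y -> P (x + y). Proof. by have [_ [_ [h _]]] := pP; apply: h. Qed.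
Lemma P_M a x : O a -> P x -> P (a * x). Proof. by have [_ [_ [_ [h _]]]] := pP; apply: h. Qed.
Lemma P_1 : ~ P 1. Proof. by have [_ [_ [_ [_ [h _]]]]] := pP. Qed.
Lemma P_prime a b : O a -> O b -> P (a * b) -> P a \/ P b.
Proof. by have [_ [_ [_ [_ [_ [h _]]]]]] := pP; apply: h. Qed.
Lemma P_Mr a x : O a -> P x -> P (x * a). Proof. by rewrite mulrC; apply: P_M. Qed.
Lemma P_N x : P x -> P (- x).
Proof. by move=> h; rewrite -mulN1r; apply: P_M => //; apply: roiN => //; apply: roi1. Qed.
Lemma P_B x y : P x -> P y -> P (x - y). Proof. by move=> hx hy; apply: P_D => //; apply: P_N. Qed.
Lemma nP_M a b : O a -> O b -> ~ P a -> ~ P b -> ~ P (a * b).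
Proof. by move=> ha hb na nb /(P_prime ha hb) []. Qed.
Lemma nP_X a n : O a -> ~ P a -> ~ P (a ^+ n).
Proof.
move=> ha na; elim: n => [|n IH]; first exact: P_1.
by rewrite exprS; apply: nP_M => //; apply: roiX.
Qed.
Lemma nP_neq0 a : ~ P a -> a != 0.
Proof. by move=> h; apply/eqP => a0; apply: h; rewrite a0; apply: P_0. Qed.

Lemma P_has_prime : exists2 l, prime l & P l%:R.
Proof.
have [x [Px /eqP x0]] : exists x, P x /\ x <> 0 by have [_ [_ [_ [_ [_ [_ h]]]]]] := pP.
have [Kx xA] := P_O Px.
have [N [w [N0 wA [p ew] e]]] := Aint_dvd_nat xA x0.
have PN : P N%:R.
  rewrite -e; apply: P_Mr => //; split => //; rewrite ew; exact: sf_poly.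
have: forall n, (0 < n)%N -> P n%:R -> exists2 l, prime l & P l%:R.
  elim/ltn_ind => n IH n0 Pn; have [n1|n1] := leqP n 1.
    by case: P_1; have -> : 1 = n%:R :> algC by have -> : n = 1%N by lia.
  have pp := pdiv_prime n1; have /dvdnP[c ec] := pdiv_dvd n.
  have [|Pc|Pl] := @P_prime c%:R (pdiv n)%:R (roi_int hK c) (roi_int hK (pdiv n)).
  - by rewrite -natrM -ec.
  - apply: (IH c) => //; last by move: n0; rewrite ec muln_gt0 => /andP[].
    by rewrite [X in (_ < X)%N]ec ltn_Pmulr ?prime_gt1 //; move: n0; rewrite ec muln_gt0 => /andP[].
  by exists (pdiv n).
by move/(_ N N0 PN).
Qed.

Definition Rloc x := exists a b, [/\ O a, O b, ~ P b & x = a / b].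
Definition mloc x := exists a b, [/\ P a, O b, ~ P b & x = a / b].

Lemma Rloc_O x : O x -> Rloc x.
Proof. by move=> h; exists x, 1; rewrite divr1; split => //; [apply: roi1|apply: P_1]. Qed.
Lemma mloc_P x : P x -> mloc x.
Proof. by move=> h; exists x, 1; rewrite divr1; split => //; [apply: roi1|apply: P_1]. Qed.
Lemma mloc_R x : mloc x -> Rloc x.
Proof. by move=> [a [b [ha hb nb ->]]]; exists a, b; split => //; apply: P_O. Qed.

Lemma RlocB x y : Rloc x -> Rloc y -> Rloc (x - y).
Proof.
move=> [a [b [ha hb nb ->]]] [c [d [hc hd nd ->]]].
exists (a * d - c * b), (b * d); split.
- by apply: roiB => //; apply: roiM.
- exact: roiM.
- exact: nP_M.
by field; rewrite !nP_neq0.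
Qed.
Lemma RlocM x y : Rloc x -> Rloc y -> Rloc (x * y).
Proof.
move=> [a [b [ha hb nb ->]]] [c [d [hc hd nd ->]]].
exists (a * c), (b * d); split; [exact: roiM|exact: roiM|exact: nP_M|].
by field; rewrite !nP_neq0.
Qed.
Lemma mlocM x y : Rloc x -> mloc y -> mloc (x * y).
Proof.
move=> [a [b [ha hb nb ->]]] [c [d [hc hd nd ->]]].
exists (a * c), (b * d); split; [exact: P_M|exact: roiM|exact: nP_M|].
by field; rewrite !nP_neq0.
Qed.
Lemma mlocB x y : mloc x -> mloc y -> mloc (x - y).
Proof.
move=> [a [b [ha hb nb ->]]] [c [d [hc hd nd ->]]].
exists (a * d - c * b), (b * d); split; [|exact: roiM|exact: nP_M|].
  by apply: P_B; apply: P_Mr.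
by field; rewrite !nP_neq0.
Qed.
Lemma mloc_O x : O x -> mloc x -> P x.
Proof.
move=> hx [a [b [ha hb nb e]]].
have : P (x * b) by rewrite e divfK ?nP_neq0.
by case/(P_prime hx hb).
Qed.
Lemma mloc_1 : ~ mloc 1.
Proof. by move/(mloc_O (roi1 hK)); apply: P_1. Qed.
Lemma RlocV x : Rloc x -> ~ mloc x -> Rloc x^-1.
Proof.
move=> [a [b [ha hb nb ->]]] h; exists b, a; split => //; last by rewrite invf_div.
by move=> Pa; apply: h; exists a, b.
Qed.

(** Two of the powers of x up to the number of classes modulo N agree. The uniformity of [n0] in x
    is used later to bound the order of l at all primes above pZ at once. *)
Lemma pigeonhole_powers N : (0 < N)%N -> exists n0, forall x, O x ->
  exists i e z, [/\ (i <= n0)%N, (0 < e)%N, O z & x ^+ i * (1 - x ^+ e) = N%:R * z].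
Proof.
move=> N0; have [s [sO hs]] := reps_mod nfK N0 (fun x (h : O x) => h).
exists (size s) => x hx.
have h (i : 'I_(size s).+1) : exists k : 'I_(size s), exists2 z, O z & x ^+ i = s`_k + N%:R * z.
  have [y [z [ys hz e]]] := hs _ (roiX hK i hx).
  have lt : (index y s < size s)%N by rewrite index_mem.
  by exists (Ordinal lt), z; rewrite //= nth_index.
have [g hg] := fin_all_exists h.
have /injectivePn[i [j ij gij]] : ~~ injectiveb g.
  apply/negP => /injectiveP /leq_card; rewrite !card_ord ltnn //.
wlog ltij : i j ij gij / (i < j)%N.
  move=> W; case: (ltngtP i j) => [lt|lt|e]; first exact: (W i j).
    by apply: (W j i) => //; rewrite eq_sym.
  by case/eqP: ij; apply: val_inj.
have [z hz ez] := hg i; have [z' hz' ez'] := hg j.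
exists i, (j - i)%N, (z - z'); split; [by rewrite -ltnS|by rewrite subn_gt0|exact: roiB|].
rewrite mulrBr mulr1 -exprD subnKC ?(ltnW ltij) // ez ez' gij; ring.
Qed.

Variable l : nat.
Hypotheses (pl : prime l) (Pl : P l%:R).

Lemma inv_modP x : O x -> ~ P x -> exists2 y, O y & P (x * y - 1).
Proof.
move=> hx nx; have [n0 h] := pigeonhole_powers (prime_gt0 pl).
have [i [e [z [_ e0 hz ez]]]] := h x hx.
have hxe : O (1 - x ^+ e) by apply: roiB => //; [apply: roi1|apply: roiX].
have : P (x ^+ i * (1 - x ^+ e)) by rewrite ez; apply: P_Mr.
case/(P_prime (roiX hK i hx) hxe) => [h1|h1]; first by case: (nP_X hx nx h1).
exists (x ^+ e.-1); first exact: roiX.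
by rewrite -exprS prednK // -opprB; apply: P_N.
Qed.

Lemma P_fg : exists ps, (forall y, y \in ps -> P y) /\ forall x, P x -> Zspan ps x.
Proof.
have [s [sP hs]] := reps_mod nfK (prime_gt0 pl) P_O.
have [om [omO hom]] := O_fg nfK.
exists (s ++ [seq l%:R * w | w <- om]); split.
  move=> y; rewrite mem_cat => /orP[/sP //|/mapP[w /omO hw ->]]; exact: P_Mr.
move=> x /hs [y [z [ys hz ->]]]; apply: ZspanD.
  by apply: Zspan_mem; rewrite mem_cat ys.
have [c ->] := hom z hz; rewrite /Zcomb mulr_sumr.
apply: (big_ind (Zspan _)) => [|a b|i _]; [exact: Zspan0|exact: ZspanD|].
rewrite mulrCA; apply: ZspanZ; apply: Zspan_mem; rewrite mem_cat; apply/orP; right.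
by apply: map_f; apply: mem_nth.
Qed.

(** For b in O: b/l does not lie in [Rloc], that is, b is nonzero in the local ring modulo l. *)
Definition alive b := O b /\ forall t z, O t -> ~ P t -> O z -> t * b <> l%:R * z.

(* An alive element generating a minimal ideal of the finite ring [R / l R] is
   annihilated by the maximal ideal. *)
Lemma socle : exists2 b, alive b & forall x, P x -> ~ alive (x * b).
Proof.
have [s [sO hs]] := reps_mod nfK (prime_gt0 pl) (fun x (h : O x) => h).
(* [S b r] says that r lies locally in the ideal generated by b and l; [cnt b] measures this ideal
   by the representatives modulo l that it contains. *)
pose S b r := exists t c z, [/\ O t, ~ P t, O c, O z & t * r = c * b + l%:R * z].
pose cnt b := count (fun r => dec (S b r)) s.
have ex : exists n, dec (exists2 b, alive b & cnt b = n).
  exists (cnt 1); apply/decP; exists 1 => //; split; first exact: roi1.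
  by move=> t z ht nt hz; rewrite mulr1 => e; apply: nt; rewrite e; apply: P_Mr.
case: (ex_minnP ex) => n /decP[b [hb ab] cb] min; exists b => // x Px [hxb axb].
have hx := P_O Px.
have sub r : S (x * b) r -> S b r.
  move=> [t [c [z [ht nt hc hz e]]]]; exists t, (c * x), z; split => //; first exact: roiM.
  by rewrite e mulrA.
have le : (cnt b <= cnt (x * b)%R)%N by rewrite cb min //; apply/decP; exists (x * b).
have eqS r : r \in s -> S b r -> S (x * b) r.
  move=> rs /decP h1; apply/decP; apply/negPn/negP => h2.
  have : (cnt (x * b)%R < cnt b)%N.
    by apply: (sub_count_lt _ rs) => // y /decP h; apply/decP; apply: sub.
  by rewrite ltnNge le.
have [r [z [rs hz eb]]] := hs b hb.
have [|t [c [z' [ht nt hc hz' e]]]] := eqS r rs _.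
  exists 1, 1, (- z); split; [exact: roi1|exact: P_1|exact: roi1|exact: roiN|].
  by rewrite eb; ring.
apply: (ab (t - c * x) (z' + t * z)); first by apply: roiB => //; apply: roiM.
- move=> h; apply: nt; rewrite -(subrK (c * x) t); apply: P_D => //; exact: P_M.
- by apply: roiD => //; apply: roiM.
have e2 : t * b = c * (x * b) + l%:R * (z' + t * z) by rewrite {1}eb mulrDr e; ring.
by rewrite mulrBl e2; ring.
Qed.

Lemma l_neq0 : l%:R != 0 :> algC.
Proof. by rewrite pnatr_eq0 -lt0n prime_gt0. Qed.

(** g = b/l with b from [socle]: the element showing that the inverse of P is locally larger than
    the ring. *)
Lemma inverse_ideal : exists g, [/\ K g, ~ Rloc g & forall x, P x -> Rloc (g * x)].
Proof.
have [b [hb ab] nb] := socle; exists (b / l%:R); split.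
- by apply: sf_div => //; [case: hb|apply: sf_nat].
- move=> [a [c [ha hc nc e]]]; apply: (ab c a) => //.
  have -> : b = l%:R * a / c by rewrite -mulrA -e mulrC divfK ?l_neq0.
  by rewrite mulrC divfK ?nP_neq0.
move=> x Px; have hxb : O (x * b) by apply: roiM => //; apply: P_O.
have : ~ alive (x * b) by apply: nb.
move=> /not_and_or[//|/not_all_ex_not[t /not_all_ex_not[z h]]].
have [ht {}h] := imply_to_and _ _ h; have [nt {}h] := imply_to_and _ _ h.
have [hz /NNPP e] := imply_to_and _ _ h.
exists z, t; split => //; apply: (mulIf (nP_neq0 nt)).
rewrite divfK ?nP_neq0 //; apply: (mulfI l_neq0); rewrite -e.
by rewrite mulrC; field; rewrite l_neq0.
Qed.

(** If g pi were never a unit for pi in P, then g P would lie in the maximal ideal. As P is finitely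
    generated, some T outside P would give T g P inside P, so T g would be integral and g in [Rloc].
    Once g pi is a unit, a/pi = (g a)/(g pi). *)
Lemma uniformizer : exists2 pi, P pi & [/\ pi != 0, ~ Rloc pi^-1 &
  forall x, mloc x -> Rloc (x / pi)].
Proof.
have [g [Kg nRg gR]] := inverse_ideal.
have [pi Ppi hpi] : exists2 pi, P pi & ~ mloc (g * pi).
  apply: NNPP => no; have hm x : P x -> mloc (g * x).
    by move=> Px; apply: NNPP => h; apply: no; exists x.
  have [ps [psP hps]] := P_fg.
  have [T [hT nT TP]] : exists T, [/\ O T, ~ P T & forall p, p \in ps -> P (T * g * p)].
    elim: (ps) psP => [|p s IH] sP.
      by exists 1; split => //; [apply: roi1|apply: P_1].
    have [|T [hT nT TP]] := IH; first by move=> y ys; apply: sP; rewrite inE ys orbT.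
    have Pp : P p by apply: sP; rewrite mem_head.
    have [a [c [ha hc nc e]]] := hm p Pp.
    exists (T * c); split; [exact: roiM|exact: nP_M|] => y; rewrite inE => /orP[/eqP ->|ys].
      have -> : T * c * g * p = T * a by rewrite -!mulrA e; field; rewrite nP_neq0.
      exact: P_M.
    have -> : T * c * g * y = c * (T * g * y) by ring.
    by apply: P_M => //; apply: TP.
  have TgA : T * g \in Aint.
    apply: (@fg_Aint _ ps); last by move=> p /TP /hps.
    have [c ec] := hps _ Pl; apply: NNPP => no0.
    have := l_neq0; rewrite ec /Zcomb big1 ?eqxx // => i _.
    have [->|h] := eqVneq ps`_i 0; first by rewrite mulr0.
    by case: no0; exists ps`_i => //; apply: mem_nth.
  apply: nRg; exists (T * g), T; split => //; last by rewrite mulrAC divff ?mul1r ?nP_neq0.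
  by split => //; apply: sfM => //; case: hT.
exists pi => //.
have pi0 : pi != 0 by apply: contra_notN hpi => /eqP ->; rewrite mulr0; apply: mloc_P; apply: P_0.
have Ru := RlocV (gR _ Ppi) hpi.
have gu : g * pi != 0.
  by apply: contra_notN hpi => /eqP ->; apply: mloc_P; apply: P_0.
split => //.
  move=> h; apply: mloc_1; rewrite -(mulVf pi0); apply: mlocM => //; exact: mloc_P.
move=> _ [a [b [ha hb nb ->]]].
have -> : a / b / pi = (g * a) * (g * pi)^-1 * b^-1.
  move: gu; rewrite mulf_eq0 negb_or => /andP[g0 _]; field.
  by rewrite g0 pi0 nP_neq0.
apply: RlocM; first by apply: RlocM => //; apply: gR.
by exists 1, b; rewrite div1r; split => //; apply: roi1.
Qed.
End AtP.

(** * Orders at a prime ideal *)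

Section Ord.
Variables (K P : cset) (l : nat) (pi : algC).
Hypothesis nfK : is_number_field K.
Hypothesis pP : is_prime_of K P.
Hypotheses (pl : prime l) (Pl : P l%:R).
Hypotheses (Ppi : P pi) (pi0 : pi != 0) (npiV : ~ Rloc K P pi^-1).
Hypothesis mdiv : forall x, mloc K P x -> Rloc K P (x / pi).
Let hK : is_subfield K := proj1 nfK.
Local Notation O := (ring_of_integers K).
Local Notation R := (Rloc K P).
Local Notation m := (mloc K P).

Let R1 : R 1. Proof. by apply: Rloc_O => //; apply: roi1. Qed.
Let R0 : R 0. Proof. by apply: Rloc_O => //; apply: roi0. Qed.
Let RN x : R x -> R (- x). Proof. by move=> h; rewrite -sub0r; apply: RlocB. Qed.
Let RD x y : R x -> R y -> R (x + y).
Proof. by move=> hx hy; rewrite -[y]opprK; apply: RlocB => //; apply: RN. Qed.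
Let RX x n : R x -> R (x ^+ n).
Proof. by move=> h; elim: n => [|n IH]; rewrite ?expr0 // exprS; apply: RlocM. Qed.
Let Rpi : R pi. Proof. by apply: Rloc_O => //; apply: (P_O pP). Qed.
Let mpi : m pi. Proof. exact: mloc_P. Qed.

Definition unitP u := R u /\ ~ m u.

Lemma unit_neq0 u : unitP u -> u != 0.
Proof. by move=> [_ h]; apply/eqP => u0; apply: h; rewrite u0; apply: mloc_P => //; apply: (P_0 pP). Qed.

Lemma unitV u : unitP u -> unitP u^-1.
Proof.
move=> hu; have u0 := unit_neq0 hu; have [h1 h2] := hu; have h := RlocV h1 h2; split => // h3.
by apply: (mloc_1 nfK pP); rewrite -(divff u0); apply: mlocM.
Qed.

Lemma unitM u v : unitP u -> unitP v -> unitP (u * v).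
Proof.
move=> hu hv; have [h1 h2] := hu; have [h3 h4] := hv; split; first exact: RlocM.
move=> h; apply: h4; rewrite -(mulKf (unit_neq0 hu) v); apply: mlocM => //.
by have [] := unitV hu.
Qed.

Lemma unit1 : unitP 1.
Proof. by split => //; apply: (mloc_1 nfK pP). Qed.

Lemma unit_O x : O x -> ~ P x -> unitP x.
Proof. by move=> hx nx; split; [apply: Rloc_O|move/(mloc_O pP hx)]. Qed.

Lemma unit_addm u x : unitP u -> m x -> unitP (u + x).
Proof.
move=> [h1 h2] hx; split; first by apply: RD => //; apply: mloc_R hx.
by move=> h; apply: h2; rewrite -(addrK x u); apply: mlocB.
Qed.

Lemma piX_m n : (0 < n)%N -> m (pi ^+ n).
Proof. by case: n => // n _; rewrite exprSr; apply: mlocM => //; apply: RX. Qed.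

(** The pigeonhole relation for pi reads pi^i (1 - pi^e) = N z with 1 - pi^e a unit; if pi^(i+1)
    divided N locally, 1/pi would lie in [Rloc]. *)
Lemma nat_bounded N : (0 < N)%N -> exists k, ~ R (N%:R / pi ^+ k).
Proof.
move=> N0; have [n0 h] := pigeonhole_powers nfK N0.
have [i [e [z [_ e0 hz ez]]]] := h pi (P_O pP Ppi).
exists i.+1 => hR; apply: npiV.
have u : unitP (1 - pi ^+ e).
  by apply: unit_addm; [apply: unit1|rewrite -sub0r; apply: mlocB => //; [apply: mloc_P => //; apply: (P_0 pP)|apply: piX_m]].
have -> : pi^-1 = (N%:R / pi ^+ i.+1) * z * (1 - pi ^+ e)^-1.
  have u0 := unit_neq0 u; apply: (mulIf u0); rewrite divfK // mulrAC -ez exprSr.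
  by field; rewrite pi0 expf_neq0.
by apply: RlocM => //; [apply: RlocM => //; apply: Rloc_O|have [] := unitV u].
Qed.

(** A relation instead of a function: existence and uniqueness are [ord_exists] and [ord_inj], and 0
    has no order. *)
Definition ordP x (n : int) := unitP (x * pi ^ (- n)).

Lemma ordM x y a b : ordP x a -> ordP y b -> ordP (x * y) (a + b).
Proof.
rewrite /ordP => h1 h2; rewrite opprD expfzDr //.
by rewrite mulrACA; apply: unitM.
Qed.

Lemma ordV x a : ordP x a -> ordP x^-1 (- a).
Proof. by rewrite /ordP => h; have := unitV h; rewrite invfM invr_expz opprK. Qed.

Lemma ord_pi : ordP pi 1.
Proof. by rewrite /ordP exprN1 divff //; apply: unit1. Qed.

Lemma ord_unit u : unitP u -> ordP u 0.
Proof. by rewrite /ordP oppr0 expr0z mulr1. Qed.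

Lemma ordX x a n : ordP x a -> ordP (x ^+ n) (a * n%:Z).
Proof.
move=> h; elim: n => [|n IH]; first by rewrite mulr0; apply: ord_unit; apply: unit1.
rewrite exprS -addn1 PoszD mulrDr mulr1 addrC; exact: ordM.
Qed.

Lemma ord_neq0 x a : ordP x a -> x != 0.
Proof. by move=> /unit_neq0; apply: contraNneq => ->; rewrite mul0r. Qed.

Lemma ord_O x : O x -> x != 0 -> exists n : nat, ordP x n.
Proof.
move=> hx x0; have [Kx xA] := hx.
have [N [w [N0 wA [p ew] e]]] := Aint_dvd_nat xA x0.
have [k0 hk0] := nat_bounded N0.
have ex : exists k, dec (~ R (x / pi ^+ k)).
  exists k0; apply/decP => h; apply: hk0; rewrite -e mulrAC; apply: RlocM => //.
  by apply: Rloc_O => //; split => //; rewrite ew; apply: sf_poly.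
case: (ex_minnP ex) => -[|k] /decP hk min.
  by case: hk; rewrite expr0 divr1; apply: Rloc_O.
exists k; rewrite /ordP -exprnN; split.
  by apply: NNPP => h; have := min k (introT (decP _) h); rewrite ltnn.
move=> h; apply: hk; rewrite exprSr invfM mulrA; exact: mdiv.
Qed.

Lemma ord_exists x : K x -> x != 0 -> exists n, ordP x n.
Proof.
move=> Kx x0; have [N N0 NA] := Aint_multiple x.
have KN : K N%:R by apply: sf_nat.
have N0' : N%:R != 0 :> algC by rewrite pnatr_eq0 -lt0n.
have [a ha] : exists n : nat, ordP (N%:R * x) n.
  by apply: ord_O; [split => //; apply: sfM|rewrite mulf_neq0].
have [b hb] : exists n : nat, ordP N%:R n by apply: ord_O => //; apply: (roi_int hK N).
exists (a%:Z - b%:Z); rewrite -(mulKf N0' x) mulrC; apply: ordM => //; exact: ordV.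
Qed.

Lemma unit_ord0 u n : unitP u -> ordP u n -> n = 0.
Proof.
move=> hu hn; have h : unitP (pi ^ n).
  have := unitV (unitM (unitV hu) hn).
  by rewrite mulKf ?unit_neq0 // invr_expz opprK.
case: n h {hn} => [[|n]|n] // [h1 h2].
  by case: h2; apply: piX_m.
case: npiV; rewrite NegzE -exprnN in h1.
have -> : pi^-1 = pi ^+ n * (pi ^+ n.+1)^-1 by rewrite exprSr invfM mulrA divff ?mul1r // expf_neq0.
by apply: RlocM => //; apply: RX.
Qed.

Lemma ord_inj x a b : ordP x a -> ordP x b -> a = b.
Proof.
move=> ha hb; have := ordM hb (ordV ha); rewrite divff ?(ord_neq0 ha) // => h.
by apply/esym/eqP; rewrite -subr_eq0; apply/eqP; apply: unit_ord0 h; apply: unit1.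
Qed.

Lemma ord_R x n : ordP x n -> 0 <= n -> R x.
Proof.
case: n => // n h _; rewrite /ordP -exprnN in h.
rewrite -(divfK (expf_neq0 n pi0) x); apply: RlocM => //; [by have [] := h|exact: RX].
Qed.

Lemma ord_m x n : ordP x n -> 0 < n -> m x.
Proof.
case: n => // -[//|n] h _; rewrite /ordP -exprnN in h.
rewrite -(divfK (expf_neq0 n.+1 pi0) x); apply: mlocM => //; [by have [] := h|exact: piX_m].
Qed.

Lemma R_ord_ge0 x n : R x -> ordP x n -> 0 <= n.
Proof.
move=> hR hn; rewrite leNgt; apply/negP => lt.
have h := ord_m (ordV hn); rewrite oppr_gt0 in h.
apply: (mloc_1 nfK pP); rewrite -(divff (ord_neq0 hn)); apply: mlocM => //; exact: h.
Qed.

Lemma m_ord_gt0 x n : m x -> ordP x n -> 0 < n.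
Proof.
move=> hm hn; have := R_ord_ge0 (mloc_R pP hm) hn; rewrite le_eqVlt => /orP[/eqP e|//].
by move: hn; rewrite -e /ordP oppr0 expr0z mulr1 => -[_ []].
Qed.

Lemma ordD_lt x y a b : ordP x a -> ordP y b -> a < b -> ordP (x + y) a.
Proof.
move=> ha hb ab; have x0 := ord_neq0 ha.
have -> : x + y = x * (1 + y / x) by rewrite mulrDr mulr1 mulrC divfK.
rewrite -[a]addr0; apply: ordM => //; apply: ord_unit; apply: unit_addm; first exact: unit1.
by apply: (ord_m (ordM hb (ordV ha))); rewrite subr_gt0.
Qed.

Lemma ordN x a : ordP x a -> ordP (- x) a.
Proof.
rewrite /ordP mulNr => -[h1 h2]; split; first exact: RN.
move=> h; apply: h2; rewrite -[X in m X]opprK -sub0r; apply: mlocB => //.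
by apply: mloc_P => //; apply: (P_0 pP).
Qed.

Lemma unit_nat N : coprime N l -> unitP N%:R.
Proof.
move=> co; apply: unit_O; first exact: (roi_int hK N).
move=> PN; have [N0|N0] := posnP N.
  by move: co; rewrite N0 /coprime gcd0n => /eqP l1; have := pl; rewrite l1.
have [u v e _] := egcdnP l N0; apply: (P_1 pP).
have -> : 1 = u%:R * N%:R - v%:R * l%:R :> algC.
  by rewrite -!natrM e (eqP co) natrD addrAC subrr add0r.
by apply: (P_B nfK pP); apply: (P_M pP) => //; [apply: (roi_int hK u)|apply: (roi_int hK v)].
Qed.

(** From local to global divisibility: if x = pi^(k+1) a / b, take c with p = 1 - b c in P and g = 1
    + p + ... + p^k. Then x = pi (pi^k a c g) + p (p^k x) is a sum of products as required. *)
Lemma idpow_iff k x : idpow O P k x <-> O x /\ R (x / pi ^+ k).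
Proof.
elim: k x => [|k IH] x /=.
  by rewrite expr0 divr1; split => [h|[]//]; split => //; apply: Rloc_O.
split.
  move=> [s [hs ->]]; elim: s hs => [|[a b] s IHs] hs.
    by rewrite big_nil mul0r; split => //; apply: roi0.
  have [|h1 h2] := IHs.
    by move=> ab abs; apply: hs; rewrite inE abs orbT.
  have [/= Pa /IH [Ob hb]] := hs _ (mem_head _ _); rewrite big_cons /=; split.
    by apply: roiD => //; apply: roiM => //; apply: (P_O pP).
  rewrite mulrDl; apply: RD => //.
  have -> : a * b / pi ^+ k.+1 = (a / pi) * (b / pi ^+ k).
    by rewrite exprS; field; rewrite pi0 expf_neq0.
  by apply: RlocM => //; apply: mdiv; apply: mloc_P.
move=> [Ox [a [b [Oa Ob nb e]]]].
have [c Oc Pc] := inv_modP nfK pP pl Pl Ob nb.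
have ex : x * b = pi ^+ k.+1 * a.
  have pk : pi ^+ k.+1 != 0 by rewrite expf_neq0.
  have := congr1 (fun y => y * pi ^+ k.+1 * b) e; rewrite divfK // => ->.
  by rewrite mulrAC divfK ?(nP_neq0 pP) // mulrC.
pose p := 1 - b * c; pose g := \sum_(i < k.+1) p ^+ i.
have Pp : P p by rewrite /p -opprB; apply: (P_N nfK pP).
have Op := P_O pP Pp.
have Og : O g by apply: roi_sum => // i; apply: roiX.
have Opi := P_O pP Ppi.
have epg : 1 - p ^+ k.+1 = b * c * g.
  have := subrX1 p k.+1; rewrite -/g => e1; rewrite -opprB e1 /p; ring.
exists [:: (pi, pi ^+ k * (a * c * g)); (p, p ^+ k * x)]; split; last first.
  rewrite big_cons big_seq1 /= !mulrA -!exprS.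
  have -> : pi ^+ k.+1 * a * c * g = x * (1 - p ^+ k.+1) by rewrite epg -ex; ring.
  ring.
move=> ab; rewrite !inE => /orP[/eqP ->|/eqP ->] /=; split => //; apply/IH; split.
- by apply: roiM => //; [apply: roiX|apply: roiM => //; apply: roiM].
- rewrite mulrAC divff ?expf_neq0 // mul1r; apply: Rloc_O => //.
  by apply: roiM => //; apply: roiM.
- by apply: roiM => //; apply: roiX.
rewrite mulrAC -expr_div_n; apply: RlocM => //; last exact: Rloc_O.
by apply: RX; apply: mdiv; apply: mloc_P.
Qed.

Lemma Rloc_ord_ge0 t : R t -> ord_ge0 K P t.
Proof.
move=> [a [b [Oa Ob nb e]]]; exists a, b; split => //; split => //; split.
  by apply/eqP; apply: (nP_neq0 pP).
split => // -[|k] /idpow_iff [_ h] //; case: nb; apply: (mloc_O pP Ob).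
rewrite -(divfK (expf_neq0 k.+1 pi0) b); apply: mlocM => //; exact: piX_m.
Qed.

Lemma ord_ge0_Rloc t : ord_ge0 K P t -> R t.
Proof.
move=> [a [b [Oa [Ob [/eqP b0 [-> h]]]]]].
have [n hn] := ord_O Ob b0; rewrite /ordP -exprnN in hn.
have /h /idpow_iff [_ ha] : idpow O P n b by apply/idpow_iff; split => //; case: hn.
have -> : a / b = (a / pi ^+ n) * (b / pi ^+ n)^-1.
  by field; rewrite b0 expf_neq0.
by apply: RlocM => //; have [] := unitV hn.
Qed.
End Ord.

(** * Residue fields *)

Lemma transversal (E : algC -> algC -> Prop) (s : seq algC) : (forall x, E x x) ->
  (forall x y, E x y -> E y x) ->
  exists t, [/\ {subset t <= s},
    forall i j, (i < size t)%N -> (j < size t)%N -> i <> j -> ~ E t`_i t`_j &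
    forall x, x \in s -> exists2 y, y \in t & E x y].
Proof.
move=> refl sym; elim: s => [|x s [t [ts tE tc]]]; first by exists [::].
have [[y yt xy]|no] := classic (exists2 y, y \in t & E x y).
  exists t; split => // [z /ts|z]; first by rewrite inE => ->; rewrite orbT.
  by rewrite inE => /orP[/eqP ->|/tc //]; exists y.
exists (x :: t); split.
- by move=> z; rewrite !inE => /orP[->|/ts ->] //; rewrite orbT.
- case=> [|i] [|j] //= hi hj ij h.
  + by apply: no; exists t`_j => //; apply: mem_nth.
  + by apply: no; exists t`_i; [apply: mem_nth|apply: sym].
  + by apply: (tE i j) => // e; apply: ij; rewrite e.
move=> z; rewrite inE => /orP[/eqP ->|/tc [y yt zy]]; first by exists x; rewrite ?mem_head.
by exists y => //; rewrite inE yt orbT.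
Qed.

Section Residue.
Variables (K P : cset) (l : nat).
Hypothesis nfK : is_number_field K.
Hypothesis pP : is_prime_of K P.
Hypotheses (pl : prime l) (Pl : P l%:R).
Let hK : is_subfield K := proj1 nfK.
Local Notation O := (ring_of_integers K).

Lemma residue_card_exists : exists n, residue_card K P n.
Proof.
have [s [sO hs]] := reps_mod nfK (prime_gt0 pl) (fun x (h : O x) => h).
have [||t [ts tE tc]] := @transversal (fun x y => P (x - y)) s.
- by move=> x; rewrite subrr; apply: (P_0 pP).
- by move=> x y h; rewrite -opprB; apply: (P_N nfK pP).
exists (size t), t; split => //; split; first by move=> x /ts /sO.
split => // x Ox; have [y [z [ys Oz ->]]] := hs x Ox.
have [w wt h] := tc y ys; exists w => //; rewrite addrAC; apply: (P_D pP) => //.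
exact: (P_Mr pP).
Qed.

Variable s : seq algC.
Hypotheses (sO : forall x, x \in s -> O x)
  (sE : forall i j, (i < size s)%N -> (j < size s)%N -> i <> j -> ~ P (s`_i - s`_j))
  (sc : forall x, O x -> exists2 y, y \in s & P (x - y)).

(** A name of its own for the set of indices, to carry the field structure of the residue
    classes. *)
Definition resT := 'I_(size s).
HB.instance Definition _ := Finite.on resT.

Lemma s_inh : inhabited resT.
Proof.
have [y ys _] := sc (roi0 hK).
by have lt : (index y s < size s)%N; [rewrite index_mem|exact: inhabits (Ordinal lt)].
Qed.

Definition cls (x : algC) : resT := epsilon s_inh (fun i => P (x - s`_(i : 'I_(size s)))).
Let e (i : resT) : algC := s`_(i : 'I_(size s)).

Let eO i : O (e i). Proof. by apply: sO; apply: mem_nth. Qed.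

Let P_eq x y : P x -> x = y -> P y. Proof. by move=> h <-. Qed.

Let clsP x : O x -> P (x - e (cls x)).
Proof.
move=> Ox; apply: (epsilon_spec s_inh (fun i : resT => P (x - e i))).
have [y ys h] := sc Ox; have lt : (index y s < size s)%N by rewrite index_mem.
by exists (Ordinal lt); rewrite /e /= nth_index.
Qed.

Let cls_e i x : O x -> P (x - e i) -> cls x = i.
Proof.
move=> Ox h; apply: NNPP => ne; have h2 := clsP Ox.
have h3 : P (e (cls x) - e i) by apply: (P_eq (P_B nfK pP h h2)); ring.
have ne' : (i : 'I_(size s)) <> cls x :> nat by move=> e1; apply: ne; apply/esym/val_inj.
case: (sE (ltn_ord (cls x : 'I_(size s))) (ltn_ord (i : 'I_(size s)))) => //.
by move=> e1; apply: ne'.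
Qed.

Let clsK i : cls (e i) = i.
Proof. by apply: cls_e => //; rewrite subrr; apply: (P_0 pP). Qed.

Lemma cls_eq x y : O x -> O y -> (cls x = cls y <-> P (x - y)).
Proof.
move=> Ox Oy; split=> [h|h].
  by apply: (P_eq (P_B nfK pP (clsP Ox) (clsP Oy))); rewrite h; ring.
apply: cls_e => //; apply: (P_eq (P_D pP h (clsP Oy))); ring.
Qed.

Let addT (i j : resT) := cls (e i + e j).
Let mulT (i j : resT) := cls (e i * e j).
Let oppT (i : resT) := cls (- e i).

Let clsD x y : O x -> O y -> addT (cls x) (cls y) = cls (x + y).
Proof.
move=> Ox Oy; apply/cls_eq; [exact: roiD|exact: roiD|].
apply: (P_eq (P_N nfK pP (P_D pP (clsP Ox) (clsP Oy)))); ring.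
Qed.
Let clsM x y : O x -> O y -> mulT (cls x) (cls y) = cls (x * y).
Proof.
move=> Ox Oy; apply/cls_eq; [exact: roiM|exact: roiM|].
have h1 := P_N nfK pP (P_M pP Oy (clsP Ox)).
have h2 := P_N nfK pP (P_M pP (eO (cls x)) (clsP Oy)).
apply: (P_eq (P_D pP h1 h2)); ring.
Qed.
Let clsN x : O x -> oppT (cls x) = cls (- x).
Proof.
move=> Ox; apply/cls_eq; [exact: roiN|exact: roiN|].
apply: (P_eq (clsP Ox)); ring.
Qed.

Let addA : associative addT.
Proof.
move=> i j k; rewrite -(clsK i) -(clsK j) -(clsK k) !clsD //; last 2 first.
- exact: roiD.
- exact: roiD.
by rewrite addrA.
Qed.
Let addC : commutative addT. Proof. by move=> i j; rewrite /addT addrC. Qed.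
Let add0 : left_id (cls 0) addT.
Proof. by move=> i; rewrite -(clsK i) clsD ?add0r //; apply: roi0. Qed.
Let addN : left_inverse (cls 0) oppT addT.
Proof. by move=> i; rewrite -(clsK i) clsN // clsD ?addNr //; apply: roiN. Qed.
HB.instance Definition _ := GRing.isZmodule.Build resT addA addC add0 addN.

Let mulA : associative mulT.
Proof.
move=> i j k; rewrite -(clsK i) -(clsK j) -(clsK k) !clsM //; last 2 first.
- exact: roiM.
- exact: roiM.
by rewrite mulrA.
Qed.
Let mulC : commutative mulT. Proof. by move=> i j; rewrite /mulT mulrC. Qed.
Let mul1 : left_id (cls 1) mulT.
Proof. by move=> i; rewrite -(clsK i) clsM ?mul1r //; apply: roi1. Qed.
Let mulD : left_distributive mulT addT.
Proof.
move=> i j k; rewrite -(clsK i) -(clsK j) -(clsK k) clsD // !clsM // ?clsD //; try exact: roiM.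
  by rewrite mulrDl.
exact: roiD.
Qed.
Let one0 : cls 1 != cls 0.
Proof.
apply/eqP => /(cls_eq (roi1 hK) (roi0 hK)); rewrite subr0; exact: (P_1 pP).
Qed.
HB.instance Definition _ := GRing.Zmodule_isComNzRing.Build resT mulA mulC mul1 mulD one0.

Let inv_ex (i : resT) : exists j : resT, (i != 0 -> j * i = 1) /\ (i = 0 -> j = 0).
Proof.
have [->|i0] := eqVneq i 0; first by exists 0; split => // /eqP.
have nP : ~ P (e i).
  move=> h; case/eqP: i0; rewrite -(clsK i); apply/(cls_eq (eO i) (roi0 hK)).
  by rewrite subr0.
have [y Oy hy] := inv_modP nfK pP pl Pl (eO i) nP.
exists (cls y); split => [_|/eqP]; last by rewrite (negbTE i0).
rewrite -[LHS]/(mulT (cls y) i) -[i in LHS]clsK clsM //; apply/cls_eq; [exact: roiM|exact: roi1|].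
by rewrite mulrC.
Qed.
Let invT (i : resT) : resT := sval (constructive_indefinite_description _ (inv_ex i)).
Let mulV i : i != 0 -> invT i * i = 1.
Proof. by rewrite /invT; case: constructive_indefinite_description => j [h _] /=. Qed.
Let inv0 : invT 0 = 0.
Proof. by rewrite /invT; case: constructive_indefinite_description => j [_ h] /=; apply: h. Qed.
HB.instance Definition _ := GRing.ComNzRing_isField.Build resT mulV inv0.

Lemma residue_field : exists (k : finFieldType) (c : algC -> k),
  [/\ #|k| = size s, c 1 = 1, forall i, exists2 x, O x & c x = i,
    forall x y, O x -> O y -> (c x = c y <-> P (x - y)) &
    forall x y, O x -> O y -> c (x + y) = c x + c y /\ c (x * y) = c x * c y].
Proof.
exists (resT : finFieldType), cls; split => //.
- by rewrite card_ord.
- by move=> i; exists (e i).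
- exact: cls_eq.
by move=> x y Ox Oy; split; apply/esym; [apply: clsD|apply: clsM].
Qed.
End Residue.

Lemma nformZ (K : comNzRingType) d (a : K) (x : 'I_d.+1 -> K) :
  nform (fun i => a * x i) = a ^+ d.+1 * nform x.
Proof.
rewrite /nform -detZ; congr (\det _); rewrite /nform_mx scaler_sumr.
by apply: eq_bigr => i _; rewrite scalerA.
Qed.

(** * Orders of norms at a prime ideal *)

Section LocalNorm.
Variables (K P : cset) (l : nat) (pi : algC).
Hypothesis nfK : is_number_field K.
Hypothesis pP : is_prime_of K P.
Hypotheses (pl : prime l) (Pl : P l%:R).
Hypotheses (Ppi : P pi) (pi0 : pi != 0) (npiV : ~ Rloc K P pi^-1).
Hypothesis mdiv : forall x, mloc K P x -> Rloc K P (x / pi).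
Let hK : is_subfield K := proj1 nfK.
Local Notation O := (ring_of_integers K).
Local Notation R := (Rloc K P).
Local Notation m := (mloc K P).

Variables (k : finFieldType) (c : algC -> k).
Hypotheses (c1 : c 1 = 1) (c_surj : forall i, exists2 x, O x & c x = i)
  (c_eq : forall x y, O x -> O y -> (c x = c y <-> P (x - y)))
  (c_morph : forall x y, O x -> O y -> c (x + y) = c x + c y /\ c (x * y) = c x * c y).

Let cD x y : O x -> O y -> c (x + y) = c x + c y.
Proof. by move=> hx hy; have [] := c_morph hx hy. Qed.
Let cM x y : O x -> O y -> c (x * y) = c x * c y.
Proof. by move=> hx hy; have [] := c_morph hx hy. Qed.
Let c0 : c 0 = 0.
Proof. by have := cD (roi0 hK) (roi0 hK); rewrite addr0 -[LHS]addr0 => /addrI. Qed.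
Let cB x y : O x -> O y -> c (x - y) = c x - c y.
Proof.
by move=> hx hy; apply/eqP; rewrite -subr_eq0 opprB addrA subr_eq0 -cD ?subrK //; apply: roiB.
Qed.
Let cP x : O x -> (c x = 0 <-> P x).
Proof. by move=> hx; rewrite -c0 -[X in _ <-> P X]subr0; apply: c_eq => //; apply: roi0. Qed.
Let c_neq0 x : O x -> ~ P x -> c x != 0.
Proof. by move=> hx nx; apply/eqP => /(cP hx). Qed.

Let frac_ex x : exists ab : algC * algC, R x -> [/\ O ab.1, O ab.2, ~ P ab.2 & x = ab.1 / ab.2].
Proof.
have [[a [b h]]|no] := classic (R x); first by exists (a, b).
by exists (0, 1).
Qed.
Let frac x := sval (constructive_indefinite_description _ (frac_ex x)).
Let fracP x : R x -> [/\ O (frac x).1, O (frac x).2, ~ P (frac x).2 & x = (frac x).1 / (frac x).2].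
Proof. by rewrite /frac; case: constructive_indefinite_description. Qed.

Definition rho x : k := c (frac x).1 / c (frac x).2.

Lemma rhoE a b : O a -> O b -> ~ P b -> rho (a / b) = c a / c b.
Proof.
move=> Oa Ob nb; have hR : R (a / b) by exists a, b.
have [h1 h2 h3 e] := fracP hR; rewrite /rho.
have b0 := nP_neq0 pP nb; have b0' := nP_neq0 pP h3.
have e2 : (frac (a / b)).1 * b = a * (frac (a / b)).2.
  have := congr1 (fun y => y * b * (frac (a / b)).2) e.
  by rewrite divfK // => ->; rewrite mulrAC divfK // mulrC.
have := congr1 c e2; rewrite !cM // => e3.
apply/eqP; rewrite eqr_div ?c_neq0 //; exact/eqP.
Qed.

Lemma rho_O a : O a -> rho a = c a.
Proof.
by move=> Oa; have := rhoE Oa (roi1 hK) (P_1 pP); rewrite c1 !divr1.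
Qed.

Lemma rhoB x y : R x -> R y -> rho (x - y) = rho x - rho y.
Proof.
move=> [a [b [Oa Ob nb ->]]] [a' [b' [Oa' Ob' nb' ->]]].
have -> : a / b - a' / b' = (a * b' - a' * b) / (b * b').
  by field; rewrite !(nP_neq0 pP).
rewrite !rhoE // ?cB ?cM //; try exact: roiM; last first.
- exact: (nP_M pP).
- by apply: roiB => //; apply: roiM.
by field; rewrite !c_neq0.
Qed.

Lemma rhoM x y : R x -> R y -> rho (x * y) = rho x * rho y.
Proof.
move=> [a [b [Oa Ob nb ->]]] [a' [b' [Oa' Ob' nb' ->]]].
have -> : a / b * (a' / b') = (a * a') / (b * b') by field; rewrite !(nP_neq0 pP).
rewrite !rhoE // ?cM //; try exact: roiM; last exact: (nP_M pP).
by field; rewrite !c_neq0.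
Qed.

Lemma rho0P x : R x -> (rho x = 0 <-> m x).
Proof.
move=> [a [b [Oa Ob nb ->]]]; rewrite rhoE //; split.
  move/eqP; rewrite mulf_eq0 invr_eq0 (negbTE (c_neq0 Ob nb)) orbF => /eqP /(cP Oa) h.
  by exists a, b.
move=> h; have Pa : P a.
  apply: (mloc_O pP Oa); rewrite -(divfK (nP_neq0 pP nb) a) mulrC.
  by apply: mlocM => //; apply: Rloc_O.
by have /(cP Oa) -> := Pa; rewrite mul0r.
Qed.

(** Multiplying the entries by pi^t makes them integral and adds t (r - 1) to the order of the norm.
    The shift is harmless: the power of q that matters later divides r - 1. *)
Lemma local_norm_ord d (x : 'I_d.+1 -> algC) (N : int) : prime d.+2 -> d.+2 != l ->
  (forall i, K (x i)) -> ordP K P pi (nform x) N ->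
  exists M t : nat, N + (t * d.+1)%N%:Z = M%:Z /\ (#|k| ^ M = 1 %[mod d.+2])%N.
Proof.
move=> pr rl Kx hN.
have [t ht] : exists t, forall i, R (pi ^+ t * x i).
  have h i : exists t, R (pi ^+ t * x i).
    have [->|x0] := eqVneq (x i) 0.
      by exists 0%N; rewrite mulr0; apply: Rloc_O => //; apply: roi0.
    have [n hn] := ord_exists nfK pP Ppi pi0 npiV mdiv (Kx i) x0.
    exists `|n|%N; apply: (ord_R nfK pP Ppi pi0 (n := 1 * `|n|%N%:Z + n)); last by lia.
    by apply: ordM => //; apply: ordX => //; apply: ord_pi.
  have [f hf] := fin_all_exists h; exists (\sum_i f i)%N => i.
  rewrite (bigD1 i) //= exprD mulrAC; apply: RlocM => //.
  elim: (\sum_(_ < _ | _) _)%N => [|j IH]; first by apply: Rloc_O => //; apply: roi1.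
  by rewrite exprS; apply: RlocM => //; apply: Rloc_O => //; apply: (P_O pP).
pose y i := pi ^+ t * x i; pose A : 'M[algC]_d.+1 := nform_mx y.
have detA : \det A = pi ^+ (t * d.+1) * nform x by rewrite exprM -nformZ.
have Rint (n : int) : R n%:~R by apply: Rloc_O => //; apply: roi_int.
have R1 : R 1 by apply: Rloc_O => //; apply: roi1.
have Rpi : R pi by apply: Rloc_O => //; apply: (P_O pP).
have Cint i a b : R ((cyclo_mx algC d ^+ i) a b).
  by rewrite -(map_cyclo intr) -rmorphXn mxE; exact: Rint.
have Rsum (s : seq 'I_d.+1) (F : 'I_d.+1 -> algC) : (forall i, R (F i)) -> R (\sum_(i <- s) F i).
  move=> hF; apply: (big_ind R) => //; first by apply: Rloc_O => //; apply: roi0.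
  move=> u v hu hv; rewrite -[v]opprK; apply: RlocB => //; rewrite -sub0r.
  by apply: RlocB => //; apply: Rloc_O => //; apply: roi0.
have RA : Rmx R A.
  by move=> a b; rewrite /A summxE; apply: Rsum => i; rewrite mxE; apply: (RlocM nfK pP (ht i)); apply: Cint.
have RC : Rmx R (cyclo_mx algC d) by move=> a b; have := Cint 1%N a b; rewrite expr1.
have hdet : ordP K P pi (\det A) (1 * (t * d.+1)%N%:Z + N).
  by rewrite detA; apply: ordM => //; apply: ordX => //; apply: ord_pi.
have r1 : rho 1 = 1 by rewrite rho_O ?c1 //; apply: roi1.
have surj (i : k) : exists2 a, R a & rho a = i.
  by have [a Oa ca] := c_surj i; exists a; [apply: Rloc_O|rewrite rho_O].
have RV u : R u -> rho u != 0 -> R u^-1.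
  by move=> Ru h; apply: RlocV => // hm; case/eqP: h; apply/rho0P.
have rpi : rho pi = 0 by apply/rho0P => //; apply: mloc_P.
have Rdiv u : R u -> rho u = 0 -> R (u / pi) by move=> Ru /(rho0P Ru); apply: mdiv.
have Or : O d.+2%:R by apply: (roi_int hK d.+2).
have cn (n : nat) : n%:R = c n%:R.
  elim: n => [|n IH]; first by rewrite c0.
  by rewrite -addn1 !natrD IH cD ?c1 //; [apply: (roi_int hK n)|apply: roi1].
have rk : (d.+2%:R : k) != 0.
  rewrite cn; apply: c_neq0 => //.
  have [_ h] : unitP K P d.+2%:R.
    by apply: (unit_nat nfK pP pl Pl); rewrite prime_coprime // dvdn_prime2.
  by move=> Pr; apply: h; apply: mloc_P.
have RdA : R (\det A).
  by have [] := @Rmx_det algC k R rho R1 (RlocB nfK pP) (RlocM nfK pP)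
    r1 rhoB rhoM _ A RA.
have ge := R_ord_ge0 nfK pP Ppi pi0 RdA hdet.
set M := absz (1 * (t * d.+1)%N%:Z + N)%R.
have eM : 1 * (t * d.+1)%N%:Z + N = M%:Z by rewrite /M gez0_abs.
exists M, t; split; first by rewrite -eM mul1r addrC.
have [Ru nu] : unitP K P (\det A * pi ^ (- M%:Z)) by rewrite -eM.
apply: (@intertwiner_det algC k R rho pi R1 (RlocB nfK pP) (RlocM nfK pP)
   r1 rhoB rhoM surj RV pi0 Rpi rpi Rdiv d d.+2 (cyclo_mx algC d) pr rk RC
   (cyclo_sum _ _) M A (cyclo_mx algC d) (\det A * pi ^ (- M%:Z))) => //.
- exact: nform_mx_comm.
- by apply/eqP => /(rho0P Ru).
by rewrite -exprnN divfK // expf_neq0.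
Qed.
End LocalNorm.

(** * Primes above pZ, residue degrees and ramification *)

Lemma number_field_gen (Z L : cset) (s : seq algC) : is_number_field Z -> is_subfield L ->
  csubset Z L -> (forall y, y \in s -> L y) ->
  exists M, [/\ is_number_field M, csubset Z M, csubset M L & forall y, y \in s -> M y].
Proof.
move=> nfZ hL ZL sL.
have [th [[Zth _] gen]] := nf_primitive nfZ.
have [z [a ez] [ps eps]] := algC_PET (th :: s).
pose M x := exists p, x = (pQtoC p).[z].
have inM y : y \in th :: s -> M y by rewrite eps => /mapP[p _ ->]; exists p.
have hM : is_subfield M by exact: adjoin_field.
have Lz : L z.
  rewrite ez; apply: (big_ind L) => [|x y|i _]; [exact: sf0|exact: sfD|].
  rewrite -mulr_natl; apply: sfM => //; first exact: sf_nat.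
  by have := mem_nth 0 (ltn_ord i); rewrite inE => /orP[/eqP ->|/sL //]; apply: ZL.
exists M; split.
- split => //; have [m [em mm] dv] := minCpolyP z.
  exists [seq z ^+ i | i <- iota 0 (size m).-1]; split.
    by move=> _ /mapP[i _ ->]; apply: sfX => //; exists 'X; rewrite map_polyX hornerX.
  move=> _ [p ->]; pose f := p %% m.
  exists [seq ratr f`_i | i <- iota 0 (size m).-1]; split; first by rewrite !size_map.
  split; first by move=> _ /mapP[i _ ->]; apply: Crat_rat.
  have -> : (pQtoC p).[z] = (pQtoC f).[z].
    rewrite [in LHS](divp_eq p m) rmorphD rmorphM /= hornerD hornerM.
    have /eqP -> : root (pQtoC m) z by rewrite dv dvdpp.
    by rewrite mulr0 add0r.
  rewrite (@horner_coef_wide _ (size m).-1).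
    rewrite size_map size_iota; apply: eq_bigr => i _; rewrite coef_map /=.
    by rewrite !(nth_map 0%N) ?size_iota // nth_iota.
  rewrite size_map_poly -ltnS prednK ?size_poly_gt0 ?monic_neq0 //.
  by rewrite ltn_modp monic_neq0.
- move=> x /gen [p ->]; apply: sf_poly => //; apply: inM; exact: mem_head.
- by move=> x [p ->]; apply: sf_poly.
by move=> y ys; apply: inM; rewrite inE ys orbT.
Qed.

Section LyingOver.
Variables (Z pZ M : cset) (l : nat).
Hypotheses (nfZ : is_number_field Z) (pP : is_prime_of Z pZ).
Hypotheses (nfM : is_number_field M) (ZM : csubset Z M).
Hypotheses (pl : prime l) (Pl : pZ l%:R).
Let hZ := proj1 nfZ.
Let hM := proj1 nfM.
Local Notation OZ := (ring_of_integers Z).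
Local Notation OM := (ring_of_integers M).

Lemma OZM x : OZ x -> OM x.
Proof. by move=> [h1 h2]; split => //; apply: ZM. Qed.

(** If 1 were a combination of elements of pZ with coefficients in O_M, then t g, with g from
    [inverse_ideal] and t a common denominator outside pZ, would be integral, and g would lie in
    [Rloc]. *)
Lemma one_notin_extension (s : seq (algC * algC)) :
  (forall ab, ab \in s -> pZ ab.1 /\ OM ab.2) -> \sum_(ab <- s) ab.1 * ab.2 <> 1.
Proof.
move=> hs e1; have [g [Zg nRg gR]] := inverse_ideal nfZ pP pl Pl.
have [t [Ot nt ht]] : exists t, [/\ OZ t, ~ pZ t & forall ab, ab \in s -> OZ (t * g * ab.1)].
  elim: (s) hs => [|ab s' IH] hs'.
    by exists 1; split => //; [apply: roi1|apply: (P_1 pP)].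
  have [|t [Ot nt ht]] := IH; first by move=> y ys; apply: hs'; rewrite inE ys orbT.
  have [Pab _] := hs' ab (mem_head _ _); have [a [b [Oa Ob nb e]]] := gR _ Pab.
  exists (t * b); split; [exact: roiM|exact: (nP_M pP)|] => y; rewrite inE => /orP[/eqP ->|ys].
    have -> : t * b * g * ab.1 = t * a.
      by rewrite -!mulrA e; field; apply: (nP_neq0 pP).
    exact: roiM.
  have -> : t * b * g * y.1 = b * (t * g * y.1) by ring.
  by apply: roiM => //; apply: ht.
have Otg : OZ (t * g).
  split; first by apply: sfM => //; case: Ot.
  rewrite -[t * g]mulr1 -e1 mulr_sumr big_seq; apply: rpred_sum => ab abs.
  rewrite mulrA; apply: rpredM; first by case: (ht _ abs).
  by have [_ []] := hs _ abs.
by apply: nRg; exists (t * g), t; split => //; rewrite mulrAC divff ?mul1r // (nP_neq0 pP).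
Qed.

Definition proper_ideal (J : cset) := [/\ csubset J OM, csubset pZ J,
  forall x y, J x -> J y -> J (x + y), forall a x, OM a -> J x -> J (a * x) & ~ J 1].

(** A maximal proper ideal containing pZ. It contains l, so its size can be measured by counting the
    representatives modulo l that belong to it. *)
Lemma lying_over : exists P, is_prime_of M P /\ lies_above Z P pZ.
Proof.
have [s [sO hs]] := reps_mod nfM (prime_gt0 pl) (fun x (h : OM x) => h).
pose cnt (J : cset) := count (fun r => dec (J r)) s.
have ex : exists n, dec (exists2 J, proper_ideal J & cnt J = n).
  pose J0 x := exists2 w : seq (algC * algC), (forall ab, ab \in w -> pZ ab.1 /\ OM ab.2) &
     \sum_(ab <- w) ab.1 * ab.2 = x.
  exists (cnt J0); apply/decP; exists J0 => //; split.
  - move=> _ [w hw <-]; rewrite big_seq; apply: (big_ind OM) => [|x y|ab /hw [h1 h2]].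
    + exact: roi0.
    + exact: roiD.
    by apply: roiM => //; apply: OZM; apply: (P_O pP).
  - move=> x hx; exists [:: (x, 1)]; last by rewrite big_seq1 mulr1.
    by move=> ab; rewrite inE => /eqP ->; split => //; apply: roi1.
  - move=> _ _ [w hw <-] [w' hw' <-]; exists (w ++ w'); last by rewrite big_cat.
    by move=> ab; rewrite mem_cat => /orP[/hw|/hw'].
  - move=> a _ Oa [w hw <-]; exists [seq (ab.1, a * ab.2) | ab <- w].
      by move=> _ /mapP[ab /hw [h1 h2] ->]; split => //; apply: roiM.
    by rewrite big_map mulr_sumr; apply: eq_bigr => ab _; rewrite mulrCA.
  by move=> [w hw] /(one_notin_extension hw).
have ub n : dec (exists2 J, proper_ideal J & cnt J = n) -> (n <= size s)%N.
  by move=> /decP [J _ <-]; apply: count_size.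
case: (ex_maxnP ex ub) => n /decP[J [JO pJ JD JM nJ1] cJ] max; exists J.
have Jl : J l%:R by apply: pJ.
have J0 : J 0 by rewrite -(mul0r l%:R); apply: JM => //; apply: roi0.
have Jmax a : OM a -> ~ J a -> exists j o, [/\ J j, OM o & 1 = j + a * o].
  move=> Oa nJa; apply: NNPP => no.
  pose J' x := exists j o, [/\ J j, OM o & x = j + a * o].
  have pJ' : proper_ideal J'.
    split.
    - by move=> _ [j [o [hj ho ->]]]; apply: roiD; [|apply: JO|apply: roiM].
    - by move=> x hx; exists x, 0; rewrite mulr0 addr0; split => //; [apply: pJ|apply: roi0].
    - move=> _ _ [j [o [hj ho ->]]] [j' [o' [hj' ho' ->]]]; exists (j + j'), (o + o').
      by split; [apply: JD|apply: roiD|ring].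
    - move=> b _ Ob [j [o [hj ho ->]]]; exists (b * j), (b * o).
      by split; [apply: JM|apply: roiM|ring].
    by move=> [j [o [hj ho e]]]; apply: no; exists j, o.
  have [r [z [rs Oz er]]] := hs a Oa.
  have : (cnt J < cnt J')%N.
    apply: (sub_count_lt _ rs).
    - move=> x /decP h; apply/decP; exists x, 0; rewrite mulr0 addr0; split => //.
      exact: roi0.
    - apply/decP; exists (- z * l%:R), 1; split; [by apply: JM => //; apply: roiN|exact: roi1|].
      by rewrite er; ring.
    apply/decP => h; apply: nJa; rewrite er; apply: JD => //; rewrite mulrC; exact: JM.
  by rewrite ltnNge cJ max //; apply/decP; exists J'.
have JN1 j : J j -> J (- j).
  by move=> h; rewrite -mulN1r; apply: JM => //; apply: roiN => //; apply: roi1.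
split.
  split => //; split => //; split => //; split => //; split => //; split.
    move=> a b Oa Ob Jab; have [Ja|nJa] := classic (J a); [by left|right].
    have [j [o [Jj Oo e]]] := Jmax a Oa nJa.
    have -> : b = b * j + o * (a * b) by rewrite -[LHS]mulr1 e; ring.
    by apply: JD; apply: JM.
  by exists l%:R; split => //; apply/eqP; rewrite pnatr_eq0 -lt0n prime_gt0.
move=> x Ox; split => [Jx|]; last exact: pJ.
apply: NNPP => nx; have [y Oy hy] := inv_modP nfZ pP pl Pl Ox nx.
apply: nJ1; have -> : 1 = y * x + - (x * y - 1) by ring.
by apply: JD; [apply: JM => //; apply: OZM|apply: JN1; apply: pJ].
Qed.
End LyingOver.

Lemma card_pfield (k : finFieldType) l : prime l -> l%:R = 0 :> k -> exists a, #|k| = (l ^ a)%N.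
Proof.
move=> pl l0; have ch : l \in [pchar k] by rewrite inE pl l0 eqxx.
have := abelem_pgroup (fin_ring_pchar_abelem ch).
by rewrite /pgroup cardsT => /p_natP [a ea]; exists a.
Qed.

Lemma dvdn_exp_pred l a b : (1 < l)%N -> (0 < b)%N -> ((l ^ b).-1 %| (l ^ a).-1)%N -> (b %| a)%N.
Proof.
move=> l1 b0 h; have l0 : (0 < l)%N by apply: ltnW.
have lb : (1 < l ^ b)%N by rewrite -{1}(expn0 l) ltn_exp2l.
have pos n : (0 < l ^ n)%N by rewrite expn_gt0 l0.
have e1 : (l ^ a = 1 %[mod (l ^ b).-1])%N.
  by apply/eqP; rewrite eqn_mod_dvd ?pos // subn1.
have e2 n : (l ^ (b * n) = 1 %[mod (l ^ b).-1])%N.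
  have eb : (l ^ b = 1 %[mod (l ^ b).-1])%N.
    by apply/eqP; rewrite eqn_mod_dvd ?pos // subn1.
  by rewrite expnM -modnXm eb modnXm exp1n.
have e3 : (l ^ (a %% b) = 1 %[mod (l ^ b).-1])%N.
  by move: e1; rewrite {1}(divn_eq a b) mulnC expnD -modnMml e2 modnMml mul1n.
have r : (l ^ (a %% b) <= (l ^ b).-1)%N.
  by rewrite -ltnS prednK ?pos // ltn_exp2l // ltn_mod.
rewrite /dvdn; apply/negPn/negP => h0; rewrite -lt0n in h0.
have r1 : (1 < l ^ (a %% b))%N by rewrite -{1}(expn0 l) ltn_exp2l.
move/eqP: e3; rewrite eqn_mod_dvd ?pos // subn1 => /dvdn_leq h2.
have h3 : (0 < (l ^ (a %% b)).-1)%N by rewrite -subn1 subn_gt0.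
have := leq_trans r (h2 h3); rewrite leqNgt -{2}(prednK (pos (a %% b)%N)).
by rewrite ltnSn.
Qed.

Section Extension.
Variables (Z pZ M P : cset) (l : nat).
Hypotheses (nfZ : is_number_field Z) (pP : is_prime_of Z pZ).
Hypotheses (nfM : is_number_field M) (ZM : csubset Z M).
Hypotheses (pPM : is_prime_of M P) (above : lies_above Z P pZ).
Hypotheses (pl : prime l) (Pl : pZ l%:R).
Let hZ := proj1 nfZ.
Let hM := proj1 nfM.
Local Notation OZ := (ring_of_integers Z).
Local Notation OM := (ring_of_integers M).

Let PlM : P l%:R. Proof. by apply/above => //; apply: (P_O pP). Qed.

Lemma cls_X (K : cset) (k : finFieldType) (c : algC -> k) : is_subfield K -> c 1 = 1 ->
  (forall x y, ring_of_integers K x -> ring_of_integers K y ->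
     c (x + y) = c x + c y /\ c (x * y) = c x * c y) ->
  forall x n, ring_of_integers K x -> c (x ^+ n) = c x ^+ n.
Proof.
move=> hK c1 cm x n Ox; elim: n => [|n IH]; first by rewrite !expr0.
by rewrite !exprS -IH; have [] := cm x (x ^+ n) Ox (roiX hK n Ox).
Qed.

Lemma cls_0 (K : cset) (k : finFieldType) (c : algC -> k) : is_subfield K ->
  (forall x y, ring_of_integers K x -> ring_of_integers K y ->
     c (x + y) = c x + c y /\ c (x * y) = c x * c y) -> c 0 = 0.
Proof.
by move=> hK cm; have [+ _] := cm _ _ (roi0 hK) (roi0 hK); rewrite addr0 -[LHS]addr0 => /addrI.
Qed.

Lemma cls_nat (K : cset) (k : finFieldType) (c : algC -> k) : is_subfield K -> c 1 = 1 ->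
  (forall x y, ring_of_integers K x -> ring_of_integers K y ->
     c (x + y) = c x + c y /\ c (x * y) = c x * c y) -> forall n, c n%:R = n%:R.
Proof.
move=> hK c1 cm; elim=> [|n IH]; first exact: cls_0 cm.
rewrite -addn1 !natrD -IH -c1; have [+ _] := cm n%:R 1 (roi_int hK n) (roi1 hK).
by rewrite !c1.
Qed.

(** A lift x of a generator of the unit group of the smaller residue field satisfies x^(n-1) = 1
    modulo P, hence modulo pZ. So N - 1 divides n - 1, and f0 divides the exponent of l in n. *)
Lemma residue_degree f0 N n : residue_card Z pZ N -> residue_card M P n -> N = (l ^ f0)%N ->
  exists f, n = (l ^ (f0 * f))%N /\ rel_degree M Z P pZ f.
Proof.
move=> rcZ rcM eN; have [s [ss [sO [sE sc]]]] := rcZ; have [t [st [tO [tE tc]]]] := rcM.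
rewrite -ss in sE; rewrite -st in tE.
have [k0 [c0 [ck0 c01 c0s c0e c0m]]] := residue_field nfZ pP pl Pl sO sE sc.
have [k [c [ck c1 cs ce cm]]] := residue_field nfM pPM pl PlM tO tE tc.
have [a ea] : exists a, #|k| = (l ^ a)%N.
  apply: card_pfield => //; rewrite -(cls_nat hM c1 cm) -(cls_0 hM cm).
  by apply/ce; [apply: (P_O pPM)|apply: roi0|rewrite subr0].
have N1 : (1 < N)%N by rewrite -ss -ck0 finRing_gt1.
have f00 : (0 < f0)%N by move: N1; rewrite eN; case: (f0).
have [g _ og] : exists2 g, g \in [set: {unit k0}] & #[g]%g = N.-1.
  have /cyclicP[g eg] : cyclic [set: {unit k0}] by apply: field_unit_group_cyclic.
  by exists g; rewrite ?inE // orderE -eg card_finField_unit ck0 ss.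
have [x Ox ex] := c0s (val g).
have xn0 : c x != 0.
  apply/eqP; rewrite -(cls_0 hM cm) => /(ce _ _ (OZM ZM Ox) (roi0 hM)); rewrite subr0 => Px.
  have : c0 x = c0 0 by apply/(c0e _ _ Ox (roi0 hZ)); rewrite subr0; apply/above.
  rewrite ex (cls_0 hZ c0m) => e0; have := valP g; by rewrite unitfE e0 eqxx.
have dv : (N.-1 %| n.-1)%N.
  rewrite -og order_dvdn; apply/eqP/val_inj.
  rewrite FinRing.val_unitX FinRing.val_unit1 -ex -(cls_X hZ c01 c0m) // -c01.
  apply/(c0e _ _ (roiX hZ _ Ox) (roi1 hZ)); apply/above.
    by apply: roiB; [|apply: roiX|apply: roi1].
  apply/(ce _ _ (roiX hM _ (OZM ZM Ox)) (roi1 hM)).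
  rewrite (cls_X hM c1 cm) ?c1; last exact: (OZM ZM).
  apply: (mulfI xn0); rewrite -exprS mulr1 prednK -st -ck ?expf_card //.
  exact: ltnW (finRing_gt1 k).
have en : n = (l ^ a)%N by rewrite -ea ck st.
have /dvdnP[f ef] : (f0 %| a)%N.
  by apply: (dvdn_exp_pred (prime_gt1 pl)) => //; rewrite -en -eN.
exists f; split; first by rewrite en ef mulnC.
by exists n, N; split => //; split => //; rewrite en eN -expnM ef mulnC.
Qed.

Variable pi : algC.
Hypotheses (Ppi : P pi) (pi0 : pi != 0) (npiV : ~ Rloc M P pi^-1).
Hypothesis mdiv : forall x, mloc M P x -> Rloc M P (x / pi).

(** Let e be the ramification index and x in pZ outside P^(e+1), so that ord x <= e. In x^i (1 -
    x^j) = l z with i <= n0 the factor 1 - x^j is a unit, and ord l <= i ord x. *)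
Lemma ord_l_bound n0 me (E : int) :
  (forall x, OZ x -> exists i e z, [/\ (i <= n0)%N, (0 < e)%N, OZ z &
     x ^+ i * (1 - x ^+ e) = l%:R * z]) ->
  (forall e, ram_index M P pZ e -> (e <= me)%N) -> ordP M P pi l%:R E ->
  0 < E <= (n0 * me)%N%:Z.
Proof.
move=> pig ram hE.
have O_ord := ord_O nfM pPM Ppi pi0 npiV mdiv.
have idp := idpow_iff nfM pPM pl PlM Ppi pi0 mdiv.
rewrite (m_ord_gt0 nfM pPM Ppi pi0 (mloc_P nfM pPM PlM) hE) /=.
have nR x n j : OM x -> ordP M P pi x n%:Z -> ~ Rloc M P (x / pi ^+ j) -> (n < j)%N.
  move=> Ox hx; rewrite ltnNge => h; apply/negP => jn; apply: h.
  rewrite exprnN; apply: (ord_R nfM pPM Ppi pi0 (n := n%:Z + 1 * (- j%:Z))).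
    apply: ordM => //; have h1 := ordX nfM pPM pi0 j (ord_pi nfM pPM pi0).
    by have := ordV nfM pPM h1; rewrite mulrN mul1r -exprnN.
  by lia.
have ex : exists j, dec (~ csubset pZ (idpow OM P j)).
  have Ol : OM l%:R by apply: (P_O pPM).
  have [n hn] := O_ord _ Ol (l_neq0 pl).
  exists n.+1; apply/decP => /(_ _ Pl) /idp [_ hR].
  have h1 := ordX nfM pPM pi0 n.+1 (ord_pi nfM pPM pi0).
  have h2 := ordM nfM pPM pi0 hn (ordV nfM pPM h1).
  by have := R_ord_ge0 nfM pPM Ppi pi0 hR h2; lia.
case: (ex_minnP ex) => -[|e] /decP hj min.
  by case: hj => x /(P_O pP) /(OZM ZM).
have he : (e <= me)%N.
  apply: ram; split => //; apply: NNPP => h.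
  by have := min e (introT (decP _) h); rewrite ltnn.
have [x hx] := not_all_ex_not _ _ hj; have [px nx] := imply_to_and _ _ hx.
have Ox := OZM ZM (P_O pP px).
have x0 : x != 0.
  apply/eqP => e0; apply: nx; rewrite e0; apply/idp; split; first exact: roi0.
  by rewrite mul0r; apply: Rloc_O => //; apply: roi0.
have [n hn] := O_ord _ Ox x0.
have ne : (n < e.+1)%N.
  by apply: (nR x n e.+1) => // hR; apply: nx; apply/idp.
have [i [j [z [i0 j0 Oz ez]]]] := pig x (P_O pP px).
have Px : P x by apply/above => //; apply: (P_O pP).
have u : unitP M P (1 - x ^+ j).
  apply: (unit_addm nfM pPM (unit1 nfM pPM)); apply: mloc_P => //; apply: (P_N nfM pPM).
  by rewrite -(prednK j0) exprS; apply: (P_Mr pPM) => //; apply: roiX.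
have h1 : ordP M P pi (x ^+ i * (1 - x ^+ j)) (n%:Z * i%:Z + 0).
  by apply: ordM => //; [apply: ordX|apply: ord_unit].
have z0 : z != 0.
  apply/eqP => z0; have := ord_neq0 nfM pPM h1; by rewrite ez z0 mulr0 eqxx.
have [nz hz] := O_ord _ (OZM ZM Oz) z0.
have h2 := ordM nfM pPM pi0 hE hz; rewrite -ez in h2.
have := ord_inj nfM pPM Ppi pi0 npiV h1 h2 => eE.
have : (n * i <= me * n0)%N by apply: leq_mul => //; rewrite -ltnS (leq_trans ne).
lia.
Qed.
End Extension.

(** If x had negative order at pZ, then 1/x would lie in the maximal ideal at pZ, hence in that of a
    prime above at which x is integral, and so would 1. *)
Lemma integral_Rloc (L Z pZ : cset) x : is_number_field Z -> is_prime_of Z pZ -> Z x ->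
  integral_at L Z pZ x -> Rloc Z pZ x.
Proof.
move=> nfZ pP Zx [M [nfM [ZM [ML [Mx h]]]]].
have [l pl Pl] := P_has_prime nfZ pP.
have [P [pPM ab]] := lying_over nfZ pP nfM ZM pl Pl.
have PlM : P l%:R by apply/ab => //; apply: (P_O pP).
have [pi Ppi [pi0 npiV mdiv]] := uniformizer nfZ pP pl Pl.
have [piM PpiM [piM0 npiVM mdivM]] := uniformizer nfM pPM pl PlM.
have RM := ord_ge0_Rloc nfM pPM pl PlM PpiM piM0 npiVM mdivM (h P pPM ab).
have [->|x0] := eqVneq x 0; first by apply: Rloc_O => //; apply: roi0 (proj1 nfZ).
have [n hn] := ord_exists nfZ pP Ppi pi0 npiV mdiv Zx x0.
have [n0|n0] := leP 0 n; first exact: (ord_R nfZ pP Ppi pi0 hn n0).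
have [a [b [Pa Ob nb e]]] : mloc Z pZ x^-1.
  by apply: (ord_m nfZ pP Ppi pi0 (ordV nfZ pP hn)); rewrite oppr_gt0.
case: (mloc_1 nfM pPM); rewrite -(divff x0) e; apply: mlocM => //.
exists a, b; split => //.
- by apply/ab => //; apply: (P_O pP).
- exact: (OZM ZM).
by move=> Pb; apply: nb; apply/ab.
Qed.

(** * A set of local integers containing the naturals *)

Section Sets.
Variables (l e : nat) (rs : seq nat).

(** The last condition forces a power of q dividing the order of l modulo r to divide the exponent
    of l in kappa, so that kappa does not disturb the order of v. For the norms found by pigeonhole
    it comes from [nform_logn] at l. *)
Definition kappa_ok r (kap : int) :=
  [&& kap != 0, (`|kap| <= kbound r.-2)%N & (l ^ logn l `|kap| == 1 %[mod r])%N].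

Definition Uset (K : cset) v := exists r f kap, [/\ r \in rs, (f %| cofexp e r)%N, kappa_ok r kap &
  exists2 x : 'I_r.-2.+1 -> algC, (forall i, K (x i)) & nform x = kap%:~R * v ^+ f].

Definition Cset (K : cset) b := exists vs : 'I_735 -> algC,
  (forall i, K (vs i) /\ Uset K (vs i)) /\ b = \prod_i vs i.

(** l gives positive order at P, the r in [rs] make b and x equal to 1 modulo each r, and 2 removes
    the prime 2 from the sieve. *)
Definition lam := (2 * l * \prod_(r <- rs) r)%N.

Definition X0 (D : nat) (K : cset) t := exists b x, [/\ Cset K b, Cset K x &
  (1 + lam%:R * t ^+ D) * b = 1 + lam%:R ^+ 2 * x].
End Sets.

Lemma no_multiple (Q E a : int) : 0 < E -> E < Q -> E + a * Q <> 0.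
Proof.
move=> E0 EQ; have [a0|a0] := leP 0 a; first by have := mulr_ge0 a0 (ltW (lt_trans E0 EQ)); lia.
have : a * Q <= -1 * Q by rewrite ler_wpM2r //; lia.
lia.
Qed.

Lemma logn_arith (n a b w c mf k B s : nat) : (n <= a + b + (w + c))%N -> (b <= mf)%N ->
  (c + k < s + n)%N -> k = (B + (a + mf) + s)%N -> (B <= w)%N.
Proof. lia. Qed.

Lemma lam_arith (E e : int) (m Q : nat) : 0 < E -> E <= m%:Z -> 0 <= e -> e <= E ->
  (4 * m < Q)%N -> 0 < e + E + 0 /\ (e + E + 0) * 2 < Q%:Z.
Proof. lia. Qed.

Lemma class_arith (E Q t : int) : 0 < E -> E * 2 < Q -> t < 0 ->
  [/\ 0 < Q, E < Q, 0 < E * 2 & E + t * Q < 0].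
Proof.
move=> E0 EQ t0; have Q0 : 0 < Q by lia.
have : t * Q <= -1 * Q by apply: ler_wpM2r; lia.
by split; lia.
Qed.

Section Integral.
Variables (Z pZ M P : cset) (l q k B s mf f0 N n0 me : nat) (rs : seq nat) (pi : algC).
Hypotheses (nfZ : is_number_field Z) (pP : is_prime_of Z pZ).
Hypotheses (nfM : is_number_field M) (ZM : csubset Z M).
Hypotheses (pPM : is_prime_of M P) (above : lies_above Z P pZ).
Hypotheses (pl : prime l) (Pl : pZ l%:R) (pq : prime q).
Hypotheses (rcZ : residue_card Z pZ N) (eN : N = (l ^ f0)%N).
Hypothesis mfP : forall f, rel_degree M Z P pZ f -> (logn q f <= mf)%N.
Hypothesis meP : forall e, ram_index M P pZ e -> (e <= me)%N.
Hypothesis pig : forall x, ring_of_integers Z x -> exists i e z,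
  [/\ (i <= n0)%N, (0 < e)%N, ring_of_integers Z z & x ^+ i * (1 - x ^+ e) = l%:R * z].
Hypotheses (Ppi : P pi) (pi0 : pi != 0) (npiV : ~ Rloc M P pi^-1).
Hypothesis mdiv : forall x, mloc M P x -> Rloc M P (x / pi).
Hypothesis prs : forall r, r \in rs -> [/\ prime r, r != l, (q ^ k %| r.-1)%N &
  exists n, (forall m, (l ^ m = 1 %[mod r])%N -> (q ^ n %| m)%N) /\ ~~ (q ^ (s + n) %| r.-1)%N].
Hypothesis kB : (k = B + (logn q f0 + mf) + s)%N.
Hypothesis QB : (4 * (n0 * me) < q ^ B)%N.
Let hM := proj1 nfM.
Local Notation OM := (ring_of_integers M).
Local Notation ord := (ordP M P pi).

Let PlM : P l%:R. Proof. by apply/above => //; apply: (P_O pP). Qed.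

Lemma ord_int E (kap : int) : ord l%:R E -> kap != 0 ->
  ord kap%:~R (E * (logn l `|kap|)%N%:Z).
Proof.
move=> hE k0; have n0' : (0 < `|kap|)%N by rewrite absz_gt0.
have [u cu eu] := pfactor_coprime pl n0'.
have hu : ord u%:R 0.
  by apply: ord_unit; apply: (unit_nat nfM pPM pl PlM); rewrite coprime_sym.
have h : ord (`|kap|%N)%:R (E * (logn l `|kap|)%N%:Z).
  rewrite eu natrM natrX -[X in ord _ X]add0r -eu; apply: ordM => //; exact: ordX.
rewrite (intEsg kap) rmorphM /= -pmulrn abszM absz_nat.
case: sgzP k0 => // _ _; rewrite ?mulrN1z ?mulN1r ?mul1r ?mul1n //=.
  exact: (ordN nfM pPM).
Qed.

(** With M = ord kappa + f ord v + t (r - 1), q^n divides the residue degree over l times M, and it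
    divides the first and last terms. So it divides f0 f' f ord v. Here f0 f' has at most
    [logn q f0 + mf] factors q, and f, a divisor of (r - 1)/q^k, has fewer than s + n - k; the
    choice of k leaves at least B for ord v. *)
Lemma U_ord v : M v -> Uset l (q ^ k) rs M v -> v != 0 -> exists j, ord v (j * (q ^ B)%N%:Z).
Proof.
move=> Mv [r [f [kap [rr fM /and3P[k0 _ /eqP lk] [x Mx ex]]]]] v0.
have [pr rl qr [n [ln sn]]] := prs rr.
have er : r.-2.+2 = r by have := prime_gt1 pr; case: (r) => [|[]].
have [E hE] : exists E, ord l%:R E.
  by apply: ord_exists => //; [apply: sf_nat|apply: l_neq0 pl].
have [w hw] := ord_exists nfM pPM Ppi pi0 npiV mdiv Mv v0.
exists (w %/ (q ^ B)%N)%Z; suff dv : ((q ^ B)%N %| w)%Z by rewrite divzK.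
have hk := ord_int hE k0.
have hN : ord (nform x) (E * (logn l `|kap|)%N%:Z + w * f%:Z).
  by rewrite ex; apply: ordM => //; apply: ordX.
have [n' rcM] := residue_card_exists nfM pPM pl PlM.
have [f' [en' rd]] := residue_degree nfZ pP nfM ZM pPM above pl Pl rcZ rcM eN.
have [t [st [tO [tE tc]]]] := rcM; rewrite -st in tE.
have [kk [c [ck c1 cs ce cm]]] := residue_field nfM pPM pl PlM tO tE tc.
rewrite -er in pr rl.
have [Mn [t' [eMn hMn]]] := local_norm_ord nfM pPM pl PlM Ppi pi0 npiV mdiv c1 cs ce cm pr rl Mx hN.
rewrite er ck st en' -expnM in hMn; rewrite er in pr rl.
have a0 : (0 < f0 * f')%N.
  have := finRing_gt1 kk; rewrite ck st en'; by case: (f0 * f')%N => //; rewrite expn0.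
have d1 : (q ^ n %| f0 * f' * Mn)%N := ln _ hMn.
have d2 : (q ^ n %| logn l `|kap|)%N := ln _ lk.
have d3 : (q ^ n %| r.-1)%N.
  apply: ln; rewrite -(totient_prime pr); apply: Euler_exp_totient.
  by rewrite prime_coprime // dvdn_prime2 // eq_sym.
have [->|w0] := eqVneq w 0; first by rewrite dvdz0.
have d4 : ((q ^ n)%N %| (f0 * f')%N%:Z * (w * f%:Z))%Z.
  have -> : (f0 * f')%N%:Z * (w * f%:Z) = (f0 * f' * Mn)%N%:Z
     - (f0 * f')%N%:Z * t'%:Z * (r.-1)%N%:Z - (f0 * f')%N%:Z * E * (logn l `|kap|)%N%:Z.
    rewrite (PoszM (f0 * f')) -eMn (_ : r.-2.+1 = r.-1) ?PoszM; first by ring.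
    by rewrite -[in RHS]er.
  by rewrite !rpredB ?dvdz_mull //.
have r1 : (0 < r.-1)%N by rewrite -subn1 subn_gt0 prime_gt1.
have qk0 : (0 < q ^ k)%N by rewrite expn_gt0 prime_gt0.
have hc : (0 < cofexp (q ^ k) r)%N by rewrite divn_gt0 // dvdn_leq.
have f1 : (0 < f)%N := dvdn_gt0 hc fM.
have w1 : (0 < `|w|)%N by rewrite absz_gt0.
have f0' : (0 < f0)%N by move: a0; rewrite muln_gt0 => /andP[].
have f1' : (0 < f')%N by move: a0; rewrite muln_gt0 => /andP[].
rewrite dvdzE !abszM !absz_nat /= pfactor_dvdn ?muln_gt0 ?f0' ?f1' ?f1 ?w1 // in d4.
rewrite dvdzE absz_nat pfactor_dvdn //.
rewrite !lognM ?muln_gt0 ?w1 ?f0' ?f1' // in d4.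
have m1 := mfP rd.
have m2 : (logn q f + k < s + n)%N.
  have h1 : (logn q f <= logn q (cofexp (q ^ k) r))%N.
    exact: dvdn_leq_log.
  have h2 : logn q r.-1 = (logn q (cofexp (q ^ k) r) + k)%N.
    by rewrite -{1}(divnK qr) lognM // pfactorK.
  by move: sn; rewrite pfactor_dvdn // -ltnNge h2; apply: leq_ltn_trans; rewrite leq_add2r.
exact: (logn_arith d4 m1 m2 kB).
Qed.

Lemma C_ord b : Cset l (q ^ k) rs M b -> b != 0 -> exists j, ord b (j * (q ^ B)%N%:Z).
Proof.
move=> [vs [hvs ->]] b0.
have : forall i, vs i != 0 by move=> i; move/prodf_neq0: b0; apply.
move=> v0; apply: (big_ind (fun b => exists j, ord b (j * (q ^ B)%N%:Z))).
- by exists 0; rewrite mul0r; apply: ord_unit; apply: unit1.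
- by move=> x y [i hi] [j hj]; exists (i + j); rewrite mulrDl; apply: ordM.
by move=> i _; have [h1 h2] := hvs i; apply: U_ord.
Qed.

(** The factor 2 counts only if l = 2, so ord lam <= 2 ord l <= 2 n0 me; requiring twice this to be
    below q^B gives the 4 in [QB]. *)
Lemma lam_ord : exists2 E', ord (lam l rs)%:R E' & 0 < E' /\ E' * 2 < (q ^ B)%N%:Z.
Proof.
have [E hE] : exists E, ord l%:R E.
  by apply: ord_exists => //; [apply: sf_nat|apply: l_neq0 pl].
have := ord_l_bound pP nfM ZM pPM above pl Pl Ppi pi0 npiV mdiv pig meP hE.
move=> /andP[E0 E1].
have hr : ord (\prod_(r <- rs) r)%N%:R 0.
  apply: ord_unit; apply: (unit_nat nfM pPM pl PlM).
  rewrite big_seq; apply: (big_ind (fun m => coprime m l)) => [|x y|r /prs [pr rl _ _]].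
  - exact: coprime1n.
  - by move=> hx hy; rewrite coprimeMl hx.
  by rewrite prime_coprime // dvdn_prime2.
have [e l2] : exists2 E2, ord 2%:R E2 & 0 <= E2 <= E.
  have [<-|n2] := eqVneq l 2%N; first by exists E; rewrite // lexx ltW.
  exists 0; last by rewrite lexx ltW.
  apply: ord_unit; apply: (unit_nat nfM pPM pl PlM).
  by rewrite prime_coprime // dvdn_prime2 // eq_sym.
move=> /andP[e0 e1]; exists (e + E + 0).
  by rewrite /lam !natrM; apply: ordM => //; apply: ordM.
exact: (lam_arith E0 E1 e0 e1 QB).
Qed.

Lemma X0_integral t : M t -> X0 l (q ^ k) rs (q ^ B) M t -> Rloc M P t.
Proof.
move=> Mt [b [x [hb hx eq]]]; apply: NNPP => nR.
have [E' hE [E0 EQ]] := lam_ord.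
have t0 : t != 0.
  by apply: contra_notN nR => /eqP ->; apply: Rloc_O => //; apply: roi0.
have [tau ht] := ord_exists nfM pPM Ppi pi0 npiV mdiv Mt t0.
have tau0 : tau < 0 by rewrite ltNge; apply/negP => h; apply: nR; apply: (ord_R nfM pPM Ppi pi0 ht h).
set Q := (q ^ B)%N%:Z in EQ *.
have [Q0 EQ1 E20 neg] := class_arith E0 EQ tau0.
have o1 : ord 1 0 by apply: ord_unit; apply: unit1.
have hl : ord ((lam l rs)%:R * t ^+ (q ^ B)) (E' + tau * Q) by apply: ordM => //; apply: ordX.
have hh : ord (1 + (lam l rs)%:R * t ^+ (q ^ B)) (E' + tau * Q).
  by rewrite addrC; apply: (ordD_lt nfM pPM Ppi pi0 hl o1).
have hl2 : ord ((lam l rs)%:R ^+ 2) (E' * 2) by apply: ordX.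
have inj := ord_inj nfM pPM Ppi pi0 npiV.
have nb j : E' + tau * Q + j * Q <> 0.
  by rewrite -addrA -mulrDl; apply: no_multiple.
have nx j : E' * 2 + j * Q <> 0 by apply: no_multiple.
(* If b or x is 0 only two terms remain, and their orders still differ modulo Q. *)
have [b0|b0] := eqVneq b 0.
  move: eq; rewrite b0 mulr0 => /esym /eqP; rewrite addrC addr_eq0 => /eqP e1.
  have x0 : x != 0 by apply: contra_eqN e1 => /eqP ->; rewrite mulr0 eq_sym oppr_eq0 oner_eq0.
  have [j hj] := C_ord hx x0; apply: (nx j).
  by apply: (inj _ _ _ (ordM nfM pPM pi0 hl2 hj)); rewrite e1; apply: (ordN nfM pPM).
have [j hj] := C_ord hb b0; have hhb := ordM nfM pPM pi0 hh hj.
have [x0|x0] := eqVneq x 0.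
  by apply: (nb j); apply: (inj _ _ _ hhb); rewrite eq x0 mulr0 addr0.
have [j' hj'] := C_ord hx x0; have hlx := ordM nfM pPM pi0 hl2 hj'.
rewrite eq in hhb.
case: (ltgtP (E' * 2 + j' * Q) 0) => lt; last exact: (nx j' lt).
  have := inj _ _ _ hhb; rewrite addrC => /(_ _ (ordD_lt nfM pPM Ppi pi0 hlx o1 lt)) e1.
  apply: (@no_multiple Q E' (j' - (tau + j)) E0 EQ1).
  have -> : E' + (j' - (tau + j)) * Q = (E' * 2 + j' * Q) - (E' + tau * Q + j * Q) by ring.
  by rewrite -e1 subrr.
by apply: (nb j); apply: (inj _ _ _ hhb (ordD_lt nfM pPM Ppi pi0 o1 hlx lt)).
Qed.
End Integral.

Lemma nform_1 (K : comNzRingType) d : nform (fun i : 'I_d.+1 => (i == ord0)%:R : K) = 1.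
Proof.
rewrite /nform /nform_mx (bigD1 ord0) //= expr0 scale1r big1 ?addr0 ?det1 // => i /negPf ->.
by rewrite scale0r.
Qed.

(** * The natural numbers belong to X0 *)

Section Naturals.
Variables (K : cset) (l e : nat) (rs : seq nat).
Hypotheses (hK : is_subfield K) (pl : prime l).
Hypothesis prs : forall r, r \in rs -> prime r /\ r != l.

Lemma prime_succ2 r : prime r -> r.-2.+2 = r.
Proof. by case: r => [|[]]. Qed.

Lemma kbound_gt0 d : prime d.+2 -> l != d.+2 -> (0 < kbound d)%N.
Proof.
move=> pd ld; have [f [x [kap [_ _ _ k0]]]] := norm_of_prime_power pd pl ld.
by apply: leq_trans; rewrite absz_gt0.
Qed.

Lemma lam_dvd r : r \in rs -> (r %| lam l rs)%N.
Proof. by move=> h; rewrite /lam dvdn_mull // (big_rem r) //= dvdn_mulr. Qed.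

Lemma U_one r : r \in rs -> Uset l e rs K 1.
Proof.
move=> rr; have [pr rl] := prs rr; have er := prime_succ2 pr.
exists r, 1%N, 1; split => //.
  by rewrite /kappa_ok oner_eq0 /= logn1 expn0 eqxx andbT kbound_gt0 ?er // eq_sym.
by exists (fun i => (i == ord0)%:R); [move=> i; apply: sf_nat|rewrite nform_1 mul1r expr1n].
Qed.

Lemma U_good p : prime p -> ~~ (p %| lam l rs)%N -> ~~ badc e rs p -> Uset l e rs K p%:R.
Proof.
move=> pp np /allPn[r rr]; have [pr rl] := prs rr; have er := prime_succ2 pr.
have pr' : p != r by apply: contraNneq np => ->; apply: lam_dvd.
have lp : l != p by apply: contraNneq np => <-; rewrite /lam dvdn_mulr // dvdn_mull.
rewrite /badr negb_and negbK dvdn_prime2 // eq_sym (negPf pr') negbK => /eqP h.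
rewrite -er in pr pr'; rewrite -er in rl.
have [f [x [kap [f0 fM ex k0 kb]]]] := norm_of_prime_power pr pp pr'.
exists r, f, kap; split => //; first by apply: fM; rewrite er.
  rewrite /kappa_ok k0 kb /=.
  have lr : l != r.-2.+2 by rewrite eq_sym.
  have n0 : nform x != 0 by rewrite ex mulf_neq0 // expf_neq0 // eqz_nat -lt0n prime_gt0.
  (* The factor p^f is prime to l, so the norm and kappa have the same exponent of l. *)
  have := nform_logn pl pr lr n0; rewrite ex abszM abszX absz_nat lognM ?absz_gt0 //; last first.
    by rewrite expn_gt0 prime_gt0.
  by rewrite lognX (lognE l p) pl prime_gt0 //= dvdn_prime2 // (negPf lp) muln0 addn0 er => /eqP.
exists (fun i => (x i)%:~R) => [i|]; first exact: sf_int.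
by rewrite -(map_nform (intmul 1 : {rmorphism int -> algC})) ex rmorphM rmorphXn.
Qed.

Lemma C_good f : (0 < size rs)%N -> (size f <= 735)%N ->
  all (fun p => [&& prime p, ~~ (p %| lam l rs)%N & ~~ badc e rs p]) f ->
  Cset l e rs K (\prod_(p <- f) p)%N%:R.
Proof.
move=> rs0 sf /allP hf; exists (fun i => (nth 1%N f i)%:R); split=> [i|].
  split; first exact: sf_nat.
  have [h|h] := ltnP i (size f); last first.
    by rewrite nth_default //; apply: (@U_one (nth 0%N rs 0)); apply: mem_nth.
  by have /and3P[h1 h2 h3] := hf _ (mem_nth 1%N h); apply: U_good.
have -> : \prod_(p <- f) p = (\prod_(p <- f ++ nseq (735 - size f) 1) p)%N.
  by rewrite big_cat /= [X in (_ * X)%N]big1_seq ?muln1 // => i /andP[_ /nseqP[]].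
rewrite natr_prod (big_nth 1%N) size_cat size_nseq subnKC // big_mkord.
apply: eq_bigr => i _; rewrite nth_cat; case: ltnP => // h.
by rewrite nth_nseq if_same nth_default.
Qed.

Lemma X0_nat D n : (0 < D)%N -> uniq rs -> all (fun r => e %| r.-1)%N rs ->
  (cS * e.-1 ^ size rs <= e ^ size rs)%N -> (0 < size rs)%N -> X0 l e rs D K n%:R.
Proof.
move=> D0 urs ers few rs0.
have prs' : all prime rs by apply/allP => r /prs[].
have lam0 : (0 < lam l rs)%N.
  rewrite /lam !muln_gt0 /= prime_gt0 //= big_seq; apply: prodn_cond_gt0 => r.
  by move=> /prs[/prime_gt0].
have l2 : (2 %| lam l rs)%N by rewrite /lam -mulnA dvdn_mulr.
have lam1 : (1 < lam l rs)%N by apply: leq_trans (dvdn_leq lam0 l2).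
have hm : ((1 + lam l rs * n ^ D) = 1 %[mod lam l rs])%N by rewrite addnC mulnC modnMDl.
have [b [x [eb hb]]] := good_pair urs prs' ers few rs0 lam1 l2 lam_dvd (ltn0Sn _) hm.
exists b%:R, x%:R; split.
- by have [f [sf gf ->]] := hb b (or_introl erefl); apply: C_good.
- by have [f [sf gf ->]] := hb x (or_intror erefl); apply: C_good.
move/(congr1 (fun m => m%:R : algC)): eb; rewrite natrM !natrD (natrM _ (_ ^ _)%N) (natrM _ (lam _ _)) => <-.
by rewrite -!natrX -(natrM _ (lam _ _)) -[in RHS]nat1r.
Qed.
End Naturals.

(** * Choice of the primes r and of the exponents *)

Lemma bernoulli_nat m R : (R.+1 * m ^ R <= m.+1 ^ R.+1)%N.
Proof.
elim: R => [|R IH]; first by rewrite mul1n expn0 expn1.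
rewrite mulSn [in leqRHS]expnS [in leqRHS]mulSn leq_add //.
  by rewrite leq_exp2r.
by rewrite [(m ^ _.+1)%N]expnS mulnCA leq_mul2l IH orbT.
Qed.

Lemma few_exists C e : (1 < e)%N -> exists2 R, (0 < R)%N & (C * e.-1 ^ R <= e ^ R)%N.
Proof.
case: e => // m _; exists (C * m).+1 => //=.
apply: leq_trans (bernoulli_nat m (C * m)).
by rewrite expnS mulnA leq_mul2r leqnSn orbT.
Qed.

(** Strictly increasing exponents n give distinct primes: a repetition would make q^(n+1) divide (q
    - 1) q^n. *)
Lemma special_primes l q : prime l -> prime q -> (2 < q)%N -> l != q ->
  exists s, forall k R, (1 < k)%N -> exists rs, [/\ uniq rs, size rs = R & forall r, r \in rs ->
    [/\ prime r, r != l, (q ^ k %| r.-1)%N & exists n,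
      (forall m, (l ^ m = 1 %[mod r])%N -> (q ^ n %| m)%N) /\ ~~ (q ^ (s + n) %| r.-1)%N]].
Proof.
move=> pl pq q2 lq; have [s hs] := special_prime pl pq q2 lq; exists s => k R k1.
suff [rs [urs srs hrs]] : exists rs, [/\ uniq rs, size rs = R & forall r, r \in rs ->
    exists n, [/\ (k <= n < k + R)%N, [/\ prime r, r != l & (l ^ (q.-1 * q ^ n) = 1 %[mod r])%N],
      (forall m, (l ^ m = 1 %[mod r])%N -> (q ^ n %| m)%N) & ~~ (q ^ (s + n) %| r.-1)%N]].
  exists rs; split => // r /hrs[n [/andP[kn _] [pr rl _] hn sn]]; split => //; last by exists n.
  apply: dvdn_trans (dvdn_exp2l q kn) _; apply: hn.
  rewrite -(totient_prime pr); apply: Euler_exp_totient.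
  by rewrite prime_coprime // dvdn_prime2 // eq_sym.
elim: R => [|R [rs [urs srs hrs]]]; first by exists [::].
have kR : (1 < k + R)%N by apply: leq_trans (leq_addr _ _).
have [r [pr rl hr er sr]] := hs _ kR.
exists (r :: rs); split; rewrite /= ?srs ?urs ?andbT //.
  apply/negP => /hrs[n [/andP[_ nR] [_ _ en] _ _]].
  have := dvdn_trans (dvdn_exp2l q nR) (hr _ en).
  rewrite expnS dvdn_pmul2r ?expn_gt0 ?prime_gt0 // => /dvdn_leq.
  by move: (prime_gt1 pq); clear; lia.
move=> r'; rewrite inE => /orP[/eqP ->|/hrs[n [/andP[n1 n2] h1 h2 h3]]].
  by exists (k + R)%N; rewrite leq_addr addnS ltnSn.
by exists n; rewrite n1 addnS ltnS ltnW.
Qed.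

(** The order of the choices avoids a circle: s depends on l and q alone, B on the bound c, then e =
    q^k is fixed, and only then the number of primes r that makes bad classes rare enough for this
    e. *)
Lemma sieve_parameters l q mf0 c : prime l -> prime q -> (2 < q)%N -> l != q ->
  exists k B s rs, [/\ (k = B + mf0 + s)%N, (c < q ^ B)%N, uniq rs,
    (0 < size rs)%N /\ (cS * (q ^ k).-1 ^ size rs <= (q ^ k) ^ size rs)%N &
    forall r, r \in rs -> [/\ prime r, r != l, (q ^ k %| r.-1)%N & exists n,
      (forall m, (l ^ m = 1 %[mod r])%N -> (q ^ n %| m)%N) /\ ~~ (q ^ (s + n) %| r.-1)%N]].
Proof.
move=> pl pq q2 lq; have [s hs] := special_primes pl pq q2 lq.
have q1 := prime_gt1 pq; pose B := c.+2.
have k1 : (1 < B + mf0 + s)%N by [].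
have e1 : (1 < q ^ (B + mf0 + s))%N by rewrite -(exp1n (B + mf0 + s)) ltn_exp2r // ltnW.
have [R R0 hR] := few_exists cS e1; have [rs [urs srs hrs]] := hs _ R k1.
exists (B + mf0 + s)%N, B, s, rs; split => //; last by rewrite srs.
by apply: leq_trans (ltn_expl _ q1); rewrite ltnW.
Qed.

From mathcomp Require Import mpoly.

(** * Diophantine sets over a field with an anisotropic form *)

(** Infinite sequences, so that families of witnesses can be interleaved without counting them; only
    [dio_diophantine] extracts a finite number of variables. *)
Definition env := nat -> algC.

(* [PE i] is the [i]-th parameter, [PW i] the [i]-th existential witness. *)
Inductive tm := PE of nat | PW of nat | PC of algC | PA of tm & tm | PM of tm & tm.

Fixpoint ev (e w : env) t := match t with
  | PE i => e i | PW i => w i | PC a => a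
  | PA t u => ev e w t + ev e w u | PM t u => ev e w t * ev e w u end.

Fixpoint sub (f g : nat -> tm) t := match t with
  | PE i => f i | PW i => g i | PC a => PC a
  | PA t u => PA (sub f g t) (sub f g u) | PM t u => PM (sub f g t) (sub f g u) end.

Lemma ev_sub e w f g t : ev e w (sub f g t) = ev (fun i => ev e w (f i)) (fun i => ev e w (g i)) t.
Proof. by elim: t => //= t -> u ->. Qed.

Lemma ev_ext e w e' w' t : (forall i, e i = e' i) -> (forall i, w i = w' i) -> ev e w t = ev e' w' t.
Proof. by move=> h1 h2; elim: t => //= t -> u ->. Qed.

Section Dio.
Variable L : cset.
Hypothesis hL : is_subfield L.

Definition Lval (e : env) := forall i, L (e i).

Fixpoint okt t := match t with
  | PC a => L a | PA t u => okt t /\ okt u | PM t u => okt t /\ okt u | _ => True end.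

Lemma okt_sub f g t : (forall i, okt (f i)) -> (forall i, okt (g i)) -> okt t -> okt (sub f g t).
Proof. by move=> h1 h2; elim: t => //= t IH u IH' [h3 h4]; split; auto. Qed.

Lemma ev_L e w t : Lval e -> Lval w -> okt t -> L (ev e w t).
Proof.
move=> he hw; elim: t => //= t IH u IH' [h1 h2]; first by apply: sfD; auto.
by apply: sfM; auto.
Qed.

Definition isP (F : env -> env -> algC) := exists2 t, okt t & forall e w, ev e w t = F e w.

Lemma isP_E i : isP (fun e _ => e i). Proof. by exists (PE i). Qed.
Lemma isP_W i : isP (fun _ w => w i). Proof. by exists (PW i). Qed.
Lemma isP_C a : L a -> isP (fun _ _ => a). Proof. by exists (PC a). Qed.
Lemma isP_D F G : isP F -> isP G -> isP (fun e w => F e w + G e w).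
Proof. by move=> [t ht et] [u hu eu]; exists (PA t u) => // e w /=; rewrite et eu. Qed.
Lemma isP_M F G : isP F -> isP G -> isP (fun e w => F e w * G e w).
Proof. by move=> [t ht et] [u hu eu]; exists (PM t u) => // e w /=; rewrite et eu. Qed.
Lemma isP_eq F G : isP F -> (forall e w, F e w = G e w) -> isP G.
Proof. by move=> [t ht et] h; exists t => // e w; rewrite et. Qed.
Lemma isP_N F : isP F -> isP (fun e w => - F e w).
Proof.
move=> hF; have h1 : L (-1) by apply: sfN => //; apply: sf1.
by apply: (isP_eq (isP_M (isP_C h1) hF)) => e w; rewrite mulN1r.
Qed.
Lemma isP_B F G : isP F -> isP G -> isP (fun e w => F e w - G e w).
Proof. by move=> hF hG; apply: isP_D => //; apply: isP_N. Qed.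
Lemma isP_sum (I : Type) (s : seq I) (F : I -> env -> env -> algC) : (forall i, isP (F i)) ->
  isP (fun e w => \sum_(i <- s) F i e w).
Proof.
move=> h; elim: s => [|i s IH].
  by apply: (isP_eq (isP_C (sf0 hL))) => e w; rewrite big_nil.
by apply: (isP_eq (isP_D (h i) IH)) => e w; rewrite big_cons.
Qed.
Lemma isP_prod (I : Type) (s : seq I) (F : I -> env -> env -> algC) : (forall i, isP (F i)) ->
  isP (fun e w => \prod_(i <- s) F i e w).
Proof.
move=> h; elim: s => [|i s IH].
  by apply: (isP_eq (isP_C (sf1 hL))) => e w; rewrite big_nil.
by apply: (isP_eq (isP_M (h i) IH)) => e w; rewrite big_cons.
Qed.
Lemma isP_X F n : isP F -> isP (fun e w => F e w ^+ n).
Proof.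
move=> h; elim: n => [|n IH]; first by apply: (isP_eq (isP_C (sf1 hL))) => e w; rewrite expr0.
by apply: (isP_eq (isP_M h IH)) => e w; rewrite exprS.
Qed.

Definition dio (A : env -> Prop) := exists2 F, isP F &
  forall e, Lval e -> (A e <-> exists2 w, Lval w & F e w = 0).

Lemma dio_iff A B : dio A -> (forall e, Lval e -> (A e <-> B e)) -> dio B.
Proof. by move=> [F hF h] AB; exists F => // e he; rewrite -AB // h. Qed.

Lemma isP_sub F (f g : nat -> env -> env -> algC) : isP F -> (forall i, isP (f i)) ->
  (forall i, isP (g i)) -> isP (fun e w => F (fun i => f i e w) (fun i => g i e w)).
Proof.
move=> [t ht et] hf hg.
have cf i : exists u, okt u /\ forall e w, ev e w u = f i e w by have [u] := hf i; exists u.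
have cg i : exists u, okt u /\ forall e w, ev e w u = g i e w by have [u] := hg i; exists u.
pose u i := sval (constructive_indefinite_description _ (cf i)).
pose v i := sval (constructive_indefinite_description _ (cg i)).
have hu i : okt (u i) /\ forall e w, ev e w (u i) = f i e w.
  by rewrite /u; case: constructive_indefinite_description.
have hv i : okt (v i) /\ forall e w, ev e w (v i) = g i e w.
  by rewrite /v; case: constructive_indefinite_description.
exists (sub u v t); first by apply: okt_sub => // i; [case: (hu i)|case: (hv i)].
move=> e w; rewrite ev_sub -et; apply: ev_ext => i; [by case: (hu i)|by case: (hv i)].
Qed.

Lemma Lval_isP F e w : isP F -> Lval e -> Lval w -> L (F e w).
Proof. by move=> [t ht <-] he hw; apply: ev_L. Qed.

Lemma dio_sub A (f : nat -> env -> algC) : dio A -> (forall i, isP (fun e _ => f i e)) ->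
  dio (fun e => A (fun i => f i e)).
Proof.
move=> [F hF h] hf; exists (fun e w => F (fun i => f i e) w).
  exact: (isP_sub hF hf isP_W).
by move=> e he; apply: h => i; apply: (Lval_isP (w := e) (hf i)).
Qed.

Definition mix (x e : env) : env := fun i => if odd i then e i./2 else x i./2.

Lemma Lval_mix x e : Lval x -> Lval e -> Lval (mix x e).
Proof. by move=> hx he i; rewrite /mix; case: odd. Qed.

Definition evens (w : env) : env := fun i => w i.*2.
Definition odds (w : env) : env := fun i => w i.*2.+1.

Lemma mix_evens x e i : evens (mix x e) i = x i.
Proof. by rewrite /evens /mix odd_double doubleK. Qed.
Lemma mix_odds x e i : odds (mix x e) i = e i.
Proof. by rewrite /odds /mix /= odd_double /= uphalf_double. Qed.

Lemma isP_ext F e w e' w' : isP F -> (forall i, e i = e' i) -> (forall i, w i = w' i) ->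
  F e w = F e' w'.
Proof. by move=> [t _ et] h1 h2; rewrite -!et; apply: ev_ext. Qed.

Lemma dio_ex A : dio A -> dio (fun e => exists2 x, Lval x & A (mix x e)).
Proof.
move=> [F hF h]; exists (fun e w => F (mix (evens w) e) (odds w)).
  apply: (isP_sub hF) => i; last exact: isP_W.
  by rewrite /mix; case: odd; [apply: isP_E|apply: isP_W].
move=> e he; split=> [[x hx /(h _ (Lval_mix hx he)) [w hw eF]]|[w hw eF]].
  exists (mix x w); first exact: Lval_mix.
  rewrite -eF; apply: (isP_ext hF) => i; last exact: mix_odds.
  by rewrite /mix; case: odd => //; exact: mix_evens.
exists (evens w) => [i|]; first exact: hw.
by apply/h; [apply: Lval_mix => // i; apply: hw|exists (odds w) => // i; apply: hw].
Qed.

Lemma dio_eq F : isP F -> dio (fun e => exists2 w, Lval w & F e w = 0).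
Proof. by exists F. Qed.

Lemma dio_eq0 (f g : env -> algC) : isP (fun e _ => f e) -> isP (fun e _ => g e) ->
  dio (fun e => f e = g e).
Proof.
move=> hf hg; exists (fun e _ => f e - g e); first exact: isP_B.
move=> e he; split=> [->|[_ _ /eqP]]; last by rewrite subr_eq0 => /eqP.
by exists e; rewrite ?subrr.
Qed.

Lemma dio_or A B : dio A -> dio B -> dio (fun e => A e \/ B e).
Proof.
move=> [F hF hA] [G hG hB]; exists (fun e w => F e w * G e w); first exact: isP_M.
move=> e he; split=> [[/(hA e he)|/(hB e he)] [w hw e0]|[w hw /eqP]].
- by exists w; rewrite ?e0 ?mul0r.
- by exists w; rewrite ?e0 ?mulr0.
by rewrite mulf_eq0 => /orP[] /eqP e0; [left; apply/hA|right; apply/hB] => //; exists w.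
Qed.

Lemma dio_False : dio (fun=> False).
Proof.
exists (fun _ _ => 1); first by apply: isP_C; apply: sf1.
by move=> e he; split => // -[w _ /eqP]; rewrite oner_eq0.
Qed.

Lemma dio_exists (I : eqType) (s : seq I) (A : I -> env -> Prop) :
  (forall i, i \in s -> dio (A i)) -> dio (fun e => exists2 i, i \in s & A i e).
Proof.
elim: s => [|i s IH] h; first by apply: (dio_iff dio_False) => e _; split => // -[].
have hs : dio (fun e => exists2 i, i \in s & A i e).
  by apply: IH => j js; apply: h; rewrite inE js orbT.
apply: (dio_iff (dio_or (h i (mem_head _ _)) hs)) => e _; split.
  by move=> [hi|[j js hj]]; [exists i; rewrite ?mem_head|exists j; rewrite // inE js orbT].
by move=> [j]; rewrite inE => /orP[/eqP ->|js] hj; [left|right; exists j].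
Qed.

Section Conj.
Variables (D : nat) (c : algC).
Hypotheses (D0 : (0 < D)%N) (Lc : L c)
  (aniso : forall a b, L a -> L b -> a ^+ D = c * b ^+ D -> a = 0 /\ b = 0).

(** By anisotropy F^D - c G^D vanishes on L exactly when F and G both do; the two families of
    witnesses are interleaved. *)
Lemma dio_and A B : dio A -> dio B -> dio (fun e => A e /\ B e).
Proof.
move=> [F hF hA] [G hG hB].
have hF' : isP (fun e w => F e (evens w)).
  by apply: (isP_sub hF) => i; [apply: isP_E|apply: isP_W].
have hG' : isP (fun e w => G e (odds w)).
  by apply: (isP_sub hG) => i; [apply: isP_E|apply: isP_W].
exists (fun e w => F e (evens w) ^+ D - c * G e (odds w) ^+ D).
  by apply: isP_B; [apply: isP_X|apply: isP_M; [apply: isP_C|apply: isP_X]].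
move=> e he; split=> [[/(hA e he) [w hw eF] /(hB e he) [w' hw' eG]]|[w hw /eqP]].
  exists (mix w w'); first exact: Lval_mix.
  rewrite (isP_ext (w' := w) hF (fun=> erefl) (mix_evens w w')).
  rewrite (isP_ext (w' := w') hG (fun=> erefl) (mix_odds w w')).
  by rewrite eF eG expr0n gtn_eqF // mulr0 subr0.
rewrite subr_eq0 => /eqP /aniso [].
- by apply: (Lval_isP hF he) => i; apply: hw.
- by apply: (Lval_isP hG he) => i; apply: hw.
move=> eF eG; split; [apply/hA|apply/hB] => //.
  by exists (evens w) => // i; apply: hw.
by exists (odds w) => // i; apply: hw.
Qed.

Lemma dio_True : dio (fun=> True).
Proof.
exists (fun _ _ => 0); first by apply: isP_C; apply: sf0.
by move=> e he; split => // _; exists e.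
Qed.

Lemma dio_forall (I : eqType) (s : seq I) (A : I -> env -> Prop) :
  (forall i, i \in s -> dio (A i)) -> dio (fun e => forall i, i \in s -> A i e).
Proof.
elim: s => [|i s IH] h; first by apply: (dio_iff dio_True) => e _; split.
have hs : dio (fun e => forall i, i \in s -> A i e).
  by apply: IH => j js; apply: h; rewrite inE js orbT.
apply: (dio_iff (dio_and (h i (mem_head _ _)) hs)) => e _; split.
  by move=> [hi hj] j; rewrite inE => /orP[/eqP ->|/hj].
by move=> hj; split=> [|j js]; apply: hj; rewrite inE ?eqxx ?js ?orbT.
Qed.
End Conj.

Fixpoint wbound t := match t with
  | PW i => i.+1 | PA t u => maxn (wbound t) (wbound u) | PM t u => maxn (wbound t) (wbound u)
  | _ => 0%N end.

(** All parameters go to the variable 0: the translation is used with the constant environment t. *)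
Fixpoint to_mpoly n t : {mpoly algC[n.+1]} := match t with
  | PE _ => 'X_ord0 | PW i => 'X_(inord i.+1) | PC a => a%:MP
  | PA t u => to_mpoly n t + to_mpoly n u | PM t u => to_mpoly n t * to_mpoly n u end.

Lemma to_mpoly_eval n t (v : 'I_n.+1 -> algC) :
  (to_mpoly n t).@[v] = ev (fun=> v ord0) (fun i => v (inord i.+1)) t.
Proof.
elim: t => //= [i|i|a|t IH u IH'|t IH u IH'].
- by rewrite mevalXU.
- by rewrite mevalXU.
- by rewrite mevalC.
- by rewrite mevalD IH IH'.
by rewrite mevalM IH IH'.
Qed.

Lemma to_mpoly_coef n t m : okt t -> L (mcoeff m (to_mpoly n t)).
Proof.
have hX (i : 'I_n.+1) m' : L (mcoeff m' 'X_i).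
  by rewrite mcoeffX; case: (_ == _); [apply: sf1|apply: sf0].
elim: t m => //= [a|t IH u IH'|t IH u IH'] m.
- by move=> La; rewrite mcoeffC; case: (_ == _); rewrite ?mulr1 ?mulr0 //; apply: sf0.
- by move=> [h1 h2]; rewrite mcoeffD; apply: sfD => //; auto.
move=> [h1 h2]; rewrite mcoeffM; apply: (big_ind L) => [|x y|i _]; [exact: sf0|exact: sfD|].
by apply: sfM => //; auto.
Qed.

Lemma dio_diophantine (A : cset) : dio (fun e => A (e 0%N)) -> diophantine_over L A.
Proof.
move=> [F [t ht et] hA]; exists (wbound t), (to_mpoly (wbound t) t).
split=> [m|y Ly]; first exact: to_mpoly_coef.
have he : Lval (fun=> y) by [].
rewrite (hA _ he); split=> [[w hw eF]|[v [v0 [vL ev0]]]]; last first.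
  exists (fun i => v (inord i.+1)) => [i|]; first exact: vL.
  by rewrite -et -v0 -to_mpoly_eval.
pose v (i : 'I_(wbound t).+1) := if i is @Ordinal _ j.+1 _ then w j else y.
exists v; split => //; split => [[[|i] hi] //|]; first exact: hw.
rewrite to_mpoly_eval -eF -et.
have : forall u, (wbound u <= wbound t)%N ->
    ev (fun=> v ord0) (fun i => v (inord i.+1)) u = ev (fun=> y) w u.
  elim=> //= [i hi|u IH u' IH'|u IH u' IH'].
  - have e1 : (inord i.+1 : 'I_(wbound t).+1) = Ordinal (hi : (i.+1 < (wbound t).+1)%N).
      by apply: val_inj; rewrite /= inordK.
    by rewrite e1.
  - by rewrite geq_max => /andP[h1 h2]; rewrite IH // IH'.
  by rewrite geq_max => /andP[h1 h2]; rewrite IH // IH'.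
exact.
Qed.
End Dio.

(** * Descent to number fields, and properties of the set X *)

Section Support.
Variable L : cset.

(** The truth of A rests on finitely many elements of L; it therefore holds over some number field
    inside L that contains them. *)
Definition supp (A : cset -> Prop) := exists s : seq algC,
  (forall y, y \in s -> L y) /\ forall M : cset, (forall y, y \in s -> M y) -> A M.

Lemma supp_mem y : L y -> supp (fun M => M y).
Proof. by move=> Ly; exists [:: y]; split=> [z|M]; [rewrite inE => /eqP ->|apply; apply: mem_head]. Qed.

Lemma supp_and A B : supp A -> supp B -> supp (fun M => A M /\ B M).
Proof.
move=> [s [sL hA]] [t [tL hB]]; exists (s ++ t); split=> [y|M hM].
  by rewrite mem_cat => /orP[/sL|/tL].
by split; [apply: hA|apply: hB] => y h; apply: hM; rewrite mem_cat h ?orbT.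
Qed.

Lemma supp_impl (A B : cset -> Prop) : supp A -> (forall M, A M -> B M) -> supp B.
Proof. by move=> [s [sL hA]] h; exists s; split=> // M /hA /h. Qed.

Lemma supp_all (I : finType) (A : I -> cset -> Prop) :
  (forall i, supp (A i)) -> supp (fun M => forall i, A i M).
Proof.
move=> /fin_all_exists[s hs]; exists (flatten [seq s i | i : I]); split=> [y|M hM i].
  by move=> /flattenP[_ /mapP[i _ ->]]; have [h _] := hs i; apply: h.
have [_ h] := hs i; apply: h => y ys; apply: hM; apply/flattenP.
by exists (s i) => //; apply: map_f; rewrite mem_enum.
Qed.

Lemma Uset_supp l e rs v : Uset l e rs L v -> supp (fun M => Uset l e rs M v).
Proof.
move=> [r [f [kap [rr fM kp [x Lx ex]]]]].
apply: (supp_impl (supp_all (fun i => supp_mem (Lx i)))) => M Mx.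
by exists r, f, kap; split => //; exists x.
Qed.

Lemma Cset_supp l e rs b : Cset l e rs L b -> supp (fun M => Cset l e rs M b).
Proof.
move=> [vs [hvs eb]].
apply: (supp_impl (supp_all (fun i => supp_and (supp_mem (hvs i).1) (Uset_supp (hvs i).2)))).
by move=> M hM; exists vs.
Qed.

Lemma X0_supp l e rs D t : X0 l e rs D L t -> supp (fun M => X0 l e rs D M t).
Proof.
move=> [b [x [hb hx eq]]].
apply: (supp_impl (supp_and (Cset_supp hb) (Cset_supp hx))) => M [h1 h2].
by exists b, x.
Qed.
End Support.

(* [w] lists the naturals whose differences are the coordinates of a numerator on
   the generators [om] of O_Z and of a denominator minus 1 on the generators [ps] of pZ. *)
Definition dif (w : env) i := w i.*2 - w i.*2.+1.
Definition num_den (om ps : seq algC) (w : env) y :=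
  y * (1 + \sum_(j < size ps) dif w (size om + j) * ps`_j) = \sum_(i < size om) dif w i * om`_i.
Definition Xset (A : cset) (L : cset) (om ps : seq algC) (y : algC) := exists2 w, Lval L w &
  (forall i, i \in iota 0 (size om + size ps).*2 -> A (w i)) /\ num_den om ps w y.

Section XProps.
Variables (L Z pZ : cset) (l : nat) (A : cset -> cset) (om ps : seq algC).
Hypotheses (hL : is_subfield L) (nfZ : is_number_field Z) (ZL : csubset Z L).
Hypotheses (pP : is_prime_of Z pZ) (pl : prime l) (Pl : pZ l%:R).
Hypotheses (omO : forall y, y \in om -> ring_of_integers Z y) (psP : forall y, y \in ps -> pZ y).

Lemma Xset_integral y :
  (forall t, A L t -> supp L (fun M => A M t)) ->
  (forall M P, is_number_field M -> csubset Z M -> csubset M L -> is_prime_of M P ->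
    lies_above Z P pZ -> forall t, M t -> A M t -> Rloc M P t) ->
  L y -> Xset (A L) L om ps y -> integral_at L Z pZ y.
Proof.
move=> Asupp Aint Ly [w Lw [wA eq]]; set n := (size om + size ps)%N.
have [s [sL hs]] : supp L (fun M => M y /\ forall i : 'I_n.*2, M (w i) /\ A M (w i)).
  apply: supp_and; first exact: supp_mem.
  apply: supp_all => i; apply: supp_and; first exact: supp_mem.
  by apply: Asupp; apply: wA; rewrite mem_iota add0n ltn_ord.
have [M [nfM ZM ML sM]] := number_field_gen nfZ hL ZL sL.
have [My Mw] := hs M sM; exists M; do 4!split => //; move=> P pPM above.
have PlM : P l%:R by apply/above => //; apply: (P_O pP).
have [pi Ppi [pi0 npiV mdiv]] := uniformizer nfM pPM pl PlM.
apply: (Rloc_ord_ge0 nfM pPM pl PlM Ppi pi0 mdiv).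
have wR i : (i < n.*2)%N -> Rloc M P (w i).
  by move=> h; have [h1 h2] := Mw (Ordinal h); apply: (Aint M P).
have dR i : (i < n)%N -> Rloc M P (dif w i).
  by move=> h; apply: (RlocB nfM pPM); apply: wR; rewrite ?ltn_Sdouble ?ltn_double.
have R0 : Rloc M P 0 by apply: (Rloc_O nfM pPM); apply: roi0; case: nfM.
have m0 : mloc M P 0 by apply: (mloc_P nfM pPM); apply: P_0 pPM.
have RD a b : Rloc M P a -> Rloc M P b -> Rloc M P (a + b).
  by move=> ha hb; rewrite -[b]opprK -[- b]sub0r; do !apply: (RlocB nfM pPM).
have mD a b : mloc M P a -> mloc M P b -> mloc M P (a + b).
  by move=> ha hb; rewrite -[b]opprK -[- b]sub0r; do !apply: (mlocB nfM pPM).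
have OZM x : ring_of_integers Z x -> ring_of_integers M x by move=> [/ZM].
have hnum : Rloc M P (\sum_(i < size om) dif w i * om`_i).
  apply: (big_ind (Rloc M P)) => // i _; apply: (RlocM nfM pPM).
    by apply: dR; rewrite ltn_addr.
  by apply: (Rloc_O nfM pPM); apply: OZM; apply: omO; apply: mem_nth.
have hden : mloc M P (\sum_(j < size ps) dif w (size om + j) * ps`_j).
  apply: (big_ind (mloc M P)) => // i _; apply: (mlocM nfM pPM).
    by apply: dR; rewrite ltn_add2l.
  have pj : pZ ps`_i by apply: psP; apply: mem_nth.
  by apply: (mloc_P nfM pPM); apply/above => //; apply: (P_O pP).
move: eq; rewrite /num_den; move: hnum hden; set S := \sum_(_ < _) _; set T := \sum_(_ < _) _.
move=> hS hT eq; have n1 := mloc_1 nfM pPM.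
have nd : ~ mloc M P (1 + T).
  by move=> h; apply: n1; rewrite -[1](addrK T); apply: (mlocB nfM pPM).
have d0 : 1 + T != 0 by apply/eqP => e0; apply: nd; rewrite e0.
have -> : y = S * (1 + T)^-1 by rewrite -eq mulfK.
apply: (RlocM nfM pPM) => //; apply: (RlocV _ nd).
apply: RD; last exact: (mloc_R pPM).
by apply: (Rloc_O nfM pPM); apply: roi1; case: nfM.
Qed.

Definition posn (z : int) := if z is Posz n then n else 0%N.
Definition negn (z : int) := if z is Negz n then n.+1 else 0%N.

Lemma int_natB (z : int) : (posn z)%:R - (negn z)%:R = z%:~R :> algC.
Proof. by case: z => n /=; rewrite ?subr0 // NegzE rmorphN sub0r. Qed.

Lemma Xset_contains x : (forall n : nat, A L n%:R) ->
  (forall y, ring_of_integers Z y -> exists c, y = Zcomb om c) ->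
  (forall y, pZ y -> Zspan ps y) ->
  Z x -> integral_at L Z pZ x -> Xset (A L) L om ps x.
Proof.
move=> An omg psg Zx intx; have hZ := proj1 nfZ.
have [a [b [Oa Ob nPb ex]]] := integral_Rloc nfZ pP Zx intx.
have [c Oc Pc] := inv_modP nfZ pP pl Pl Ob nPb.
have [u eu] := omg _ (roiM hZ Oa Oc); have [v ev] := psg _ Pc.
pose z i := if (i < size om)%N then u i else v (i - size om)%N.
exists (mix (fun i => (posn (z i))%:R) (fun i => (negn (z i))%:R)).
  by move=> i; rewrite /mix; case: odd; apply: sf_nat.
split=> [i _|]; first by rewrite /mix; case: odd.
have dz i : dif (mix (fun i => (posn (z i))%:R) (fun i => (negn (z i))%:R)) i = (z i)%:~R.
  by rewrite -int_natB /dif -[X in X - _]/(evens _ i) -[X in _ - X]/(odds _ i) mix_evens mix_odds.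
have -> : num_den om ps (mix (fun i => (posn (z i))%:R) (fun i => (negn (z i))%:R)) x =
    (x * (1 + Zcomb ps v) = Zcomb om u).
  rewrite /num_den /Zcomb; congr (x * (1 + _) = _).
    by apply: eq_bigr => i _; rewrite dz /z ltnNge leq_addr /= addKn.
  by apply: eq_bigr => i _; rewrite dz /z ltn_ord.
have b0 : b != 0 := nP_neq0 pP nPb.
by rewrite -eu -ev ex addrC subrK mulrA divfK.
Qed.
End XProps.

(** * Diophantine definitions of the sets *)

Section DioSets.
Variable L : cset.
Hypothesis hL : is_subfield L.
Local Notation isP := (isP L).
Local Notation dio := (dio L).

Lemma dio_at (A : cset) (f : env -> algC) : dio (fun e => A (e 0%N)) -> isP (fun e _ => f e) ->
  dio (fun e => A (f e)).
Proof. by move=> hA hf; apply: (dio_sub hL (f := fun=> f) hA (fun=> hf)). Qed.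

Lemma cyclo_mx_L d n i j : L ((cyclo_mx algC d ^+ n) i j).
Proof.
elim: n i j => [|n IH] i j; first by rewrite expr0 mxE; case: (i == j); [apply: sf1|apply: sf0].
rewrite exprS mxE; apply: (big_ind L) => [|x y|k _]; [exact: sf0|exact: sfD|].
apply: sfM => //; rewrite mxE; case: ifP => _; first exact: sf1.
by case: ifP => _; [apply: sfN => //; apply: sf1|apply: sf0].
Qed.

Lemma isP_nform d : isP (fun _ w => nform (fun i : 'I_d.+1 => w i)).
Proof.
apply: isP_sum => // s; apply: isP_M.
  by apply: isP_C; apply: sfX => //; apply: sfN => //; apply: sf1.
apply: isP_prod => // i.
apply: (isP_eq (F := fun _ w => \sum_(j < d.+1) w j * (cyclo_mx algC d ^+ j) i (s i))).
  by apply: isP_sum => // j; apply: isP_M; [apply: isP_W|apply: isP_C; apply: cyclo_mx_L].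
by move=> e w; rewrite summxE; apply: eq_bigr => j _; rewrite mxE.
Qed.

(** A finite disjunction over r, f and kappa; positivity of [cofexp e r] makes its divisors a finite
    list. *)
Lemma dio_Uset l e rs : (forall r, r \in rs -> (0 < cofexp e r)%N) ->
  dio (fun v => Uset l e rs L (v 0%N)).
Proof.
move=> hc; pose kaps r := [seq k <- [seq Posz n | n <- iota 0 (kbound r.-2).+1] ++
  [seq - Posz n | n <- iota 0 (kbound r.-2).+1] | kappa_ok l r k].
have h (r f : nat) (kap : int) : dio (fun v : env => exists2 w, Lval L w &
    nform (fun i : 'I_r.-2.+1 => w i) - kap%:~R * v 0%N ^+ f = 0).
  apply: dio_eq; apply: isP_B => //; first exact: isP_nform.
  by apply: isP_M; [apply: isP_C; apply: sf_int|apply: isP_X => //; apply: isP_E].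
have h2 := dio_exists hL (fun r (rr : r \in rs) => dio_exists hL
  (fun f (ff : f \in divisors (cofexp e r)) =>
     dio_exists hL (fun kap (kk : kap \in kaps r) => h r f kap))).
apply: (dio_iff h2) => v _; split=> [[r rr [f ff [kap]]]|[r [f [kap [rr ff kk [x Lx ex]]]]]].
  rewrite mem_filter => /andP[kk _] [w Lw /eqP]; rewrite subr_eq0 => /eqP ew.
  exists r, f, kap; split => //; first by rewrite dvdn_divisors // hc.
  by exists (fun i => w i) => // i; apply: Lw.
exists r => //; exists f; first by rewrite -dvdn_divisors // hc.
exists kap.
  rewrite mem_filter kk; case/and3P: kk => _ + _; rewrite mem_cat -ltnS.
  case: kap {ex} => n hn; apply/orP; [left|right].
    by apply: map_f; rewrite mem_iota.
  by rewrite NegzE; apply/mapP; exists n.+1; rewrite // mem_iota.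
exists (fun i => x (inord i)) => [i|]; first exact: Lx.
apply/eqP; rewrite subr_eq0 -ex; apply/eqP; congr (\det _).
by apply: eq_bigr => i _; rewrite inord_val.
Qed.

Section Aniso.
Variables (D : nat) (c : algC).
Hypotheses (D0 : (0 < D)%N) (Lc : L c)
  (aniso : forall a b, L a -> L b -> a ^+ D = c * b ^+ D -> a = 0 /\ b = 0).
Let dand := dio_and hL D0 Lc aniso.

(** The family is read at even places because [dio_ex] puts the quantified sequence there. *)
Lemma dio_family (A : cset) n : dio (fun e => A (e 0%N)) ->
  dio (fun e => forall i, i \in iota 0 n -> A (e i.*2)).
Proof.
move=> hA; apply: (dio_forall hL D0 Lc aniso (A := fun i e => A (e i.*2))) => i _.
by apply: dio_at => //; apply: isP_E.
Qed.

Lemma dio_prod (A : cset) n : dio (fun e => A (e 0%N)) ->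
  dio (fun e => exists2 w, Lval L w &
    (forall i, i \in iota 0 n -> A (w i)) /\ e 0%N = \prod_(i < n) w i).
Proof.
move=> hA; have hB : dio (fun e => (forall i, i \in iota 0 n -> A (e i.*2)) /\
    e 1%N = \prod_(i < n) e (i : nat).*2).
  apply: dand; first exact: dio_family.
  by apply: dio_eq0 => //; [apply: isP_E|apply: isP_prod => // i; apply: isP_E].
apply: (dio_iff (dio_ex hB)) => e _; split=> [[w Lw [h1 h2]]|[w Lw [h1 h2]]]; exists w => //.
  split=> [i /h1|]; first by rewrite -[mix _ _ _]/(evens _ i) mix_evens.
  by move: h2; under eq_bigr do rewrite -[mix _ _ _]/(evens _ _) mix_evens.
split=> [i /h1|]; first by rewrite -[mix _ _ _]/(evens _ i) mix_evens.
by under eq_bigr do rewrite -[mix _ _ _]/(evens _ _) mix_evens.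
Qed.

Lemma dio_Cset l e rs : (forall r, r \in rs -> (0 < cofexp e r)%N) ->
  dio (fun v => Cset l e rs L (v 0%N)).
Proof.
move=> hc; have := dio_prod 735 (dio_Uset l hc); rewrite /Cset; move: 735%N => n hn.
apply: (dio_iff hn) => v _; split=> [[w Lw [h1 h2]]|[vs [h1 h2]]].
  by exists (fun i => w i); split=> // i; split; [apply: Lw|apply: h1; rewrite mem_iota /=].
exists (fun i => oapp vs 0 (insub i)) => [i|].
  by case: insub => [j|] /=; [apply: (h1 j).1|apply: sf0].
split=> [i|]; last by rewrite h2; apply: eq_bigr => i _; rewrite valK.
by rewrite mem_iota /= add0n => hi; rewrite insubT; apply: (h1 _).2.
Qed.

Lemma dio_X0 l e rs d : (forall r, r \in rs -> (0 < cofexp e r)%N) ->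
  dio (fun v => X0 l e rs d L (v 0%N)).
Proof.
move=> hc; have hC := dio_Cset l hc.
have Llam : L (lam l rs)%:R by apply: sf_nat.
(* After interleaving, the places 0, 1 and 2 hold b, the parameter t and x. *)
have hB : dio (fun v => (Cset l e rs L (v 0%N) /\ Cset l e rs L (v 2)) /\
    (1 + (lam l rs)%:R * v 1%N ^+ d) * v 0%N = 1 + (lam l rs)%:R ^+ 2 * v 2).
  apply: dand; first by apply: dand; apply: dio_at => //; apply: isP_E.
  apply: dio_eq0 => //.
    apply: isP_M; last exact: isP_E.
    apply: isP_D; first by apply: isP_C; apply: sf1.
    by apply: isP_M; [apply: isP_C|apply: isP_X => //; apply: isP_E].
  apply: isP_D; first by apply: isP_C; apply: sf1.
  by apply: isP_M; [apply: isP_C; apply: sfX|apply: isP_E].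
apply: (dio_iff (dio_ex hB)) => v _; split=> [[w Lw [[h1 h2] h3]]|[b [x [h1 h2 h3]]]].
  by exists (w 0%N), (w 1%N).
exists (fun i => if i is 0 then b else x); last by [].
have Lb s : Cset l e rs L s -> L s.
  move=> [vs [hv ->]]; apply: (big_ind L) => [|y z|i _]; [exact: sf1|exact: sfM|].
  by case: (hv i).
by case=> [|i]; apply: Lb.
Qed.

Lemma dio_Xset (A : cset) om ps : (forall y, y \in om -> L y) -> (forall y, y \in ps -> L y) ->
  dio (fun e => A (e 0%N)) -> dio (fun e => Xset A L om ps (e 0%N)).
Proof.
move=> hom hps hA; pose d (w : env) i := w i.*2.*2 - w i.*2.+1.*2.
have isd i : isP (fun e _ => d e i) by apply: isP_B => //; apply: isP_E.
have hB : dio (fun e => (forall i, i \in iota 0 (size om + size ps).*2 -> A (e i.*2)) /\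
    e 1%N * (1 + \sum_(j < size ps) d e (size om + j)%N * ps`_j) = \sum_(i < size om) d e i * om`_i).
  apply: dand; first exact: dio_family.
  apply: dio_eq0 => //.
    apply: isP_M; first exact: isP_E.
    apply: isP_D; first by apply: isP_C; apply: sf1.
    apply: isP_sum => // j; apply: isP_M => //.
    by apply: isP_C; apply: hps; apply: mem_nth.
  apply: isP_sum => // j; apply: isP_M => //.
  by apply: isP_C; apply: hom; apply: mem_nth.
have dm w e i : d (mix w e) i = dif w i.
  by rewrite /d /dif -[mix _ _ _]/(evens _ i.*2) -[X in _ - X]/(evens _ i.*2.+1) !mix_evens.
have s1 w e : \sum_(j < size ps) d (mix w e) (size om + j)%N * ps`_j =
    \sum_(j < size ps) dif w (size om + j)%N * ps`_j by apply: eq_bigr => j _; rewrite dm.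
have s2 w e : \sum_(i < size om) d (mix w e) i * om`_i = \sum_(i < size om) dif w i * om`_i.
  by apply: eq_bigr => j _; rewrite dm.
have hm w e i : mix w e i.*2 = w i by rewrite -[mix _ _ _]/(evens _ i) mix_evens.
apply: (dio_iff (dio_ex hB)) => e _; rewrite /Xset /num_den.
split=> [[w Lw [h1 h2]]|[w Lw [h1 h2]]]; exists w => //.
  by split; [move=> i /h1; rewrite hm|rewrite -(s1 w e) -(s2 w e)].
by split; [move=> i /h1; rewrite hm|rewrite s1 s2].
Qed.
End Aniso.
End DioSets.

(* At a prime above pZ the order of the coefficient [lam] is positive and smaller than [q ^ B],
   so [a ^ q ^ B] and [lam * b ^ q ^ B] have different orders. *)
Lemma lam_aniso (L Z pZ : cset) (l q k B s n0 me : nat) (rs : seq nat) :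
  is_subfield L -> is_number_field Z -> csubset Z L -> is_prime_of Z pZ -> prime l -> pZ l%:R ->
  (forall M P e, is_number_field M -> csubset Z M -> csubset M L ->
      is_prime_of M P -> lies_above Z P pZ -> ram_index M P pZ e -> (e <= me)%N) ->
  (forall x, ring_of_integers Z x -> exists i e z,
    [/\ (i <= n0)%N, (0 < e)%N, ring_of_integers Z z & x ^+ i * (1 - x ^+ e) = l%:R * z]) ->
  (forall r, r \in rs -> [/\ prime r, r != l, (q ^ k %| r.-1)%N & exists n,
    (forall m, (l ^ m = 1 %[mod r])%N -> (q ^ n %| m)%N) /\ ~~ (q ^ (s + n) %| r.-1)%N]) ->
  (4 * (n0 * me) < q ^ B)%N ->
  forall a b, L a -> L b -> a ^+ (q ^ B) = (lam l rs)%:R * b ^+ (q ^ B) -> a = 0 /\ b = 0.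
Proof.
move=> hL nfZ ZL pP pl Pl meP pig prs QB a b La Lb eq.
have D0 : (0 < q ^ B)%N by apply: leq_ltn_trans QB.
have [b0|b0] := eqVneq b 0.
  by move: eq; rewrite b0 expr0n gtn_eqF // mulr0 => /eqP; rewrite expf_eq0 => /andP[_ /eqP].
exfalso; have sL y : y \in [:: a; b] -> L y by rewrite !inE => /orP[] /eqP ->.
have [M [nfM ZM ML sM]] := number_field_gen nfZ hL ZL sL.
have [P [pPM above]] := lying_over nfZ pP nfM ZM pl Pl.
have PlM : P l%:R by apply/above => //; apply: (P_O pP).
have [pi Ppi [pi0 npiV mdiv]] := uniformizer nfM pPM pl PlM.
have [E hE [E0 EQ]] := lam_ord pP nfM ZM pPM above pl Pl (fun e => meP M P e nfM ZM ML pPM above)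
  pig Ppi pi0 npiV mdiv prs QB.
have Ma : M a by apply: sM; rewrite !inE eqxx.
have Mb : M b by apply: sM; rewrite !inE eqxx orbT.
have a0 : a != 0.
  apply: contraNneq b0 => a0; move/eqP: eq; rewrite a0 expr0n gtn_eqF // eq_sym mulf_eq0.
  by rewrite (negPf (ord_neq0 nfM pPM hE)) expf_eq0 => /andP[_].
have [x hx] := ord_exists nfM pPM Ppi pi0 npiV mdiv Ma a0.
have [y hy] := ord_exists nfM pPM Ppi pi0 npiV mdiv Mb b0.
have h1 := ordX nfM pPM pi0 (q ^ B) hx.
have := ordM nfM pPM pi0 hE (ordX nfM pPM pi0 (q ^ B) hy); rewrite -eq.
move=> /(ord_inj nfM pPM Ppi pi0 npiV h1) e1.
apply: (@no_multiple (q ^ B)%N E (y - x) E0).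
  by apply: le_lt_trans EQ; rewrite ler_peMr // ltW.
by rewrite mulrBl addrA -e1 subrr.
Qed.

(** * Assembly of the set from the parameters *)

Theorem theorem3p8 (L Z pZ : cset) (q : nat) :
  is_subfield L ->
  is_number_field Z -> csubset Z L -> normal_over L Z ->
  prime q -> (2 < q)%N ->
  is_prime_of Z pZ -> ~ pZ q%:R ->
  (exists mf : nat, forall M P f, is_number_field M -> csubset Z M -> csubset M L ->
      is_prime_of M P -> lies_above Z P pZ -> rel_degree M Z P pZ f ->
      (logn q f <= mf)%N) ->
  (exists me : nat, forall M P e, is_number_field M -> csubset Z M -> csubset M L ->
      is_prime_of M P -> lies_above Z P pZ -> ram_index M P pZ e ->
      (e <= me)%N) ->
  exists X : cset,
    csubset X L /\
    (forall x, X x -> integral_at L Z pZ x) /\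
    (forall x, Z x -> integral_at L Z pZ x -> X x) /\
    diophantine_over L X.
Proof.
move=> hL nfZ ZL _ pq q2 pP npq [mf hmf] [me hme].
have [l pl Pl] := P_has_prime nfZ pP.
have lq : l != q by apply/eqP => e; apply: npq; rewrite -e.
have [N rcZ] := residue_card_exists nfZ pP pl Pl.
have [f0 eN] : exists f0, N = (l ^ f0)%N.
  have [t [st [tO [tE tc]]]] := rcZ; rewrite -st in tE.
  have [kk [c [ck c1 cs ce cm]]] := residue_field nfZ pP pl Pl tO tE tc.
  rewrite -st -ck; apply: card_pfield => //.
  have hZ := proj1 nfZ; rewrite -(cls_nat hZ c1 cm) -(cls_0 hZ cm).
  by apply/ce; [apply: (P_O pP)|apply: roi0|rewrite subr0].
have [n0 pig] := pigeonhole_powers nfZ (prime_gt0 pl).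
(* The q-part of f0 is added to [mf] because the hypothesis bounds degrees over pZ, while the order
   of l modulo r sees degrees over l. *)
have [k [B [s [rs [kB QB urs [rs0 few] prs]]]]] :=
  sieve_parameters (logn q f0 + mf) (4 * (n0 * me)) pl pq q2 lq.
have [om [omO omg]] := O_fg nfZ; have [ps [psP psg]] := P_fg nfZ pP pl Pl.
pose A K := X0 l (q ^ k) rs (q ^ B) K.
have D0 : (0 < q ^ B)%N by apply: leq_ltn_trans QB.
have hc r : r \in rs -> (0 < cofexp (q ^ k) r)%N.
  move=> /prs[/prime_gt1 r1 _ qr _]; have r0 : (0 < r.-1)%N by rewrite -subn1 subn_gt0.
  by rewrite divn_gt0 ?expn_gt0 ?prime_gt0 // dvdn_leq.
have psL y : y \in ps -> L y by move=> /psP /(P_O pP)[/ZL].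
have aniso := lam_aniso hL nfZ ZL pP pl Pl hme pig prs QB.
exists (fun y => L y /\ Xset (A L) L om ps y); split; first by move=> y [].
split.
  move=> y [Ly Xy]; apply: (Xset_integral hL nfZ ZL pP pl Pl omO psP _ _ Ly Xy).
    by move=> t; apply: X0_supp.
  move=> M P nfM ZM ML pPM above t Mt.
  have PlM : P l%:R by apply/above => //; apply: (P_O pP).
  have [pi Ppi [pi0 npiV mdiv]] := uniformizer nfM pPM pl PlM.
  apply: (X0_integral nfZ pP nfM ZM pPM above pl Pl pq rcZ eN _ _ pig Ppi pi0 npiV mdiv prs kB QB Mt).
    by move=> f; apply: hmf.
  by move=> e; apply: hme.
split.
  move=> x Zx intx; split; first exact: ZL.
  apply: (@Xset_contains L Z pZ l A om ps hL nfZ pP pl Pl x _ omg psg Zx intx) => n.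
  apply: X0_nat => //; first by move=> r /prs[].
  by apply/allP => r /prs[].
have hX : dio L (fun e => Xset (A L) L om ps (e 0%N)).
  apply: (dio_Xset hL D0 _ aniso) => //; first exact: sf_nat.
    by move=> y /omO[/ZL].
  exact: (dio_X0 hL D0 (sf_nat hL _) aniso l (q ^ B) hc).
by apply: (dio_diophantine hL); apply: (dio_iff hX) => e he; split=> [|[]].
Qed.
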